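(* Consider the free cancel-on-completion particle systems. Suppose the component sizes have finite second moments, i.e. $\mathbb E[\xi^{(j)}_1]^2<\infty$ for every $j$, and the following non-triviality assumption holds: there exists a class $j$ with $k_j<d_j$ and $F_j$ such that (i) $\mathbb P\{\max_i\xi^{(j)}_i-\xi^{(j)}_{i_1}>0\}>0$, where $\xi^{(j)}_{i_1}$ is the $k_j$-th smallest among the $\xi^{(j)}_i$; and (ii) $\mathbb P\{\sum_i\mathbf 1(\xi^{(j)}_i=0)\ge k_j\}<1$. Suppose further that, for all large $n$, for any $C>0$ the (closed) set $\{|p^n|\le C\}$ is small for $p^n(\cdot)$. Then there exist $\bar C>0$ and $\bar n$ such that for all $n\ge\bar n$ the centered process $\mathring x^n(\cdot)$ (with any $\lambda^n>0$) is positive recurrent and, moreover, $$\mathbb E\,\Phi_1(\mathring x^n(\infty))\le\bar C .$$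
   Context: Free system. There are $n$ particles with locations $W_1(t),\dots,W_n(t)\in\mathbb R$ (not bounded below), and a finite set of job classes $j$ (not depending on $n$). Jobs arrive as a Poisson process of rate $\lambda^nn$; an arriving job is of class $j$ with probability $\pi^n_j\ge0$, $\sum_j\pi^n_j=1$, and $\pi^n_j\to\pi_j$ as $n\to\infty$. Class $j$ has integers $1\le k_j\le d_j$ and an exchangeable distribution $F_j$ on $\mathbb R_+^{d_j}$. A class $j$ job selects $d_j$ particles uniformly at random without replacement, with component sizes $(\xi^{(j)}_1,\ldots,\xi^{(j)}_{d_j})\sim F_j$ drawn independently of the past; if the selected particles are at $W_1,\dots,W_{d_j}$ just before the arrival and $T$ is the $k_j$-th smallest of $W_i+\xi^{(j)}_i$, then selected particle $i$ jumps to $\max\{W_i,\min\{W_i+\xi^{(j)}_i,T\}\}$. Between arrivals all particles move left at constant speed 1. Centered process. $p^n(t)=(w_1(t),\dots,w_n(t))\in\mathbb R^n$, $w_i(t)=W_i(t)-\frac1n\sum_lW_l(t)$; $\mathring x^n(t)$ is the empirical complementary distribution function of $w_1(t),\dots,w_n(t)$, i.e. $\mathring x^n_u(t)=\frac1n\sum_i\mathbf 1\{w_i(t)>u\}$, $u\in\mathbb R$. It is a Markov process changing state only at job arrivals, and $p^n(\cdot)$ is an equivalent description of it. $|p|=\sum_i|p_i|$. $\Phi_1(\mathring x^n)=\frac1n\sum_i|w_i|$. Positive recurrent means positive Harris recurrent; $\mathring x^n(\infty)$ denotes a random element with the stationary distribution. A set $B\subset\mathbb R^n$ is small for $p^n(\cdot)$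 if there exist $\tau>0$ and a (nonzero) finite measure $\mathcal M$ on $\mathbb R^n$ such that, uniformly over the initial states $p^n(0)\in B$, the distribution of $p^n(\tau)$ dominates $\mathcal M$. Standing assumptions: $0<\mathbb E\xi^{(j)}_1<\infty$ for all $j$; there exists a class $j$ with $\mathbb P\{\sum_i \mathbf 1(\xi^{(j)}_i=0)\ge k_j\}<1$.
   Formalization: The class j in the non-triviality assumption is also required to have limiting probability π_j>0; otherwise it may never occur, and the claim fails (e.g. if all arriving jobs have d=k=1, giving independent walks). *)

(* Defs.v *)
From HB Require Import structures.
From mathcomp Require Import all_boot all_order all_algebra.
From mathcomp Require Import fingroup perm.
From mathcomp Require Import all_classical all_reals all_analysis.

Set Implicit Arguments.
Unset Strict Implicit.
Unset Printing Implicit Defensive.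

Import Order.TTheory GRing.Theory Num.Theory.
Import numFieldNormedType.Exports.

Local Open Scope classical_set_scope.
Local Open Scope ring_scope.

(* R^n is [n.-tuple R], which carries the Borel (product) sigma-algebra. *)

Section Vectors.
Context {R : realType}.

Definition kth_smallest (k : nat) (s : seq R) : R :=
  nth 0 (sort <=%R s) k.-1.

(* The default value is the head of [s], so this is the true maximum of any
   nonempty sequence. *)
Definition max_entry (s : seq R) : R := \big[Num.max/head 0 s]_(y <- s) y.

Definition translate n (a : R) (w : n.-tuple R) : n.-tuple R :=
  [tuple tnth w i + a | i < n].

Definition mean n (w : n.-tuple R) : R := n%:R^-1 * \sum_(i < n) tnth w i.

Definition centering n (w : n.-tuple R) : n.-tuple R := translate (- mean w) w.

Definition l1norm n (p : n.-tuple R) : R := \sum_(i < n) `|tnth p i|.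

Definition Phi1 n (p : n.-tuple R) : R := n%:R^-1 * l1norm p.

(* Complementary distribution functions are functions [R -> R], with the
   sigma-algebra generated by the evaluations [x |-> x u]. *)
Definition evaluation_sets : set (set (R -> R)) :=
  [set A | exists u : R, exists2 B : set R,
     measurable B & A = (fun x : R -> R => x u) @^-1` B].

Definition ccdf_space := g_sigma_algebraType evaluation_sets.

Definition empirical_ccdf n (w : n.-tuple R) : ccdf_space :=
  fun u : R => n%:R^-1 * \sum_(i < n) (u < tnth w i)%R%:R.

End Vectors.

Section JobClasses.
Context (R : realType) (J : finType).

Record job_classes := JobClasses {
  jc_d : J -> nat;
  jc_k : J -> nat;
  jc_F : forall j, probability ((jc_d j).-tuple R) R;
  jc_k_gt0 : forall j, (0 < jc_k j)%N;
  jc_k_le_d : forall j, (jc_k j <= jc_d j)%N;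
  jc_F_ge0 : forall j,
    jc_F j [set x : (jc_d j).-tuple R | forall i, 0 <= tnth x i] = 1%E;
  jc_F_exchangeable : forall j (s : {perm 'I_(jc_d j)})
    (A : set ((jc_d j).-tuple R)), measurable A ->
    jc_F j [set x : (jc_d j).-tuple R | A [tuple tnth x (s i) | i < jc_d j]]
    = jc_F j A
}.

(* The effect of an arrival: [sel] lists the selected particles, [x] their
   component sizes, [w] the locations just before the arrival. *)
Definition jump n (d k : nat) (sel : {ffun 'I_d -> 'I_n}) (x : d.-tuple R)
    (w : n.-tuple R) : n.-tuple R :=
  let T := kth_smallest k
             [seq tnth w (sel a) + tnth x a | a <- enum 'I_d] in
  [tuple if [pick a | sel a == i] is Some a
         then Num.max (tnth w i) (Num.min (tnth w i + tnth x a) T)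
         else tnth w i | i < n].

End JobClasses.

Section Independence.
Context {d : measure_display} {Omega : measurableType d} {R : realType}.

Definition mutually_independent (P : probability Omega R) (I : eqType)
    (G : I -> set (set Omega)) : Prop :=
  forall (s : seq I) (A : I -> set Omega), uniq s ->
    (forall i, i \in s -> G i (A i)) ->
    P (\bigcap_(i in [set` s]) A i) = (\prod_(i <- s) P (A i))%E.

(* Events determined by a random element of a discrete space. *)
Definition discrete_events (T : Type) (X : Omega -> T) : set (set Omega) :=
  [set X @^-1` B | B in [set: set T]].

End Independence.

Section System.
Context {R : realType} {J : finType}.

(* The randomness driving the system of n particles: i.i.d. exponential gaps
   between the arrivals, and for every arrival its class, and for every class j
   an ordered selection of d_j distinct particles and a vector of component
   sizes. At an arrival of class j only the selection and sizes attached to j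
   are used, so drawing them for all classes does not affect the law of the
   system. All these variables are independent of each other. *)
Record driving (c : job_classes R J) (n : nat) (rate : R) (p : J -> R)
    (d : measure_display) (Omega : measurableType d)
    (P : probability Omega R) := Driving {
  gap : nat -> Omega -> R;
  cls : nat -> Omega -> J;
  sel : nat -> forall j, Omega -> {ffun 'I_(jc_d c j) -> 'I_n};
  xi : nat -> forall j, Omega -> (jc_d c j).-tuple R;
  gap_measurable : forall m, measurable_fun setT (gap m);
  cls_measurable : forall m j, measurable (cls m @^-1` [set j]);
  sel_measurable : forall m j f, measurable (sel m j @^-1` [set f]);
  xi_measurable : forall m j, measurable_fun setT (xi m j);
  gap_law : forall m (A : set R), measurable A ->
    P (gap m @^-1` A) = exponential_prob rate A;
  cls_law : forall m j, P (cls m @^-1` [set j]) = (p j)%:E;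
  sel_law : forall m j (f : {ffun 'I_(jc_d c j) -> 'I_n}), injective f ->
    P (sel m j @^-1` [set f]) = (((n ^_ jc_d c j)%:R : R)^-1)%:E;
  xi_law : forall m j (A : set ((jc_d c j).-tuple R)), measurable A ->
    P (xi m j @^-1` A) = jc_F c j A;
  driving_independent :
    mutually_independent P
      (fun i : (nat + nat) + (nat * J + nat * J) => match i with
       | inl (inl m) => preimage_set_system setT (gap m) measurable
       | inl (inr m) => discrete_events (cls m)
       | inr (inl (m, j)) => discrete_events (sel m j)
       | inr (inr (m, j)) => preimage_set_system setT (xi m j) measurable
       end)
}.

Context {c : job_classes R J} {n : nat} {rate : R} {p : J -> R}
  {d : measure_display} {Omega : measurableType d} {P : probability Omega R}
  (D : driving c n rate p P).

(* Time of the m-th arrival, m >= 1; equal to 0 for m = 0. *)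
Definition arrival_time (m : nat) (omega : Omega) : R :=
  \sum_(i < m) gap D i omega.

(* Number of arrivals in ]0, t]; the set below has at most one element, and it
   is empty only on the null event of infinitely many arrivals before t. *)
Definition arrivals (t : R) (omega : Omega) : nat :=
  xget 0%N [set m | t < arrival_time m.+1 omega /\
                    forall i, (i < m)%N -> arrival_time i.+1 omega <= t].

(* Locations just after the m-th arrival, from the initial locations [w]. *)
Fixpoint after_arrival (w : n.-tuple R) (m : nat) (omega : Omega)
    : n.-tuple R :=
  if m is m'.+1 then
    let j := cls D m' omega in
    jump (jc_k c j) (sel D m' j omega) (xi D m' j omega)
      (translate (- gap D m' omega) (after_arrival w m' omega))
  else w.

(* W(t), for W(0) = w. *)
Definition particles (w : n.-tuple R) (t : R) (omega : Omega) : n.-tuple R :=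
  let m := arrivals t omega in
  translate (- (t - arrival_time m omega)) (after_arrival w m omega).

(* p^n(t), for W(0) = w; the initial state is p^n(0) = centering w. *)
Definition centered (w : n.-tuple R) (t : R) (omega : Omega) : n.-tuple R :=
  centering (particles w t omega).

Definition centered_ccdf (w : n.-tuple R) (t : R) (omega : Omega)
    : @ccdf_space R :=
  empirical_ccdf (centered w t omega).

Definition small_set (B : set (n.-tuple R)) : Prop :=
  exists2 tau : R, 0 < tau &
  exists2 M : {finite_measure set (n.-tuple R) -> \bar R}, (0 < M setT)%E &
    forall w, B (centering w) -> forall A, measurable A ->
      (M A <= P [set omega | A (centered w tau omega)])%E.

End System.

(* [X w] is the trajectory, with values in E, of a Markov process started from
   the state described by w; every initial state is described by some w. *)
Section Recurrence.
Context {R : realType} {d d1 d2 : measure_display} {Omega : measurableType d}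
  {T : measurableType d1} {E : measurableType d2}.
Variables (P : probability Omega R) (X : T -> R -> Omega -> E).

(* Harris recurrence: some nonzero sigma-finite phi is such that every set A
   with phi(A) > 0 is occupied for an infinite time, almost surely from every
   initial state. It is positive if moreover there is an invariant probability
   measure. *)
Definition occupation_time (A : set E) (w : T) (omega : Omega) : \bar R :=
  lebesgue_measure [set t : R | 0 <= t /\ A (X w t omega)].

Definition harris_recurrent : Prop :=
  exists phi : {measure set E -> \bar R},
    [/\ sigma_finite setT phi, (0 < phi setT)%E &
      forall A, measurable A -> (0 < phi A)%E ->
      forall w, {ae P, forall omega, occupation_time A w omega = +oo%E}].

(* The process is stationary when its initial state is described by a random
   element of law nu. *)
Definition stationary (nu : probability T R) : Prop :=
  forall t, 0 <= t -> forall A, measurable A ->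
    (\int[nu]_w P [set omega | A (X w t omega)]
     = \int[nu]_w P [set omega | A (X w 0 omega)])%E.

Definition positive_harris_recurrent : Prop :=
  harris_recurrent /\ exists nu, stationary nu.

End Recurrence.

(* Main.v *)
(* The Lyapunov function is the energy V(w), the sum of the squares of the
   centered locations. Swapping a selected particle with another one shows that,
   on average, a particle moves at least as far when it is lower, so that
   displacement and location are negatively correlated; the non-triviality
   assumption makes this strict for spread out configurations. Hence one arrival
   satisfies QV <= V - eps Phi1 + C, with eps and C independent of n.

   Centering removes the drift between arrivals, so the centered process is the
   jump chain Q observed at independent Poisson times, and smallness for one
   arrival rate minorizes the resolvent of Q, whatever the rate. With Foster's
   criterion this gives infinitely many visits to every charged set, and
   regeneration (Nummelin splitting without enlarging the space) gives an
   invariant law.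

   An arbitrary stationary law need not have a finite mean energy, so its moment
   is bounded by applying the drift to min(V, K) over a short time: this function
   is bounded and depends only on the empirical distribution, so stationarity
   cancels its mean, and K tends to infinity. *)
Require Import Defs.
From HB Require Import structures.
From mathcomp Require Import all_boot all_order all_algebra.
From mathcomp Require Import fingroup perm.
From mathcomp Require Import all_classical all_reals all_analysis.
From mathcomp Require Import measurable_realfun.
From mathcomp Require Import ring lra.

Set Implicit Arguments.
Unset Strict Implicit.
Unset Printing Implicit Defensive.

Import Order.TTheory GRing.Theory Num.Theory.
Import numFieldNormedType.Exports.

Local Open Scope classical_set_scope.
Local Open Scope ring_scope.

(** * Exchange of particles and the quadratic energy *)

(** Strictness rests on a lower bound for the effect of one exchange. Let all sizes be at most [L],
    let [s a] be the lowest selected particle, and let [i], unselected, lie above the whole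
    selection and at least 2 L above [s a]. If at least k of the other selected particles lie at or
    below [w i - L], they end at or below [w i]; then [i], put in place of [s a], would not move,
    while [s a] moves at least min (x a) (k-th smallest size), which is positive with positive
    probability by condition (ii). Otherwise [s a] makes its whole jump [x a], while [i] would move
    at most min (x a) (k-th smallest size); by condition (i) the difference is positive with
    positive probability. Each condition thus settles one of the two configurations.

    Uniformity in n comes from comparing only d + 1 particles at a time: putting the highest of them
    outside the selection costs a factor d + 1, and the sizes enter through events whose
    probabilities do not involve n. *)

Section OrderStatistics.
Context {R : realType}.
Implicit Types (s : seq R) (u : R).

(** Order statistics are handled through counts from here on, both in estimates and for
    measurability. In the sorted list the entries up to index k are at most the k-th one; if that
    one exceeds u, so do all later ones, and only k candidates remain. *)
Lemma nth_sort_le s k u : (k < size s)%N ->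
  (nth 0 (sort <=%R s) k <= u) = (k < count (fun y => (y <= u)%R) s)%N.
Proof.
move=> ks; set t := sort <=%R s.
have srt : sorted <=%R t by apply: sort_le_sorted.
have szt : size t = size s by rewrite size_sort.
have mono i j : (i <= j)%N -> (j < size t)%N -> nth 0 t i <= nth 0 t j.
  move=> ij js; apply: (sorted_leq_nth le_trans lexx) => //.
  by rewrite inE (leq_ltn_trans ij).
rewrite -(seq.permP (permEl (perm_sort <=%R s))) -/t.
rewrite -{2}(cat_take_drop k.+1 t) count_cat.
apply/idP/idP => [le_u|].
  apply: (@leq_trans (size (take k.+1 t))).
    by rewrite size_takel// szt.
  apply: leq_trans (leq_addr _ _).
  rewrite -count_predT; apply/eq_leq/eq_in_count => y /(nthP 0)[i].
  rewrite size_takel ?szt// => ik <-; rewrite nth_take//= (le_trans _ le_u)//.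
  by apply: mono => //; rewrite szt.
apply: contraTT; rewrite -ltNge -leqNgt => lt_u.
rewrite (_ : take k.+1 t = rcons (take k t) (nth 0 t k)); last first.
  by rewrite (take_nth 0)// szt.
rewrite -cats1 count_cat /= leNgt lt_u /= addn0.
have -> : count (fun y => y <= u) (drop k.+1 t) = 0%N.
  rewrite (@eq_in_count _ _ pred0) ?count_pred0// => y /(nthP 0)[i].
  rewrite size_drop szt => ik <-; rewrite nth_drop/=; apply/negbTE.
  rewrite -ltNge (lt_le_trans lt_u)//; apply: mono.
    by rewrite (leq_trans (leqnSn k))// leq_addr.
  by rewrite szt -ltn_subRL.
rewrite !addn0; apply: leq_trans (count_size _ _) _.
by rewrite size_take_min geq_minl.
Qed.

Variables (I : finType) (k : nat).
Hypotheses (k_gt0 : (0 < k)%N) (k_leI : (k <= #|I|)%N).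
Implicit Types f g : I -> R.

Definition kth_of f := kth_smallest k [seq f a | a <- enum I].

Lemma kth_of_le f u : (kth_of f <= u) = (k <= #|[pred a | (f a <= u)%R]|)%N.
Proof.
rewrite /kth_of /kth_smallest nth_sort_le; last first.
  by rewrite size_map -cardE prednK.
rewrite prednK// count_map; congr (_ <= _)%N.
by rewrite -sum1_count big_enum_cond /= -sum1_card; apply: eq_bigl => a.
Qed.

(** Every index counted below [kth_of f] for f is counted below [kth_of f + e] for g. This is the
    only comparison of thresholds that the displacement estimates need. *)
Lemma kth_of_shift f g (e : R) : (forall b, g b <= f b + e) ->
  kth_of g <= kth_of f + e.
Proof.
move=> gf; rewrite kth_of_le.
have := lexx (kth_of f); rewrite {1}kth_of_le => /leq_trans; apply.
apply/subset_leq_card/fintype.subsetP => b; rewrite !inE => fb.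
by rewrite (le_trans (gf b))// lerD2r.
Qed.

Lemma kth_of_ge f u : (#|[pred a | (f a < u)%R]| < k)%N -> u <= kth_of f.
Proof.
rewrite leNgt; apply: contraTN => lt_u; rewrite -leqNgt.
have := lexx (kth_of f); rewrite {1}kth_of_le => /leq_trans; apply.
by apply/subset_leq_card/fintype.subsetP => b; rewrite !inE => /le_lt_trans; apply.
Qed.

Lemma kth_of_ge0 f : (forall b, 0 <= f b) -> 0 <= kth_of f.
Proof.
move=> f0; apply: kth_of_ge; rewrite eq_card0// => a.
by rewrite !inE ltNge f0.
Qed.

End OrderStatistics.

(** * Displacement of one selected particle *)

Section Displacement.
Context {R : realType} {d k : nat}.
Hypotheses (k_gt0 : (0 < k)%N) (k_le_d : (k <= d)%N).
Implicit Types u x : 'I_d -> R.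

(** The jump rule max(W, min(W + xi, T)) with W subtracted, for locations u and sizes x; T is the
    k-th smallest of the [u b + x b]. *)
Definition disp k u x a : R :=
  Num.max 0 (Num.min (x a) (kth_of k (fun b => u b + x b) - u a)).

Let k_leI : (k <= #|'I_d|)%N. Proof. by rewrite card_ord. Qed.

Lemma disp_ge0 u x a : 0 <= disp k u x a.
Proof. by rewrite /disp le_max lexx. Qed.

Lemma disp_le u x a : 0 <= x a -> disp k u x a <= x a.
Proof. by move=> x0; rewrite /disp ge_max x0 ge_min lexx. Qed.

(** Passing from u to u' raises a at least as much as any other particle. The threshold then rises
    by at most [u' a - u a], so its distance to a does not grow. *)
Lemma le_disp u u' x a : (forall b, u' b - u b <= u' a - u a) ->
  disp k u' x a <= disp k u x a.
Proof.
move=> uu'; rewrite /disp ge_max le_max lexx /= le_max; apply/orP; right.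
rewrite le_min ge_min lexx /= ge_min; apply/orP; right.
rewrite lerBlDr.
apply: le_trans (kth_of_shift k_gt0 k_leI (f := fun b => u b + x b) (e := u' a - u a) _) _.
  by move=> b; have := uu' b; lra.
lra.
Qed.

(** Seen from the lowest particle all relative locations are nonnegative, so the threshold is at
    least the one obtained when all particles start together. For the highest particle the
    inequality is reversed. *)
Lemma disp_lowest u x a : (forall b, 0 <= x b) -> (forall b, u a <= u b) ->
  Num.min (x a) (kth_of k x) <= disp k u x a.
Proof.
move=> x0 ua; rewrite /disp le_max; apply/orP; right.
rewrite le_min ge_min lexx /= ge_min; apply/orP; right.
rewrite lerBrDr -lerBrDr.
have := @kth_of_shift _ _ _ k_gt0 k_leI (fun b => u b + x b) x (- u a).
by apply => b; have := ua b; lra.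
Qed.

Lemma disp_highest u x a : (forall b, 0 <= x b) -> (forall b, u b <= u a) ->
  disp k u x a <= Num.min (x a) (kth_of k x).
Proof.
move=> x0 ua; rewrite /disp ge_max !le_min x0 kth_of_ge0//= ge_min lexx /=.
rewrite ge_min; apply/orP; right; rewrite lerBlDr.
have := @kth_of_shift _ _ _ k_gt0 k_leI x (fun b => u b + x b) (u a).
by apply => b; have := ua b; lra.
Qed.

Lemma disp_eq0 u x a : (k <= #|[pred b | (u b + x b <= u a)%R]|)%N ->
  disp k u x a = 0.
Proof.
move=> ck; apply/eqP; rewrite eq_le disp_ge0 andbT /disp ge_max lexx /=.
by rewrite ge_min subr_le0 (kth_of_le k_gt0 k_leI) ck orbT.
Qed.

Lemma disp_full u x a : 0 <= x a ->
  (#|[pred b | (u b + x b < u a + x a)%R]| < k)%N -> disp k u x a = x a.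
Proof.
move=> x0 ck; apply/eqP; rewrite eq_le disp_le //= /disp le_max; apply/orP; right.
by rewrite le_min lexx /= lerBrDr addrC; apply: kth_of_ge.
Qed.

End Displacement.

Section Selections.
Context {d n : nat}.
Implicit Types (s : {ffun 'I_d -> 'I_n}) (a : 'I_d) (i : 'I_n).

(** A transposition rather than an overwriting: if [i] is already selected, it trades places with
    [s a], and injectivity is preserved. *)
Definition reselect s a i : {ffun 'I_d -> 'I_n} := [ffun b => tperm (s a) i (s b)].

Lemma injective_reselect s a i :
  injectiveb (reselect s a i) = injectiveb s.
Proof.
apply/injectiveP/injectiveP => inj b b'.
  by move=> e; apply: inj; rewrite !ffunE e.
by rewrite !ffunE => /perm_inj/inj.
Qed.

Lemma reselect_at s a i : reselect s a i a = i.
Proof. by rewrite ffunE tpermL. Qed.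

Lemma reselectK s a i : reselect (reselect s a i) a (s a) = s.
Proof.
apply/ffunP => b; rewrite [LHS]ffunE reselect_at ffunE.
by rewrite [tperm i _]tpermC tpermK.
Qed.

(** The map sending (s, i) to ([reselect s a i], [s a]) is an involution that preserves injectivity
    of the selection. *)
Lemma sum_reselect (V : nmodType) a (F : {ffun 'I_d -> 'I_n} -> 'I_n -> V) :
  \sum_(s : {ffun 'I_d -> 'I_n} | injectiveb s) \sum_(i < n) F s i =
  \sum_(s : {ffun 'I_d -> 'I_n} | injectiveb s) \sum_(i < n)
     F (reselect s a i) (s a).
Proof.
rewrite !pair_big /=.
rewrite (reindex_onto (fun p : {ffun 'I_d -> 'I_n} * 'I_n => (reselect p.1 a p.2, p.1 a))
  (fun p : {ffun 'I_d -> 'I_n} * 'I_n => (reselect p.1 a p.2, p.1 a)))/=; last first.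
  by move=> [s i] _ /=; rewrite reselectK reselect_at.
apply: eq_bigl => -[s i] /=.
by rewrite injective_reselect !andbT reselectK reselect_at eqxx andbT.
Qed.

(** Each coordinate of a uniform injective selection is uniform on the n particles; the identity is
    cleared of denominators. *)
Lemma sum_select_marginal (R : realType) a (g : 'I_n -> R) :
  n%:R * (\sum_(s : {ffun 'I_d -> 'I_n} | injectiveb s) g (s a)) =
  (n ^_ d)%:R * (\sum_(i < n) g i).
Proof.
have := sum_reselect a (fun (s : {ffun 'I_d -> 'I_n}) (i : 'I_n) => g i).
rewrite sumr_const => e.
transitivity (\sum_(s : {ffun 'I_d -> 'I_n} | injectiveb s) \sum_(i < n) g (s a)).
  rewrite mulr_sumr; apply: eq_bigr => s _.
  by rewrite sumr_const card_ord mulr_natl.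
rewrite -e mulr_natl; congr (_ *+ _).
by have := card_inj_ffuns 'I_d 'I_n; rewrite !card_ord cardsE => <-.
Qed.

End Selections.

Section Exchange.
Context {R : realType} {d n k : nat}.
Hypotheses (k_gt0 : (0 < k)%N) (k_le_d : (k <= d)%N).
Variables (w : 'I_n -> R).
Implicit Types (x : 'I_d -> R) (s : {ffun 'I_d -> 'I_n}) (a : 'I_d) (i : 'I_n).

Definition sel_disp k x s a : R := disp k (fun b => w (s b)) x a.

Definition exchange_term k x s a i : R :=
  (w i - w (s a)) * (sel_disp k x s a - sel_disp k x (reselect s a i) a).

(** If [i] is above [s a], the exchange raises position a by [w i - w (s a)] and raises no other
    position by more: a position holding [i] even falls. By [le_disp] the displacement then
    decreases, so both factors have the same sign; the opposite case is symmetric. *)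
Lemma exchange_term_ge0 x s a i : injective s -> 0 <= exchange_term k x s a i.
Proof.
move=> s_inj; rewrite /exchange_term /sel_disp.
have E b : b != a -> reselect s a i b = if s b == i then s a else s b.
  move=> ba; rewrite ffunE; case: tpermP => [/s_inj e|->|_ /eqP/negbTE->//].
  - by rewrite e eqxx in ba.
  - by rewrite eqxx.
have [wi|/ltW wi] := leP (w (s a)) (w i).
  rewrite mulr_ge0 ?subr_ge0//; apply: le_disp => // b.
  have [->//|/E ->] := eqVneq b a; rewrite reselect_at.
  by case: eqP => [->|_]; lra.
rewrite -mulrNN !opprB mulr_ge0 ?subr_ge0//; apply: le_disp => // b.
have [->//|/E ->] := eqVneq b a; rewrite reselect_at.
by case: eqP => [->|_]; lra.
Qed.

Hypothesis w_sum0 : \sum_(i < n) w i = 0.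

(* Pairing (s, i) with the selection in which i replaces s a antisymmetrizes
   the sum of (w (s a) - w i) times the displacement. *)
Lemma sum_disp_exchange x :
  2 * n%:R * (\sum_(s : {ffun 'I_d -> 'I_n} | injectiveb s) \sum_(a < d)
    w (s a) * sel_disp k x s a) =
  - \sum_(s : {ffun 'I_d -> 'I_n} | injectiveb s) \sum_(a < d) \sum_(i < n)
      exchange_term k x s a i.
Proof.
rewrite exchange_big /= [in RHS]exchange_big /= mulr_sumr -sumrN.
apply: eq_bigr => a _.
have S : n%:R * (\sum_(s : {ffun 'I_d -> 'I_n} | injectiveb s)
    w (s a) * sel_disp k x s a) =
  \sum_(s : {ffun 'I_d -> 'I_n} | injectiveb s) \sum_(i < n)
    (w (s a) - w i) * sel_disp k x s a.
  rewrite mulr_sumr; apply: eq_bigr => s _.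
  rewrite -mulr_suml sumrB sumr_const card_ord w_sum0 subr0.
  by rewrite -[w (s a) *+ n]mulr_natl mulrA.
rewrite -mulrA S mulr_natl mulr2n {1}(sum_reselect a) -big_split /=.
rewrite -sumrN; apply: eq_bigr => s _; rewrite -big_split /= -sumrN.
apply: eq_bigr => i _; rewrite /exchange_term /sel_disp reselect_at; ring.
Qed.

Variable L : R.
Hypothesis L_ge0 : 0 <= L.

(** The gap 2 L leaves room for the level [w i - L]. A particle at or below it ends at or below
    [w i] after a jump of size at most L; a particle above it is already beyond the point that [s a]
    can reach. *)
Definition spread s a i : bool :=
  [&& [forall b, s b != i], [forall b, w (s b) <= w i],
      [forall b, w (s a) <= w (s b)] & w (s a) + 2 * L <= w i].

Definition low_majority k s a i : bool :=
  (k <= #|[pred b | (b != a) && (w (s b) <= w i - L)%R]|)%N.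

Lemma exchange_term_spread x s a i : injective s -> spread s a i ->
  (forall b, 0 <= x b <= L) ->
  (w i - w (s a)) * (if low_majority k s a i then Num.min (x a) (kth_of k x)
                     else x a - Num.min (x a) (kth_of k x))
  <= exchange_term k x s a i.
Proof.
move=> s_inj /and4P[/forallP si /forallP wsi /forallP wsa gapL] xL.
have x0 b : 0 <= x b by case/andP: (xL b).
rewrite /exchange_term ler_wpM2l ?subr_ge0//.
have E b : b != a -> reselect s a i b = s b.
  move=> ba; rewrite ffunE tpermD//; last by rewrite eq_sym si.
  by rewrite (inj_eq s_inj) eq_sym.
rewrite /low_majority; case: (leqP k) => ck.
  rewrite [sel_disp k x (reselect s a i) a](_ : _ = 0) ?subr0; last first.
    apply: disp_eq0 => //; apply: leq_trans ck _.
    apply/subset_leq_card/fintype.subsetP => b; rewrite !inE reselect_at => /andP[ba wb].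
    by rewrite E//; have := xL b; lra.
  exact: disp_lowest.
rewrite [sel_disp k x s a](_ : _ = x a); last first.
  apply: disp_full => //; apply: leq_ltn_trans ck.
  apply/subset_leq_card/fintype.subsetP => b; rewrite !inE => wb.
  apply/andP; split; first by apply: contraTneq wb => ->; rewrite ltxx.
  have := xL a; have := xL b; lra.
rewrite lerD2l lerN2; apply: disp_highest => // b; rewrite reselect_at.
have [->|ba] := eqVneq b a; first by rewrite reselect_at.
by rewrite E.
Qed.

End Exchange.

(** * The spread of the configuration carried by pairs to which the strict bound applies *)

Section SpreadCount.
Context {R : realType} {d n : nat}.
Variables (w : 'I_n -> R) (L : R) (a0 : 'I_d).
Hypotheses (w_sum0 : \sum_(i < n) w i = 0) (L_ge0 : 0 <= L)
  (d_small : (4 * d <= n)%N).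
Implicit Types (s : {ffun 'I_d -> 'I_n}) (a : 'I_d) (i : 'I_n).

Let outside s i := [forall b, s b != i].

(* The range of the d + 1 locations, beyond 2 L; symmetric in these particles. *)
Let excess s i : R :=
  \big[Num.max/0]_(e | (e == i) || [exists b, s b == e])
   \big[Num.max/0]_(f | (f == i) || [exists b, s b == f]) (w e - w f - 2 * L).

Let excess_ge0 s i : 0 <= excess s i. Proof. exact: bigmax_ge_id. Qed.

Let excess_reselect s a i : outside s i ->
  excess (reselect s a i) (s a) = excess s i.
Proof.
move=> /forallP si; have E e : (e == s a) || [exists b, reselect s a i b == e] =
    ((e == i) || [exists b, s b == e]).
  apply/idP/idP => [/predU1P[->|/existsP[b /eqP<-]]|/predU1P[->|/existsP[b /eqP<-]]].
  - by apply/orP; right; apply/existsP; exists a.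
  - rewrite ffunE; case: tpermP => [_|sbi|_ _]; first by rewrite eqxx.
      by have := si b; rewrite sbi eqxx.
    by apply/orP; right; apply/existsP; exists b.
  - by apply/orP; right; apply/existsP; exists a; rewrite reselect_at.
  - have [->|ne] /= := eqVneq (s b) (s a); first by [].
    apply/existsP; exists b; rewrite ffunE tpermD//.
      by rewrite eq_sym.
    by rewrite eq_sym si.
by rewrite /excess (eq_bigl _ _ E); apply: eq_bigr => e _; apply: eq_bigl.
Qed.

Let outside_reselect s a i : injective s -> outside s i ->
  outside (reselect s a i) (s a).
Proof.
move=> s_inj /forallP si; apply/forallP => b; rewrite ffunE.
case: tpermP => [_|sbi|+ _]; last by move/eqP.
  by rewrite eq_sym si.
by have := si b; rewrite sbi eqxx.
Qed.

Let highest s i := [forall b, w (s b) <= w i].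

(** With [i] on top, the range is attained by [i] and a lowest selected particle. Either it exceeds
    2 L and this pair is spread, or the excess is 0. *)
Let excess_le_spread s i : outside s i -> highest s i ->
  excess s i <= \sum_(a < d) (spread w L s a i)%:R * (w i - w (s a)).
Proof.
move=> si hi; have wsi b : w (s b) <= w i by move/forallP: hi.
have [a _ wsa] := @Order.TotalTheory.arg_minP _ _ 'I_d a0 xpredT (fun b => w (s b)) isT.
have terms_ge0 b : 0 <= (spread w L s b i)%:R * (w i - w (s b)).
  by rewrite mulr_ge0 ?ler0n// subr_ge0.
have spread_ge : Num.max 0 (w i - w (s a) - 2 * L) <=
    \sum_(a < d) (spread w L s a i)%:R * (w i - w (s a)).
  rewrite (bigD1 a)//= -[leLHS]addr0 lerD ?sumr_ge0//.
  have [sp|nsp] := boolP (spread w L s a i).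
    by rewrite mul1r ge_max subr_ge0 wsi//= gerBl mulr_ge0.
  rewrite mul0r ge_max lexx /= leNgt; apply: contraNN nsp => gap.
  rewrite /spread; apply/and4P; split => //; last by lra.
  by apply/forallP => b; apply: wsa.
apply: le_trans spread_ge; apply/bigmax_leP; split; first by rewrite le_max lexx.
move=> e se; apply/bigmax_leP; split; first by rewrite le_max lexx.
move=> f sf; rewrite le_max; apply/orP; right.
rewrite lerB//; apply: lerB.
  by case/predU1P: se => [->//|/existsP[b /eqP<-]].
by case/predU1P: sf => [->|/existsP[b /eqP<-]]; [exact: wsi|exact: wsa].
Qed.

(** Some particle among the d + 1 involved is highest, and at most one exchange makes it the outside
    one without changing the excess. Each pair (s, i) is thus charged to itself or to one of its d
    exchanges. *)
Let sum_excess_highest :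
  \sum_(s : {ffun 'I_d -> 'I_n} | injectiveb s) \sum_(i < n)
    (outside s i)%:R * excess s i <=
  d.+1%:R * \sum_(s : {ffun 'I_d -> 'I_n} | injectiveb s) \sum_(i < n)
    (outside s i && highest s i)%:R * excess s i.
Proof.
set T := \sum_(s | _) \sum_(i < n) (outside s i && _)%:R * _.
pose F s i : R := (outside s i && highest s i)%:R * excess s i.
have TE a : T = \sum_(s : {ffun 'I_d -> 'I_n} | injectiveb s) \sum_(i < n)
    F (reselect s a i) (s a) by rewrite -sum_reselect.
(* The d + 1 copies of [T] are one taken as it stands and one reindexed by the exchange at each
   coordinate a. *)
rewrite mulrS mulrDl mul1r -[d in d%:R]card_ord -sum1_card natr_sum mulr_suml.
under [X in _ + X]eq_bigr => a _ do rewrite mul1r (TE a).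
rewrite [X in _ + X]exchange_big -big_split /=; apply: ler_sum => s /injectiveP s_inj.
rewrite [X in _ + X]exchange_big -big_split /=; apply: ler_sum => i _.
have F_ge0 s' i' : 0 <= F s' i' by rewrite mulr_ge0 ?ler0n.
have [si|] := boolP (outside s i); last first.
  by rewrite /= mul0r addr_ge0 ?sumr_ge0.
rewrite mul1r; have [hi|/forallPn[b0]] := boolP (highest s i).
  by rewrite mul1r lerDl sumr_ge0.
rewrite -ltNge => wb0; rewrite mul0r add0r.
have [a _ wsa] := @Order.TotalTheory.arg_maxP _ _ 'I_d a0 xpredT (fun b => w (s b)) isT.
rewrite (bigD1 a)//= -[leLHS]addr0 lerD ?sumr_ge0//.
rewrite /F outside_reselect// excess_reselect//.
suff -> : highest (reselect s a i) (s a) by rewrite mul1r.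
apply/forallP => b; rewrite ffunE; case: tpermP => [_|//|_ _]; last exact: wsa.
by rewrite (le_trans (ltW wb0))//; apply: wsa.
Qed.

Let abs_le_excess s i : `|w i - w (s a0)| - 2 * L <= excess s i.
Proof.
have i1 : (i == i) || [exists b, s b == i] by rewrite eqxx.
have i2 : (s a0 == i) || [exists b, s b == s a0].
  by apply/orP; right; apply/existsP; exists a0.
have ex e f : (e == i) || [exists b, s b == e] -> (f == i) || [exists b, s b == f] ->
    w e - w f - 2 * L <= excess s i.
  move=> se sf; rewrite /excess (bigmaxD1 e)//= le_max; apply/orP; left.
  by rewrite (bigmaxD1 f)//= le_max lexx.
have [_|_] := ger0P (w i - w (s a0)); first exact: ex.
by rewrite opprB; exact: ex.
Qed.

(** The excess is at least [|w i - w (s a0)| - 2 L], and since w sums to 0, summing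
    [|w i - w (s a0)|] over all i gives at least [n |w (s a0)|]. The selected i must be left out of
    the sum; they cost at most 2 d M, which is half of the main term n M because 4 d <= n. This is
    the origin of the factor 1/2. *)
Lemma sum_spread :
  (n ^_ d)%:R * (2^-1 * (\sum_(i < n) `|w i|) - 2 * L * n%:R) <=
  d.+1%:R * \sum_(s : {ffun 'I_d -> 'I_n} | injectiveb s) \sum_(a < d)
    \sum_(i < n) (spread w L s a i)%:R * (w i - w (s a)).
Proof.
have hs : \sum_(s : {ffun 'I_d -> 'I_n} | injectiveb s) \sum_(i < n)
    (outside s i && highest s i)%:R * excess s i <=
    \sum_(s : {ffun 'I_d -> 'I_n} | injectiveb s) \sum_(a < d)
    \sum_(i < n) (spread w L s a i)%:R * (w i - w (s a)).
  apply: ler_sum => s _; rewrite [leRHS]exchange_big /=; apply: ler_sum => i _.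
  have [/andP[si hi]|nsh] := boolP (outside s i && highest s i).
    by rewrite mul1r excess_le_spread.
  rewrite mul0r; apply: sumr_ge0 => a _; have [sp|_] := boolP (spread _ _ _ _ _).
    by rewrite mul1r subr_ge0; case/and4P: sp => _ /forallP.
  by rewrite mul0r.
apply: le_trans (ler_wpM2l (ler0n _ _) hs).
apply: le_trans sum_excess_highest.
pose M := \sum_(s : {ffun 'I_d -> 'I_n} | injectiveb s) `|w (s a0)|.
have marg a : n%:R * (\sum_(s : {ffun 'I_d -> 'I_n} | injectiveb s) `|w (s a)|) =
    (n ^_ d)%:R * (\sum_(i < n) `|w i|) by rewrite (sum_select_marginal a (fun i => `|w i|)).
have d_gt0 : (0 < d)%N := leq_ltn_trans (leq0n _) (ltn_ord a0).
have n_gt0 : (0 < n)%N by rewrite (leq_trans _ d_small)// muln_gt0.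
have margM a : \sum_(s : {ffun 'I_d -> 'I_n} | injectiveb s) `|w (s a)| = M.
  by apply: (mulfI (x := n%:R)); rewrite ?pnatr_eq0 -?lt0n// !marg.
have cardN : (\sum_(s : {ffun 'I_d -> 'I_n} | injectiveb s) 1 : R) = (n ^_ d)%:R.
  rewrite sumr_const; have := card_inj_ffuns 'I_d 'I_n.
  by rewrite !card_ord cardsE => <-.
apply: (@le_trans _ _ (\sum_(s : {ffun 'I_d -> 'I_n} | injectiveb s)
  ((\sum_(i < n) `|w i - w (s a0)|) - 2 * L * n%:R
   - \sum_(b < d) `|w (s b) - w (s a0)|))); last first.
  apply: ler_sum => s /injectiveP s_inj.
  rewrite [X in _ - X](_ : _ = \sum_(i < n) (~~ outside s i)%:R * `|w i - w (s a0)|); last first.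
    rewrite (eq_bigr (fun i => if i \in codom s then `|w i - w (s a0)| else 0)); last first.
      move=> i _; rewrite negb_forall (_ : [exists _, _] = (i \in codom s)).
        by case: ifP; rewrite ?mul1r ?mul0r.
      apply/existsP/codomP => -[b]; first by rewrite negbK => /eqP<-; exists b.
      by move=> ->; exists b; rewrite negbK.
    rewrite -big_mkcond /= -big_uniq; last by rewrite map_inj_uniq// enum_uniq.
    by rewrite /codom /image_mem big_map big_enum.
  rewrite mulr_natr -[n in _ *+ n]card_ord -sumr_const -!sumrB.
  apply: ler_sum => i _; case: (outside s i); rewrite /= ?mul1r ?mul0r ?subr0//.
  by rewrite lerBlDr add0r gerBl mulr_ge0.
rewrite !sumrB (_ : \sum_(s | _) 2 * L * n%:R = 2 * L * n%:R * (n ^_ d)%:R); last first.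
  by rewrite -cardN mulr_sumr; apply: eq_bigr => s _; rewrite mulr1.
have S1 : (n ^_ d)%:R * (\sum_(i < n) `|w i|) <=
    \sum_(s : {ffun 'I_d -> 'I_n} | injectiveb s) \sum_(i < n) `|w i - w (s a0)|.
  rewrite -(marg a0) mulr_sumr; apply: ler_sum => s _.
  have := ler_norm_sum (index_enum 'I_n) (fun i => w i - w (s a0)) xpredT.
  rewrite sumrB w_sum0 sumr_const card_ord sub0r normrN normrMn.
  by rewrite mulr_natl.
have S2 : \sum_(s : {ffun 'I_d -> 'I_n} | injectiveb s) \sum_(b < d)
    `|w (s b) - w (s a0)| <= 2 * d%:R * M.
  rewrite exchange_big /=; apply: (@le_trans _ _ (\sum_(b < d) (M + M))).
    apply: ler_sum => b _; rewrite -{1}(margM b) -(margM a0) -big_split /=.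
    by apply: ler_sum => s _; apply: ler_normB.
  by rewrite sumr_const card_ord -[leLHS]mulr_natl (_ : d%:R * (M + M) = 2 * d%:R * M)//; ring.
have M_ge0 : 0 <= M by apply: sumr_ge0.
have S3 : 2 * d%:R * M <= 2^-1 * ((n ^_ d)%:R * (\sum_(i < n) `|w i|)).
  rewrite -(marg a0) -/M mulrA ler_wpM2r//.
  by move: d_small; rewrite -(ler_nat R) natrM; lra.
lra.
Qed.

End SpreadCount.

(** * Energy increment caused by one jump *)

Section Energy.
Context {R : realType}.

Definition energy n (w : n.-tuple R) : R := \sum_(i < n) tnth w i ^+ 2.

Lemma energy_ge0 n (w : n.-tuple R) : 0 <= energy w.
Proof. by apply: sumr_ge0 => i _; exact: sqr_ge0. Qed.

Lemma sum_mean n (w : n.-tuple R) : n%:R * mean w = \sum_(i < n) tnth w i.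
Proof.
rewrite /mean; case: n w => [|n] w; last by rewrite mulVKf// pnatr_eq0.
by rewrite mul0r big_ord0.
Qed.

Lemma tnth_centering n (w : n.-tuple R) i : tnth (centering w) i = tnth w i - mean w.
Proof. by rewrite tnth_mktuple. Qed.

Lemma sum_centering n (w : n.-tuple R) : \sum_(i < n) tnth (centering w) i = 0.
Proof.
rewrite (eq_bigr _ (fun i _ => tnth_centering w i)) sumrB -sum_mean.
by rewrite sumr_const card_ord -[mean w *+ n]mulr_natl subrr.
Qed.

(** Recentering subtracts n times the squared mean. The shift of the mean caused by a jump can
    therefore be ignored in upper bounds on the energy. *)
Lemma energy_centering_le n (w : n.-tuple R) : energy (centering w) <= energy w.
Proof.
rewrite /energy (eq_bigr (fun i => tnth w i ^+ 2 + (- (2 * mean w) * tnth w i + mean w ^+ 2))).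
  rewrite big_split /= gerDl big_split /= -mulr_sumr -sum_mean sumr_const card_ord.
  rewrite -[mean w ^+ 2 *+ n]mulr_natl.
  rewrite (_ : _ + _ = - (n%:R * mean w ^+ 2)); last by ring.
  by rewrite oppr_le0 mulr_ge0// sqr_ge0.
by move=> i _; rewrite tnth_centering; ring.
Qed.

Lemma tnth_jump n d k (s : {ffun 'I_d -> 'I_n}) (x : d.-tuple R) (w : n.-tuple R) a :
  injective s ->
  tnth (jump k s x w) (s a) = tnth w (s a) + sel_disp (tnth w) k (tnth x) s a.
Proof.
move=> s_inj; rewrite tnth_mktuple; case: pickP => [a' /eqP/s_inj ->|/(_ a)]; last first.
  by rewrite eqxx.
rewrite /sel_disp /disp /kth_of.
set T := kth_smallest _ _.
by rewrite addr_maxr addr0 addr_minr addrCA subrr addr0.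
Qed.

Lemma tnth_jump_out n d k (s : {ffun 'I_d -> 'I_n}) (x : d.-tuple R) (w : n.-tuple R) i :
  i \notin codom s -> tnth (jump k s x w) i = tnth w i.
Proof.
move=> iNs; rewrite tnth_mktuple; case: pickP => // a /eqP sa.
by move: iNs; rewrite -sa codom_f.
Qed.

Lemma energy_jump n d k (s : {ffun 'I_d -> 'I_n}) (x : d.-tuple R) (w : n.-tuple R) :
  injective s ->
  energy (jump k s x w) = energy w +
    \sum_(a < d) (2 * (tnth w (s a) * sel_disp (tnth w) k (tnth x) s a)
                  + sel_disp (tnth w) k (tnth x) s a ^+ 2).
Proof.
move=> s_inj; apply/eqP; rewrite addrC -subr_eq -sumrB; apply/eqP.
rewrite (bigID (mem (codom s)))/= [X in _ + X]big1 ?addr0; last first.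
  by move=> i iNs; rewrite tnth_jump_out// subrr.
rewrite -big_uniq; last by rewrite map_inj_uniq// enum_uniq.
rewrite big_map big_enum; apply: eq_bigr => a _.
by rewrite tnth_jump//; ring.
Qed.

(** The cross terms of the squares form the sum evaluated in [sum_disp_exchange], and the squared
    displacements are at most the squared sizes. Multiplying by n and by the number of selections
    avoids division. *)
Lemma sum_energy_jump n d k (x : d.-tuple R) (w : n.-tuple R) :
  (0 < k)%N -> (k <= d)%N ->
  \sum_(i < n) tnth w i = 0 -> (forall a, 0 <= tnth x a) ->
  n%:R * (\sum_(s : {ffun 'I_d -> 'I_n} | injectiveb s)
            energy (centering (jump k s x w)))
  + \sum_(s : {ffun 'I_d -> 'I_n} | injectiveb s) \sum_(a < d) \sum_(i < n)
      exchange_term (tnth w) k (tnth x) s a i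
  <= n%:R * (n ^_ d)%:R * (energy w + \sum_(a < d) tnth x a ^+ 2).
Proof.
move=> k_gt0 k_le_d w_sum0 x_ge0.
rewrite -[X in _ + X]opprK -sum_disp_exchange// lerBlDr -mulrA.
rewrite (mulrC 2) -!mulrA -mulrDr ler_wpM2l//.
have cardN : (\sum_(s : {ffun 'I_d -> 'I_n} | injectiveb s) 1 : R) = (n ^_ d)%:R.
  rewrite sumr_const; have := card_inj_ffuns 'I_d 'I_n.
  by rewrite !card_ord cardsE => <-.
rewrite -cardN mulr_suml mulr_sumr -big_split /=; apply: ler_sum => s /injectiveP s_inj.
rewrite (le_trans (energy_centering_le _))// energy_jump// mul1r -addrA lerD2l.
rewrite mulr_sumr -big_split /=; apply: ler_sum => a _.
rewrite [leLHS]addrC lerD2r ler_sqr ?nnegrE ?disp_ge0//.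
exact: disp_le.
Qed.

End Energy.

(** * Energy drift of one job class *)

Section Measurability.
Context {R : realType} {dT : measure_display} {T : measurableType dT}.

Lemma measurable_count (I : finType) (f : I -> T -> R) (u : R) m :
  (forall a, measurable_fun setT (f a)) ->
  measurable [set t | (m <= #|[pred a | (f a t <= u)%R]|)%N].
Proof.
move=> mf; pose g t : R := \sum_(a : I) \1_(f a @^-1` `]-oo, u]) t.
have mg : measurable_fun setT g.
  apply: measurable_sum => a; apply: measurable_indic.
  by rewrite -[X in measurable X]setTI; exact: mf.
rewrite (_ : [set _ | _] = g @^-1` `[m%:R, +oo[).
  by rewrite -[X in measurable X]setTI; exact: mg.
suff gE t : g t = #|[pred a | (f a t <= u)%R]|%:R.
  by apply/seteqP; split => t /=; rewrite in_itv/= andbT gE ler_nat.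
rewrite /g -sum1_card natr_sum [RHS]big_mkcond; apply: eq_bigr => a _.
rewrite indicE inE/= (_ : (t \in _) = (f a t <= u)); first by case: ifP.
by apply/idP/idP; rewrite inE/= in_itv.
Qed.

Lemma measurable_nth_sort (I : finType) (f : I -> T -> R) k : (k < #|I|)%N ->
  (forall a, measurable_fun setT (f a)) ->
  measurable_fun setT (fun t => nth 0 (sort <=%R [seq f a t | a <- enum I]) k).
Proof.
move=> kI mf; apply: (measurability _ (RGenOInfty.measurableE R)).
move=> _ [_ [u ->] <-]; rewrite setTI.
rewrite (_ : _ @^-1` _ = ~` [set t | (k.+1 <= #|[pred a | (f a t <= u)%R]|)%N]).
  by apply: measurableC; exact: measurable_count.
have E t : (nth 0 (sort <=%R [seq f a t | a <- enum I]) k <= u) =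
    (k < #|[pred a | (f a t <= u)%R]|)%N.
  rewrite nth_sort_le; last by rewrite size_map -cardE.
  by rewrite count_map -sum1_count big_enum_cond/= sum1_card.
by apply/seteqP; split => t /=; rewrite in_itv/= andbT ltNge E => /negP.
Qed.

Lemma measurable_kth_of (I : finType) (f : I -> T -> R) k :
  (0 < k)%N -> (k <= #|I|)%N ->
  (forall a, measurable_fun setT (f a)) ->
  measurable_fun setT (fun t => kth_of k (f ^~ t)).
Proof. by move=> k0 kI mf; apply: measurable_nth_sort => //; rewrite prednK. Qed.

Lemma measurable_tnth_comp n (f : T -> n.-tuple R) i : measurable_fun setT f ->
  measurable_fun setT (fun t => tnth (f t) i).
Proof. by move=> /measurable_fun_tnthP/(_ i). Qed.

Lemma measurable_mktuple n (f : 'I_n -> T -> R) :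
  (forall i, measurable_fun setT (f i)) ->
  measurable_fun setT (fun t => [tuple f i t | i < n]).
Proof.
move=> mf; apply/measurable_fun_tnthP => i; apply: eq_measurable_fun (mf i) => t _.
by rewrite /= tnth_mktuple.
Qed.

Lemma measurable_translate n (f : T -> R) (w : T -> n.-tuple R) :
  measurable_fun setT f -> measurable_fun setT w ->
  measurable_fun setT (fun t => translate (f t) (w t)).
Proof.
move=> mf mw; apply: measurable_mktuple => i; apply: measurable_funD => //.
exact: measurable_tnth_comp.
Qed.

Lemma measurable_mean n (w : T -> n.-tuple R) : measurable_fun setT w ->
  measurable_fun setT (fun t => mean (w t)).
Proof.
move=> mw; apply: measurable_funM => //; apply: measurable_sum => i.
exact: measurable_tnth_comp.
Qed.

Lemma measurable_centering n (w : T -> n.-tuple R) : measurable_fun setT w ->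
  measurable_fun setT (fun t => centering (w t)).
Proof.
move=> mw; apply: measurable_translate => //.
by apply: measurable_funN; exact: measurable_mean.
Qed.

Lemma measurable_jump n d k (s : {ffun 'I_d -> 'I_n}) (x : T -> d.-tuple R)
    (w : T -> n.-tuple R) : (0 < k)%N -> (k <= d)%N ->
  measurable_fun setT x -> measurable_fun setT w ->
  measurable_fun setT (fun t => jump k s (x t) (w t)).
Proof.
move=> k0 kd mx mw; apply: measurable_mktuple => i.
case: pickP => [a _|_]; last exact: measurable_tnth_comp.
apply: measurable_maxr; first exact: measurable_tnth_comp.
apply: measurable_minr.
  by apply: measurable_funD; exact: measurable_tnth_comp.
apply: (@measurable_kth_of _ (fun a t => tnth (w t) (s a) + tnth (x t) a)) => //.
  by rewrite card_ord.
by move=> b; apply: measurable_funD; exact: measurable_tnth_comp.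
Qed.

Lemma measurable_energy n (w : T -> n.-tuple R) : measurable_fun setT w ->
  measurable_fun setT (fun t => energy (w t)).
Proof.
move=> mw; apply: measurable_sum => i; apply: measurable_funX.
exact: measurable_tnth_comp.
Qed.

End Measurability.

Section IntegralLowerBound.
Context {R : realType} {dT : measure_display} {T : measurableType dT}
  (mu : {measure set T -> \bar R}).

(** The events [Z i] may differ as long as their probabilities share a lower bound. In the drift
    estimate each pair (s, i) and coordinate a comes with its own event for the sizes. *)
Lemma integral_sum_indic_ge (I : finType) (P : pred I) (c : I -> R)
    (Z : I -> set T) (delta : R) : 0 <= delta ->
  (forall i, P i -> 0 <= c i) -> (forall i, measurable (Z i)) ->
  (forall i, P i -> (delta%:E <= mu (Z i))%E) ->
  ((delta * \sum_(i | P i) c i)%:E <=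
    \int[mu]_x (\sum_(i | P i) c i * \1_(Z i) x)%:E)%E.
Proof.
move=> d0 c0 mZ muZ.
under eq_integral do rewrite -sumEFin big_mkcond/=.
rewrite ge0_integral_sum//=; last 2 first.
- move=> i; case: (P i) => //; apply/measurable_EFinP; apply: measurable_funM => //.
- by move=> i x _; case: ifPn => // Pi; rewrite lee_fin mulr_ge0 ?c0.
rewrite mulr_sumr big_mkcond -sumEFin; apply: lee_sum => i _.
case: ifPn => Pi; last by rewrite integral0.
under eq_integral do rewrite EFinM.
rewrite ge0_integralZl//=; last 2 first.
- by apply/measurable_EFinP; exact: measurable_indic.
- exact: c0.
by rewrite integral_indic// setIT mulrC EFinM lee_wpmul2l// ?lee_fin ?c0 ?muZ.
Qed.

End IntegralLowerBound.

Section ExchangeableSizes.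
Context {R : realType} {d : nat} (F : probability (d.-tuple R) R).
Hypothesis F_ge0 : F [set x : d.-tuple R | forall i, 0 <= tnth x i] = 1%E.
Hypothesis F_exchangeable : forall (s : {perm 'I_d}) (A : set (d.-tuple R)),
  measurable A -> F [set x : d.-tuple R | A [tuple tnth x (s i) | i < d]] = F A.

Let permute (s : {perm 'I_d}) (x : d.-tuple R) := [tuple tnth x (s i) | i < d].

Lemma measurable_sizes_ge0 :
  measurable [set x : d.-tuple R | forall i, 0 <= tnth x i].
Proof.
rewrite (_ : [set _ | _] = \bigcap_(i in [set: 'I_d])
   ((fun x : d.-tuple R => tnth x i) @^-1` `[0, +oo[)).
  apply: fin_bigcap_measurable => // i _; rewrite -[X in measurable X]setTI.
  exact: measurable_tnth.
apply/seteqP; split => x /= x0 i; last by have := x0 i I; rewrite /= in_itv/= andbT.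
by move=> _; rewrite /= in_itv/= andbT.
Qed.

Lemma ae_sizes_ge0 : {ae F, forall x, forall i, 0 <= tnth x i}.
Proof.
exists (~` [set x : d.-tuple R | forall i, 0 <= tnth x i]); split.
- exact: measurableC measurable_sizes_ge0.
- rewrite probability_setC; last exact: measurable_sizes_ge0.
  by rewrite F_ge0 subee.
- by move=> x /=.
Qed.

Lemma measurable_permute (s : {perm 'I_d}) :
  measurable_fun setT (permute s : d.-tuple R -> d.-tuple R).
Proof. by apply: measurable_mktuple => i; exact: measurable_tnth. Qed.

Lemma integral_permute (s : {perm 'I_d}) (f : d.-tuple R -> \bar R) :
  measurable_fun setT f -> (forall x, (0 <= f x)%E) ->
  (\int[F]_x f (permute s x) = \int[F]_x f x)%E.
Proof.
move=> mf f0.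
have <- := @ge0_integral_pushforward _ _ _ _ _ _ (measurable_permute s) F setT f
  measurableT mf (fun x _ => f0 x).
apply: eq_measure_integral; first exact: measurable_permute.
by move=> ? A mA _; exact: F_exchangeable.
Qed.

Lemma integral_sqr_tnth (a b : 'I_d) :
  (\int[F]_x (tnth x a ^+ 2)%:E = \int[F]_x (tnth x b ^+ 2)%:E)%E.
Proof.
rewrite -(@integral_permute (tperm a b)).
- by apply: eq_integral => x _; rewrite tnth_mktuple tpermL.
- by apply/measurable_EFinP; apply: measurable_funX; exact: measurable_tnth.
- by move=> x; rewrite lee_fin sqr_ge0.
Qed.

(* Exchangeability transfers eligibility from some coordinate to all of them. *)
Lemma eligible_lower_bound (g : 'I_d -> d.-tuple R -> R) :
  (forall a, measurable_fun setT (g a)) ->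
  (forall a s x, g a (permute s x) = g (s a) x) ->
  (0 < F [set x | exists a, (0 < g a x)%R])%E ->
  exists m0, forall m, (m0 <= m)%N -> exists2 delta : R, 0 < delta & forall a,
    (delta%:E <= F [set x | (forall b, (0 <= tnth x b <= m%:R)%R) /\
                            (m.+1%:R^-1 <= g a x)%R])%E.
Proof.
move=> mg gs Fpos.
pose Y a m := [set x : d.-tuple R | (forall b, (0 <= tnth x b <= m%:R)%R) /\
                            (m.+1%:R^-1 <= g a x)%R].
have mY a m : measurable (Y a m).
  rewrite (_ : Y a m = (\bigcap_(b in [set: 'I_d])
     ((fun x : d.-tuple R => tnth x b) @^-1` `[0, m%:R])) `&`
     (g a @^-1` `[m.+1%:R^-1, +oo[)).
    apply: measurableI; last by rewrite -[X in measurable X]setTI; exact: mg.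
    apply: fin_bigcap_measurable => // i _; rewrite -[X in measurable X]setTI.
    exact: measurable_tnth.
  apply/seteqP; split => x /= [x1 x2]; split.
  - by move=> b _ /=; rewrite in_itv/=.
  - by rewrite in_itv/= andbT.
  - by move=> b; have := x1 b I; rewrite /= in_itv.
  - by move: x2; rewrite in_itv/= andbT.
have YE a b m : F (Y a m) = F (Y b m).
  rewrite -(F_exchangeable (tperm a b) (mY a m)); congr (F _).
  have E x : g a (permute (tperm a b) x) = g b x by rewrite gs tpermL.
  apply/seteqP; split => x /= [x1 x2]; split.
  - by move=> c; have := x1 (tperm a b c); rewrite tnth_mktuple tpermK.
  - by rewrite -E.
  - by move=> c; rewrite tnth_mktuple.
  - by move: x2; rewrite -E.
(* Up to a null set, the countably many [Y a m] cover the points where some [g a] is positive, so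
   they cannot all be null. *)
have [a [m0 Ym0]] : exists a m, (0 < F (Y a m))%E.
  apply: contrapT => nY; move: Fpos; apply/negP; rewrite -leNgt.
  have Y0 a m : F (Y a m) = 0%E.
    apply/eqP; rewrite eq_le measure_ge0 andbT leNgt; apply/negP => Yam.
    by apply: nY; exists a, m.
  have : F.-negligible [set x | exists a, (0 < g a x)%R].
    have [N [mN N0 subN]] := ae_sizes_ge0.
    (* The finite union over coordinates is written as a countable one; [insub] yields no coordinate
       from d on. *)
    apply: (@negligibleS _ _ _ _ (N `|`
      \bigcup_m \bigcup_i (if insub i is Some a then Y a m else set0))).
      move=> x [a ga]; have [x0|/subN Nx] := pselect (forall i, 0 <= tnth x i); last by left.
      right; have [m1 gm1] : exists m, m.+1%:R^-1 <= g a x.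
        exists (Num.truncn (g a x)^-1); rewrite invf_ple ?posrE ?ltr0n//.
        by apply/ltW/truncnS_gt.
      have xb : 0 <= \sum_b tnth x b by apply: sumr_ge0.
      pose m := maxn m1 (Num.truncn (\sum_b tnth x b)).+1.
      exists m => //; exists (a : nat) => //; rewrite valK; split.
        move=> b; rewrite x0/= (@le_trans _ _ (\sum_b tnth x b))//.
          by rewrite (bigD1 b)//= lerDl sumr_ge0.
        by rewrite (le_trans (ltW (truncnS_gt _)))// ler_nat leq_maxr.
      by rewrite (le_trans _ gm1)// lef_pV2 ?posrE ?ltr0n// ler_nat ltnS leq_maxl.
    apply: negligibleU; first by exists N; split.
    apply: negligible_bigcup => m.
    apply: negligible_bigcup => i; case: insubP => [a' _ _|_].
      by exists (Y a' m); split => //; exact: Y0.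
    exact: negligible_set0.
  move/negligibleP => ->//.
  rewrite (_ : [set x | exists a, (0 < g a x)%R] = \bigcup_(a in [set: 'I_d]) (g a @^-1` `]0, +oo[)).
    apply: fin_bigcup_measurable => // a _; rewrite -[X in measurable X]setTI; exact: mg.
  apply/seteqP; split => x /= [a]; first by exists a => //=; rewrite in_itv/= andbT.
  by move=> _; rewrite /= in_itv/= andbT; exists a.
exists m0 => m m0m; exists (fine (F (Y a m0))).
  by rewrite fine_gt0// Ym0/= (le_lt_trans (probability_le1 _ _)) ?ltry.
move=> b; rewrite fineK ?fin_num_measure// (YE a b); apply: le_measure; rewrite ?inE//; first exact: (mY b m).
move=> x [x1 x2]; split.
  by move=> c; have /andP[-> /=/le_trans] := x1 c; apply; rewrite ler_nat.
by rewrite (le_trans _ x2)// lef_pV2 ?posrE ?ltr0n// ler_nat ltnS.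
Qed.

End ExchangeableSizes.

Section ClassDrift.
Context {R : realType} {d k : nat} (F : probability (d.-tuple R) R).
Hypotheses (k_gt0 : (0 < k)%N) (k_le_d : (k <= d)%N).
Hypothesis F_ge0 : F [set x : d.-tuple R | forall i, 0 <= tnth x i] = 1%E.
Hypothesis F_exchangeable : forall (s : {perm 'I_d}) (A : set (d.-tuple R)),
  measurable A -> F [set x : d.-tuple R | A [tuple tnth x (s i) | i < d]] = F A.

(** Dividing by [n ^_ d] gives the mean energy after an arrival of this class. *)
Definition class_energy n (w : n.-tuple R) : \bar R :=
  (\sum_(s : {ffun 'I_d -> 'I_n} | injectiveb s)
     \int[F]_x (energy (centering (jump k s x w)))%:E)%E.

Lemma measurable_sel_disp n (w : 'I_n -> R) s a :
  measurable_fun setT (fun x : d.-tuple R => sel_disp w k (tnth x) s a).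
Proof.
apply: measurable_maxr => //; apply: measurable_minr; first exact: measurable_tnth.
apply: measurable_funB => //.
apply: (@measurable_kth_of _ _ _ _ (fun b (x : d.-tuple R) => w (s b) + tnth x b)) => //.
  by rewrite card_ord.
by move=> b; apply: measurable_funD => //; exact: measurable_tnth.
Qed.

Lemma measurable_exchange_term n (w : 'I_n -> R) s a i :
  measurable_fun setT (fun x : d.-tuple R => exchange_term w k (tnth x) s a i).
Proof.
by apply: measurable_funM => //; apply: measurable_funB; exact: measurable_sel_disp.
Qed.

Lemma measurable_energy_jump n (w : n.-tuple R) (s : {ffun 'I_d -> 'I_n}) :
  measurable_fun setT (fun x : d.-tuple R => energy (centering (jump k s x w))).
Proof.
by apply: measurable_energy; apply: measurable_centering; exact: measurable_jump.
Qed.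

Let exchange_sum n (w : n.-tuple R) (x : d.-tuple R) : R :=
  \sum_(s : {ffun 'I_d -> 'I_n} | injectiveb s) \sum_(a < d) \sum_(i < n)
      exchange_term (tnth w) k (tnth x) s a i.

Let measurable_exchange_sum n (w : n.-tuple R) : measurable_fun setT (exchange_sum w).
Proof.
rewrite (_ : exchange_sum w = fun x =>
  \sum_(s : {ffun 'I_d -> 'I_n}) if injectiveb s then \sum_(a < d) \sum_(i < n)
      exchange_term (tnth w) k (tnth x) s a i else 0).
  apply: measurable_sum => s; case: (injectiveb s) => //.
  by apply: measurable_sum => a; apply: measurable_sum => i; exact: measurable_exchange_term.
by apply/funext => x; rewrite /exchange_sum big_mkcond.
Qed.

Let exchange_sum_ge0 n (w : n.-tuple R) x : 0 <= exchange_sum w x.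
Proof.
apply: sumr_ge0 => s /injectiveP s_inj; apply: sumr_ge0 => a _.
by apply: sumr_ge0 => i _; exact: exchange_term_ge0.
Qed.

Lemma class_energy_exchange n (w : n.-tuple R) : \sum_(i < n) tnth w i = 0 ->
  (n%:R%:E * class_energy w + \int[F]_x (exchange_sum w x)%:E <=
   (n%:R * (n ^_ d)%:R)%:E *
     ((energy w)%:E + d%:R%:E * \int[F]_x ((nth 0 x 0%N) ^+ 2)%:E))%E.
Proof.
move=> w_sum0.
have d_gt0 : (0 < d)%N := leq_trans k_gt0 k_le_d.
have -> : (n%:R%:E * class_energy w = \int[F]_x (n%:R * \sum_(s : {ffun 'I_d -> 'I_n} |
    injectiveb s) energy (centering (jump k s x w)))%:E)%E.
  under [RHS]eq_integral do rewrite EFinM -sumEFin big_mkcond/=.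
  have mE (s : {ffun 'I_d -> 'I_n}) : measurable_fun setT (fun x : d.-tuple R =>
      if injectiveb s then (energy (centering (jump k s x w)))%:E else 0%E).
    by case: (injectiveb s) => //; apply/measurable_EFinP; exact: measurable_energy_jump.
  have E0 (s : {ffun 'I_d -> 'I_n}) (x : d.-tuple R) :
      (0 <= if injectiveb s then (energy (centering (jump k s x w)))%:E else 0%E)%E.
    by case: ifP => // _; rewrite lee_fin energy_ge0.
  rewrite ge0_integralZl//=; last 2 first.
  - exact: emeasurable_sum.
  - by move=> x _; apply: sume_ge0.
  congr (_ * _)%E; rewrite ge0_integral_sum//= /class_energy big_mkcond/=.
  by apply: eq_bigr => s _; case: ifP => // _; rewrite integral0.
rewrite -ge0_integralD//=; last 4 first.
- by move=> x _; rewrite lee_fin mulr_ge0// sumr_ge0// => s _; exact: energy_ge0.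
- apply/measurable_EFinP; apply: measurable_funM => //.
  under eq_fun do rewrite big_mkcond/=.
  apply: measurable_sum => s; case: (injectiveb s) => //; exact: measurable_energy_jump.
- by move=> x _; rewrite lee_fin.
- exact/measurable_EFinP.
have -> : ((n%:R * (n ^_ d)%:R)%:E *
     ((energy w)%:E + d%:R%:E * \int[F]_x ((nth 0 x 0%N) ^+ 2)%:E) =
   \int[F]_x (n%:R * (n ^_ d)%:R * (energy w + \sum_(a < d) tnth x a ^+ 2))%:E)%E.
  have mS : measurable_fun setT (fun x : d.-tuple R => (\sum_(a < d) tnth x a ^+ 2)%:E).
    apply/measurable_EFinP; apply: measurable_sum => a; apply: measurable_funX.
    exact: measurable_tnth.
  have S0 (x : d.-tuple R) : (0 <= (\sum_(a < d) tnth x a ^+ 2)%:E)%E.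
    by rewrite lee_fin sumr_ge0// => a _; exact: sqr_ge0.
  under [RHS]eq_integral do rewrite EFinM EFinD.
  rewrite ge0_integralZl//=; last 2 first.
  - by apply: emeasurable_funD.
  - by move=> x _; rewrite adde_ge0// lee_fin energy_ge0.
  rewrite ge0_integralD//=; last by move=> x _; rewrite lee_fin energy_ge0.
  rewrite integral_cst//= probability_setT mule1; congr (_ * (_ + _))%E.
  under [RHS]eq_integral do rewrite -sumEFin.
  rewrite ge0_integral_sum//=; last 2 first.
  - by move=> a; apply/measurable_EFinP; apply: measurable_funX; exact: measurable_tnth.
  - by move=> a x _; rewrite lee_fin sqr_ge0.
  rewrite (eq_bigr (fun=> \int[F]_x (nth 0 x 0%N ^+ 2)%:E)%E); last first.
    move=> a _; rewrite (integral_sqr_tnth F_exchangeable a (Ordinal d_gt0)).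
    by apply: eq_integral => x _; rewrite (tnth_nth 0).
  by rewrite sumr_const card_ord mule_natl.
apply: ae_ge0_le_integral => //=.
- move=> x _; rewrite -EFinD lee_fin addr_ge0// mulr_ge0// sumr_ge0// => s _.
  exact: energy_ge0.
- apply/measurable_EFinP; apply: measurable_funD => //; apply: measurable_funM => //.
  under eq_fun do rewrite big_mkcond/=.
  apply: measurable_sum => s; case: (injectiveb s) => //; exact: measurable_energy_jump.
- move=> x _; rewrite lee_fin mulr_ge0// addr_ge0 ?energy_ge0// sumr_ge0// => a _.
- apply/measurable_EFinP; apply: measurable_funM => //; apply: measurable_funD => //.
  by apply: measurable_sum => a; apply: measurable_funX; exact: measurable_tnth.
apply: filterS (ae_sizes_ge0 F_ge0) => x x0 _; rewrite -EFinD lee_fin.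
exact: sum_energy_jump.
Qed.

(** Dropping the nonnegative exchange sum leaves a bound that holds for every class; only the
    non-trivial one supplies a strict gain. *)
Lemma class_energy_le n (w : n.-tuple R) : (0 < n)%N -> \sum_(i < n) tnth w i = 0 ->
  (class_energy w <= (n ^_ d)%:R%:E *
     ((energy w)%:E + d%:R%:E * \int[F]_x ((nth 0 x 0%N) ^+ 2)%:E))%E.
Proof.
move=> n0 w_sum0; rewrite -(@lee_pmul2l _ n%:R%:E)//; last by rewrite lte_fin ltr0n.
rewrite muleA -EFinM; apply: le_trans (class_energy_exchange w_sum0).
by rewrite leeDl// integral_ge0// => x _; rewrite lee_fin.
Qed.

Hypothesis low_eligible : (0 < F [set x : d.-tuple R |
  exists a, (0 < Num.min (tnth x a) (kth_of k (tnth x)))%R])%E.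
Hypothesis high_eligible : (0 < F [set x : d.-tuple R |
  exists a, (0 < tnth x a - Num.min (tnth x a) (kth_of k (tnth x)))%R])%E.

(** The constant [eps] is the product of a lower bound [delta] on the eligibility probabilities, the
    amount 1/(m + 1) gained on an eligible event, and the factor 1/(d + 1) lost in [sum_spread]. *)
Lemma class_energy_drift : exists eps L : R, [/\ 0 < eps, 0 <= L &
  forall n (w : n.-tuple R), (4 * d <= n)%N -> \sum_(i < n) tnth w i = 0 ->
  (n%:R%:E * class_energy w +
     (eps * (n ^_ d)%:R * (2^-1 * l1norm w - 2 * L * n%:R))%:E <=
   (n%:R * (n ^_ d)%:R)%:E *
     ((energy w)%:E + d%:R%:E * \int[F]_x ((nth 0 x 0%N) ^+ 2)%:E))%E].
Proof.
have mkth : measurable_fun setT (fun x : d.-tuple R => kth_of k (tnth x)).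
  apply: (@measurable_kth_of _ _ _ _ (fun b (x : d.-tuple R) => tnth x b)) => //.
    by rewrite card_ord.
  by move=> b; exact: measurable_tnth.
have kth_perm (s : {perm 'I_d}) (x : d.-tuple R) :
    kth_of k (tnth [tuple tnth x (s i) | i < d]) = kth_of k (tnth x).
  have c (u : R) (y : 'I_d -> R) : (kth_of k y <= u) = (k <= #|[pred a : 'I_d | (y a <= u)%R]|)%N.
    by rewrite kth_of_le// card_ord.
  have e u : #|[pred a | (tnth [tuple tnth x (s i) | i < d] a <= u)%R]| =
      #|[pred a | (tnth x a <= u)%R]|.
    rewrite -[RHS](fintype.card_image (@perm_inj _ s^-1%g)); apply: eq_card => a.
    rewrite !inE tnth_mktuple; apply/idP/fintype.imageP.
      by move=> xa; exists (s a) => //; rewrite permK.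
    by move=> [b xb ->]; rewrite permKV.
  by apply: le_anti; rewrite {1}c e -c lexx c -e -c lexx.
pose g1 (a : 'I_d) (x : d.-tuple R) := Num.min (tnth x a) (kth_of k (tnth x)).
pose g2 (a : 'I_d) (x : d.-tuple R) := tnth x a - g1 a x.
have mg1 a : measurable_fun setT (g1 a).
  by apply: measurable_minr => //; exact: measurable_tnth.
have mg2 a : measurable_fun setT (g2 a).
  by apply: measurable_funB => //; exact: measurable_tnth.
have [m1 b1] := eligible_lower_bound F_ge0 F_exchangeable mg1
  (fun a s x => ltac:(by rewrite /g1 kth_perm tnth_mktuple)) low_eligible.
have [m2 b2] := eligible_lower_bound F_ge0 F_exchangeable mg2
  (fun a s x => ltac:(by rewrite /g2 /g1 kth_perm tnth_mktuple)) high_eligible.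
(* One m serves both kinds of eligibility, and it is also the bound L on the sizes. *)
pose m := maxn m1 m2.
have [delta1 d1 Z1] := b1 m (leq_maxl _ _).
have [delta2 d2 Z2] := b2 m (leq_maxr _ _).
pose delta := Num.min delta1 delta2.
have d0 : 0 < delta by rewrite lt_min d1.
have d_gt0 : (0 < d)%N := leq_trans k_gt0 k_le_d.
exists (delta * m.+1%:R^-1 * d.+1%:R^-1), m%:R; split=> [||n w dn w_sum0].
- by rewrite !mulr_gt0// invr_gt0 ltr0n.
- by [].
apply: le_trans (class_energy_exchange w_sum0); rewrite leeD2l//.
pose G (p : {ffun 'I_d -> 'I_n} * ('I_d * 'I_n)) : R :=
  (spread (tnth w) m%:R p.1 p.2.1 p.2.2)%:R * (tnth w p.2.2 - tnth w (p.1 p.2.1)).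
have G0 p : 0 <= G p.
  rewrite /G; have [/and4P[_ /forallP h _ _]|_] := boolP (spread _ _ _ _ _); last by rewrite mul0r.
  by rewrite mul1r subr_ge0.
(* The configuration decides, through [low_majority], which of the two kinds of eligibility is
   demanded of the sizes. *)
pose Z (p : {ffun 'I_d -> 'I_n} * ('I_d * 'I_n)) :=
  [set x : d.-tuple R | (forall b, (0 <= tnth x b <= m%:R)%R) /\
    (m.+1%:R^-1 <= (if low_majority (tnth w) m%:R k p.1 p.2.1 p.2.2 then g1 else g2) p.2.1 x)%R].
have mZ p : measurable (Z p).
  pose g := if low_majority (tnth w) m%:R k p.1 p.2.1 p.2.2 then g1 else g2.
  rewrite (_ : Z p = (\bigcap_(b in [set: 'I_d])
     ((fun x : d.-tuple R => tnth x b) @^-1` `[0, m%:R])) `&`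
     (g p.2.1 @^-1` `[m.+1%:R^-1, +oo[)).
    apply: measurableI.
      apply: fin_bigcap_measurable => // i _; rewrite -[X in measurable X]setTI.
      exact: measurable_tnth.
    rewrite -[X in measurable X]setTI; suff : measurable_fun setT (g p.2.1) by apply.
    by rewrite /g; case: (low_majority (tnth w) m%:R k p.1 p.2.1 p.2.2).
  apply/seteqP; split => x /= [x1 x2]; split.
  - by move=> b _ /=; rewrite in_itv/=.
  - by rewrite in_itv/= andbT.
  - by move=> b; have := x1 b I; rewrite /= in_itv.
  - by move: x2; rewrite in_itv/= andbT.
have FZ p : (delta%:E <= F (Z p))%E.
  rewrite /Z; case: ifP => _.
    by apply: le_trans (Z1 p.2.1); rewrite lee_fin ge_min lexx.
  by apply: le_trans (Z2 p.2.1); rewrite lee_fin ge_min lexx orbT.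
pose c p := m.+1%:R^-1 * G p.
have c0 p : 0 <= c p by rewrite mulr_ge0.
have lb := integral_sum_indic_ge (P := fun p : {ffun 'I_d -> 'I_n} * ('I_d * 'I_n) => injectiveb p.1) (ltW d0) (fun p _ => c0 p) mZ (fun p _ => FZ p).
apply: (@le_trans _ _ (delta * \sum_(p : {ffun 'I_d -> 'I_n} * ('I_d * 'I_n) | injectiveb p.1) c p)%:E).
  set X := 2^-1 * l1norm w - _.
  rewrite lee_fin -!mulrA ler_wpM2l//; first exact: ltW.
  rewrite -mulr_sumr ler_wpM2l// mulrC ler_pdivrMr// [leRHS]mulrC.
  have := sum_spread (Ordinal d_gt0) w_sum0 (ler0n R m) dn.
  move=> /le_trans; apply; rewrite ler_wpM2l//.
  under eq_bigr => s _ do rewrite pair_bigA/=.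
  by rewrite pair_big/=; under [leLHS]eq_bigl do rewrite andbT.
apply: le_trans lb _; apply: ge0_le_integral => //=.
- by move=> x _; rewrite lee_fin sumr_ge0// => p _; rewrite mulr_ge0.
- apply/measurable_EFinP; under eq_fun do rewrite big_mkcond/=.
  apply: measurable_sum => p; case: (injectiveb _) => //.
  by apply: measurable_funM => //; exact: measurable_indic.
- exact/measurable_EFinP.
move=> x _; rewrite lee_fin /exchange_sum.
under [leRHS]eq_bigr => s _ do rewrite pair_bigA/=.
rewrite [leRHS]pair_big/=; under [leRHS]eq_bigl do rewrite andbT.
apply: ler_sum => -[s [a i]] /= /injectiveP s_inj.
rewrite indicE; have [|_] := boolP (x \in _); last first.
  by rewrite mulr0; exact: exchange_term_ge0.
rewrite inE => -[/= xb xg]; rewrite mulr1 /c /G/=.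
have [sp|_] := boolP (spread _ _ _ _ _); last first.
  by rewrite mul0r mulr0; exact: exchange_term_ge0.
rewrite mul1r mulrC.
apply: le_trans (exchange_term_spread k_gt0 k_le_d (x := tnth x) s_inj sp xb).
rewrite ler_wpM2l//.
  by rewrite subr_ge0; case/and4P: sp => _ /forallP.
by move: xg; rewrite /g2 /g1; case: ifP.
Qed.

End ClassDrift.

(** * Transition kernels *)

Section PushMeasure.
Context {R : realType} {d1 d2 : measure_display}
  {T1 : measurableType d1} {T2 : measurableType d2}.
Variables (mu : {finite_measure set T1 -> \bar R}) (K : R.-pker T1 ~> T2).

Let const_kernel : unit -> {measure set T1 -> \bar R} := fun=> mu.

Let measurable_const_kernel U : measurable U ->
  measurable_fun setT (const_kernel ^~ U).
Proof. by move=> mU; exact: measurable_cst. Qed.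

HB.instance Definition _ := isKernel.Build _ _ unit T1 R const_kernel
  measurable_const_kernel.

Let const_kernel_uub : measure_fam_uub const_kernel.
Proof.
exists (fine (mu setT) + 1) => x; rewrite /const_kernel EFinD fineK ?fin_num_measure//.
by rewrite lteDl ?fin_num_measure// lte_fin.
Qed.

HB.instance Definition _ :=
  Kernel_isFinite.Build _ _ unit T1 R const_kernel const_kernel_uub.

Let snd_kernel : (unit * T1)%type -> {measure set T2 -> \bar R} := K \o snd.

Let measurable_snd_kernel U : measurable U -> measurable_fun setT (snd_kernel ^~ U).
Proof.
by move=> mU; apply: (measurableT_comp (measurable_kernel K U mU)); exact: measurable_snd.
Qed.

HB.instance Definition _ := isKernel.Build _ _ (unit * T1)%type T2 R snd_kernel
  measurable_snd_kernel.

Let snd_kernel_prob p : snd_kernel p setT = 1%E. Proof. exact: prob_kernel. Qed.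

HB.instance Definition _ :=
  Kernel_isProbability.Build _ _ (unit * T1)%type T2 R snd_kernel snd_kernel_prob.

(** The measure mu K, obtained by composing kernels that start from the one-point space, so that its
    measure structure and integral formula come from kernel composition. *)
Definition push_measure : set T2 -> \bar R := kcomp const_kernel snd_kernel tt.

Lemma push_measureE A : push_measure A = (\int[mu]_w K w A)%E.
Proof. by []. Qed.

HB.instance Definition _ := Measure.on push_measure.

Lemma push_measureT : push_measure setT = mu setT.
Proof.
rewrite push_measureE; under eq_integral do rewrite prob_kernel.
by rewrite integral_cst// mul1e.
Qed.

Let push_measure_fin : fin_num_fun push_measure.
Proof.
apply: lty_fin_num_fun; have := push_measureT; rewrite /= => ->.
by rewrite ltey_eq fin_num_measure.
Qed.

HB.instance Definition _ := Measure_isFinite.Build _ _ _ push_measure push_measure_fin.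

Lemma integral_push_measure f : (forall z, (0 <= f z)%E) -> measurable_fun setT f ->
  (\int[push_measure]_z f z = \int[mu]_w \int[K w]_z f z)%E.
Proof. exact: integral_kcomp. Qed.

End PushMeasure.

Section SubMeasure.
Context {R : realType} {d : measure_display} {T : measurableType d}.
Variables (mu lam : {finite_measure set T -> \bar R}).
Hypothesis lam_le : forall A, measurable A -> (lam A <= mu A)%E.

(** The difference mu - lam. The domination is an argument, so that the measure structure can be
    attached to the term; the maximum with 0 ensures nonnegativity on nonmeasurable sets as well. *)
Definition sub_measure (_ : forall A, measurable A -> (lam A <= mu A)%E) (A : set T) : \bar R :=
  maxe 0%E (mu A - lam A)%E.

Local Notation sub := (sub_measure lam_le).

Lemma sub_measureE A : measurable A -> sub A = (mu A - lam A)%E.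
Proof.
move=> mA; rewrite /sub_measure max_r// sube_ge0 ?lam_le//.
by rewrite fin_num_measure.
Qed.

Let sub0 : sub set0 = 0%E. Proof. by rewrite sub_measureE// !measure0 sube0. Qed.

Let sub_ge0 A : (0 <= sub A)%E. Proof. by rewrite /sub_measure le_max lexx. Qed.

Let sub_sigma_additive : semi_sigma_additive sub.
Proof.
move=> F mF tF mUF; rewrite sub_measureE//.
rewrite (_ : (fun n => _) =
  (fun n => (\sum_(0 <= i < n) mu (F i)) - (\sum_(0 <= i < n) lam (F i)))%E).
  apply: cvgeB; last 2 first.
  - exact: measure_semi_sigma_additive.
  - exact: measure_semi_sigma_additive.
  by rewrite fin_num_adde_defl// fin_numN fin_num_measure.
apply/funext => n; rewrite -sumeN.
  rewrite -big_split/=; apply: eq_bigr => i _; exact: sub_measureE.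
move=> i j _ _; rewrite fin_num_adde_defl// fin_num_measure//.
Qed.

HB.instance Definition _ := isMeasure.Build _ _ _ sub sub0 sub_ge0 sub_sigma_additive.

Lemma sub_measureK A : measurable A -> (sub A + lam A = mu A)%E.
Proof. by move=> mA; rewrite sub_measureE// subeK// fin_num_measure. Qed.

Let sub_fin : fin_num_fun sub.
Proof.
by move=> A mA; rewrite /= sub_measureE// fin_numB !fin_num_measure.
Qed.

HB.instance Definition _ := Measure_isFinite.Build _ _ _ sub sub_fin.

Lemma integral_sub_measure f : (forall z, (0 <= f z)%E) -> measurable_fun setT f ->
  (\int[sub]_z f z + \int[lam]_z f z = \int[mu]_z f z)%E.
Proof.
move=> f0 mf; rewrite -ge0_integral_measure_add//.
apply: eq_measure_integral => A mA _.
by have := measure_addE sub lam A; rewrite /= sub_measureK.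
Qed.

End SubMeasure.

Section Average.
Context {R : realType} {d : measure_display} {T : measurableType d}.
Variable Q : R.-pker T ~> T.
Implicit Types f g : T -> \bar R.
Local Open Scope ereal_scope.

Definition average f (w : T) : \bar R := \int[Q w]_z f z.

Lemma average_ge0 f w : (forall z, 0 <= f z) -> 0 <= average f w.
Proof. by move=> f0; exact: integral_ge0. Qed.

Lemma measurable_average f : (forall z, 0 <= f z) -> measurable_fun setT f ->
  measurable_fun setT (average f).
Proof. by move=> f0 mf; apply: measurable_fun_integral_kernel => // U; exact: measurable_kernel. Qed.

Lemma average_cst (r : R) w : average (cst r%:E) w = r%:E.
Proof. by rewrite /average integral_cst// prob_kernel mule1. Qed.

Lemma le_average f g w : (forall z, 0 <= f z) -> measurable_fun setT f ->
  measurable_fun setT g -> (forall z, f z <= g z) -> average f w <= average g w.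
Proof.
by move=> f0 mf mg fg; apply: ge0_le_integral => // z _; exact: (le_trans (f0 z)).
Qed.

Lemma averageD f g w : (forall z, 0 <= f z) -> (forall z, 0 <= g z) ->
  measurable_fun setT f -> measurable_fun setT g ->
  average (fun z => f z + g z) w = average f w + average g w.
Proof. by move=> f0 g0 mf mg; exact: ge0_integralD. Qed.

Lemma averageZ (r : R) f w : (0 <= r)%R -> (forall z, 0 <= f z) ->
  measurable_fun setT f -> average (fun z => r%:E * f z) w = r%:E * average f w.
Proof. by move=> r0 f0 mf; exact: ge0_integralZl. Qed.

Lemma iter_average_ge0 m f w : (forall z, 0 <= f z) -> 0 <= iter m average f w.
Proof. by move=> f0; elim: m w => [|m IH] w //=; exact: average_ge0. Qed.

Lemma measurable_iter_average m f : (forall z, 0 <= f z) -> measurable_fun setT f ->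
  measurable_fun setT (iter m average f).
Proof.
move=> f0 mf; elim: m => [//|m IH] /=; apply: measurable_average => // z.
exact: iter_average_ge0.
Qed.

Lemma le_iter_average m f g w : (forall z, 0 <= f z) -> measurable_fun setT f ->
  measurable_fun setT g -> (forall z, f z <= g z) ->
  iter m average f w <= iter m average g w.
Proof.
move=> f0 mf mg fg; have g0 z : 0 <= g z by exact: le_trans (fg z).
elim: m w => [|m IH] w //=; apply: le_average => //.
- by move=> z; exact: iter_average_ge0.
- exact: measurable_iter_average.
- exact: measurable_iter_average.
Qed.

Lemma iter_averageD m f g w : (forall z, 0 <= f z) -> (forall z, 0 <= g z) ->
  measurable_fun setT f -> measurable_fun setT g ->
  iter m average (fun z => f z + g z) w = iter m average f w + iter m average g w.
Proof.
move=> f0 g0 mf mg; elim: m w => [|m IH] w //=; rewrite -averageD.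
- by congr average; apply/funext.
- by move=> z; exact: iter_average_ge0.
- by move=> z; exact: iter_average_ge0.
- exact: measurable_iter_average.
- exact: measurable_iter_average.
Qed.

Lemma iter_averageZ m (r : R) f w : (0 <= r)%R -> (forall z, 0 <= f z) ->
  measurable_fun setT f ->
  iter m average (fun z => r%:E * f z) w = r%:E * iter m average f w.
Proof.
move=> r0 f0 mf; elim: m w => [|m IH] w //=; rewrite -averageZ//.
- by congr average; apply/funext.
- by move=> z; exact: iter_average_ge0.
- exact: measurable_iter_average.
Qed.

Lemma iter_average_cst m (r : R) w : iter m average (cst r%:E) w = r%:E.
Proof.
elim: m w => [//|m IH] w /=; rewrite -[RHS](average_cst r w); congr average.
by apply/funext => z; rewrite IH.
Qed.

Lemma average_cvg (f_ : nat -> T -> \bar R) f w :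
  (forall m, measurable_fun setT (f_ m)) -> (forall m z, 0 <= f_ m z <= 1) ->
  (forall z, f_ ^~ z @ \oo --> f z) -> (fun m => average (f_ m) w) @ \oo --> average f w.
Proof.
move=> mf f01 ff; apply: (@dominated_cvg _ _ _ _ _ _ _ _ (cst 1)) => //.
- apply/integrableP; split; first exact: measurable_cst.
  by under eq_integral do rewrite /= normr1; rewrite integral_cst// prob_kernel mule1 ltry.
- by move=> m z _; case/andP: (f01 m z) => f0 f1; rewrite gee0_abs.
Qed.

Lemma iter_average_cvg0 m (f_ : nat -> T -> \bar R) w :
  (forall m, measurable_fun setT (f_ m)) -> (forall m z, 0 <= f_ m z <= 1) ->
  (forall z, f_ ^~ z @ \oo --> 0) -> (fun i => iter m average (f_ i) w) @ \oo --> 0.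
Proof.
move=> mf f01 ff; have f0 i z : 0 <= f_ i z by case/andP: (f01 i z).
elim: m w => [|m IH] w //=.
rewrite -[X in _ --> X](average_cst 0 w); apply: average_cvg => //.
- by move=> i; exact: measurable_iter_average.
- move=> i z; rewrite iter_average_ge0//= -(iter_average_cst m 1 z).
  by apply: le_iter_average => // {}z; case/andP: (f01 i z).
Qed.

End Average.

(** * Recurrence from a drift condition *)

Section Survival.
Context {R : realType} {d : measure_display} {T : measurableType d}.
Variable Q : R.-pker T ~> T.
Local Open Scope ereal_scope.

(* The probability of surviving m steps when a step from w is survived with
   probability a w. *)
Definition survival (a : T -> R) (m : nat) : T -> \bar R :=
  iter m (fun f w => (a w)%:E * average Q f w) (cst 1).

Section Bounds.
Variable a : T -> R.
Hypotheses (ma : measurable_fun setT a) (a01 : forall w, (0 <= a w <= 1)%R).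

Let a0 w : 0 <= (a w)%:E. Proof. by rewrite lee_fin; case/andP: (a01 w). Qed.

Let a1 w : (a w)%:E <= 1. Proof. by rewrite lee_fin; case/andP: (a01 w). Qed.

Lemma survival_ge0 m w : 0 <= survival a m w.
Proof. by elim: m w => [//|m IH] w /=; rewrite mule_ge0// average_ge0. Qed.

Lemma measurable_survival m : measurable_fun setT (survival a m).
Proof.
elim: m => [|m IH] /=; first exact: measurable_cst.
apply: emeasurable_funM; first exact/measurable_EFinP.
by apply: measurable_average => // z; exact: survival_ge0.
Qed.

Lemma survivalS_le m w : survival a m.+1 w <= survival a m w.
Proof.
elim: m w => [|m IH] w.
  by rewrite /= average_cst mule1.
rewrite [leRHS]/= [leLHS]/= lee_wpmul2l//.
apply: le_average; [exact: (survival_ge0 m.+1)|exact: (measurable_survival m.+1)|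
  exact: (measurable_survival m)|exact: IH].
Qed.

Lemma survival_le1 m w : survival a m w <= 1.
Proof. by elim: m => [//|m IH]; exact: le_trans (survivalS_le _ _) IH. Qed.

End Bounds.

Variables (V : T -> R) (B : set T).
Hypotheses (mV : measurable_fun setT V) (V_ge0 : forall w, (0 <= V w)%R)
  (mB : measurable B)
  (drift : forall w, ~ B w -> average Q (EFin \o V) w + 1 <= (V w)%:E).

Let avoid m := survival \1_(~` B) m.

Let indic01 (A : set T) w : (0 <= (\1_A w : R) <= 1)%R.
Proof. by rewrite indicE; case: (w \in A); rewrite lexx ler01. Qed.

Let mavoid m : measurable_fun setT (avoid m).
Proof. by apply: measurable_survival => //; apply: measurable_indic; exact: measurableC. Qed.

Let avoid_ge0 m w : 0 <= avoid m w. Proof. exact: survival_ge0. Qed.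

Let avoid_le1 m w : avoid m w <= 1.
Proof. by apply: survival_le1 => //; apply: measurable_indic; exact: measurableC. Qed.

(* m P(avoid B for m steps) is at most the expected sum of the unit decrements
   of V accumulated before B is hit. *)
Lemma avoid_bound m w : m%:R%:E * survival \1_(~` B) m w <= (V w)%:E.
Proof.
elim: m w => [|m IH] w; first by rewrite mul0e lee_fin.
have [Bw|NBw] := pselect (B w).
  by rewrite /= indicE memNset ?mul0e ?mule0 ?lee_fin//= => /(_ Bw).
rewrite /= indicE mem_set// mul1e; apply: le_trans (drift NBw).
rewrite -[X in _ + X](average_cst Q 1 w) -averageZ//.
rewrite -averageD//; last exact/measurable_EFinP.
apply: le_average.
- by move=> z; rewrite mule_ge0// avoid_ge0.
- by apply: measurable_funeM; exact: mavoid.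
- by apply: emeasurable_funD => //; exact/measurable_EFinP.
- move=> z; rewrite -natr1 EFinD ge0_muleDl//; apply: leeD; first exact: IH.
  by rewrite mul1e avoid_le1.
Qed.

Variables (A : set T) (rho delta : R).
Hypotheses (mA : measurable A) (rho01 : (0 < rho <= 1)%R) (delta_gt0 : (0 < delta)%R)
  (reach : forall w, B w ->
     exists m, delta%:E <= iter m (average Q) (EFin \o \1_A) w).

(** Each visit to A is recorded with probability rho, and [survival a] is the probability that none
    has been recorded. In the application rho is the probability of a gap longer than 1. *)
Let a w : R := (1 - rho * \1_A w)%R.

Let a01 w : (0 <= a w <= 1)%R.
Proof.
case/andP: rho01 => r0 r1; rewrite /a indicE; case: (w \in A) => /=.
  by rewrite mulr1 subr_ge0 r1 gerBl ltW.
by rewrite mulr0 subr0 ler01 lexx.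
Qed.

Let ma : measurable_fun setT a.
Proof.
by apply: measurable_funB => //; apply: measurable_funM => //; exact: measurable_indic.
Qed.

(** The probability that no visit to A is ever recorded; its supremum [s] will turn out to be 0. *)
Let h w := limn (survival a ^~ w).

Let cvg_h w : survival a ^~ w @ \oo --> h w.
Proof.
by apply: ereal_nonincreasing_is_cvgn; apply/nonincreasing_seqP => m; exact: survivalS_le.
Qed.

Let h_ge0 w : 0 <= h w.
Proof.
apply: lime_ge; first exact: cvg_h.
by apply: nearW => m; exact: survival_ge0.
Qed.

Let h_le1 w : h w <= 1.
Proof.
apply: lime_le; first exact: cvg_h.
by apply: nearW => m; exact: survival_le1.
Qed.

Let mh : measurable_fun setT h.
Proof.
apply: (emeasurable_fun_cvg (survival a)) => [m|w _]; last exact: cvg_h.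
exact: measurable_survival.
Qed.

Let h_fix w : h w = (a w)%:E * average Q h w.
Proof.
have /cvg_lim <- // : (fun m => survival a m.+1 w) @ \oo --> h w.
  by move: (@cvg_h w); rewrite -cvg_shiftS.
apply/cvg_lim => //; apply: cvgeZl => //; apply: average_cvg => //.
- by move=> m; exact: measurable_survival.
- by move=> m z; rewrite survival_ge0//= survival_le1.
Qed.

Let s := ereal_sup (range h).

Let h_le w : h w <= s. Proof. by apply: ereal_sup_ubound; exists w. Qed.

Let s_fin (w0 : T) : s \is a fin_num.
Proof.
rewrite ge0_fin_numE; last exact: le_trans (h_ge0 w0) (h_le w0).
by apply: (@le_lt_trans _ _ 1); [apply: ge_ereal_sup => _ [w _ <-]|exact: ltry].
Qed.

Let h_average m w : h w <= iter m (average Q) h w.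
Proof.
elim: m w => [//|m IH] w; apply: (@le_trans _ _ (average Q h w)).
  rewrite h_fix -[leRHS]mul1e lee_wpmul2r ?average_ge0//.
  by rewrite lee_fin; case/andP: (a01 w).
rewrite /=; apply: le_average => //; exact: measurable_iter_average.
Qed.

(** The cap keeps [1 - eta] nonnegative: nothing bounds [delta] when B is empty. *)
Let eta : R := Num.min (rho * delta)%R 1%R.

Let eta01 : (0 < eta <= 1)%R.
Proof.
by case/andP: rho01 => r0 r1; rewrite lt_min ltr01 mulr_gt0//= ge_min lexx orbT.
Qed.

(** Pointwise h is at most s times a. Hence [h w] is at most s times the mean of a after m steps,
    that is, one minus rho times the probability of being in A then. *)
Let h_le_B w : B w -> h w <= (1 - eta)%:E * s.
Proof.
move=> Bw; have [m dm] := reach Bw.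
have s0 : 0 <= s := le_trans (h_ge0 w) (h_le w).
have sf := s_fin w; have ss : s = (fine s)%:E by rewrite fineK.
have fs0 : (0 <= fine s)%R by rewrite fine_ge0.
apply: le_trans (h_average m w) _.
have ha z : h z <= (fine s)%:E * (a z)%:E.
  rewrite -ss h_fix muleC lee_wpmul2r//; first by rewrite lee_fin; case/andP: (a01 z).
  apply: (@le_trans _ _ (average Q (cst (fine s)%:E) z)).
    by apply: le_average => //; move=> y; rewrite /= -ss.
  by rewrite average_cst -ss.
have mEa : measurable_fun setT (EFin \o a) by exact/measurable_EFinP.
have a0 z : 0 <= (EFin \o a) z by rewrite lee_fin; case/andP: (a01 z).
apply: (@le_trans _ _ (iter m (average Q) (fun z => (fine s)%:E * (EFin \o a) z) w)).
  by apply: le_iter_average => //; exact: measurable_funeM.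
rewrite iter_averageZ// -ss muleC lee_wpmul2r//.
have mI : measurable_fun setT (EFin \o \1_A : T -> \bar R).
  by apply/measurable_EFinP; exact: measurable_indic.
have I0 z : 0 <= (EFin \o \1_A : T -> \bar R) z by rewrite lee_fin.
have r0 : (0 <= rho)%R by case/andP: rho01 => /ltW.
have sum1 : iter m (average Q) (EFin \o a) w +
    rho%:E * iter m (average Q) (EFin \o \1_A) w = 1.
  rewrite -iter_averageZ// -iter_averageD//.
  - rewrite -[RHS](iter_average_cst Q m 1 w); congr (iter m _ _ w).
    by apply/funext => z; rewrite /= -EFinM -EFinD /a subrK.
  - by move=> z; rewrite mule_ge0// lee_fin.
  - exact: measurable_funeM.
have aF : iter m (average Q) (EFin \o a) w \is a fin_num.
  rewrite ge0_fin_numE ?iter_average_ge0//; apply: (@le_lt_trans _ _ 1); last exact: ltry.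
  by rewrite -sum1 leeDl// mule_ge0// ?lee_fin// iter_average_ge0.
rewrite EFinB leeBrDr// -sum1 leeD2l//.
apply: le_trans (lee_wpmul2l _ dm); last by rewrite lee_fin.
by rewrite -EFinM lee_fin ge_min lexx.
Qed.

(** Run the chain until it hits B, for at most m steps: after a hit [h_le_B] applies, and otherwise
    h is at most s. *)
Let h_le_avoid m w : h w <= (1 - eta)%:E * s + s * avoid m w.
Proof.
have s0 : 0 <= s := le_trans (h_ge0 w) (h_le w).
have sf := s_fin w; have ss : s = (fine s)%:E by rewrite fineK.
have e0 : (0 <= 1 - eta)%R by case/andP: eta01 => _ e1; rewrite subr_ge0.
have es0 : 0 <= (1 - eta)%:E * s by rewrite mule_ge0// lee_fin.
elim: m w => [|m IH] w.
  by rewrite mule1 (le_trans (h_le w))// leeDr.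
have [Bw|NBw] := pselect (B w).
  by apply: le_trans (h_le_B Bw) _; rewrite leeDl// mule_ge0.
rewrite /avoid/= indicE mem_set// mul1e.
apply: le_trans (h_average 1 w) _ => /=.
have fs0 : (0 <= fine s)%R by rewrite fine_ge0.
rewrite ss -EFinM -[X in X + _](average_cst Q _ w) -averageZ//.
rewrite -averageD//.
- apply: le_average => //.
    apply: emeasurable_funD; first exact: measurable_cst.
    by apply: measurable_funeM; exact: mavoid.
  by move=> z; rewrite /= EFinM -ss; exact: IH.
- by move=> z; rewrite lee_fin mulr_ge0.
- by move=> z; rewrite mule_ge0// avoid_ge0.
- by apply: measurable_funeM; exact: mavoid.
Qed.

(** By [avoid_bound] the last term of [h_le_avoid] tends to 0, so [s <= (1 - eta) * s], which forces
    the finite number s to vanish. *)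
Lemma survival_cvg0 w : survival a ^~ w @ \oo --> 0.
Proof.
suff -> : 0 = h w by exact: cvg_h.
have s0 : 0 <= s := le_trans (h_ge0 w) (h_le w).
have sf := s_fin w; have ss : s = (fine s)%:E by rewrite fineK.
have fs0 : (0 <= fine s)%R by rewrite fine_ge0.
suff s_le : s <= (1 - eta)%:E * s.
  suff s_eq0 : s = 0 by apply/eqP; rewrite eq_le h_ge0/= -s_eq0.
  move: s_le; rewrite ss -EFinM lee_fin mulrBl mul1r lerBrDr gerDl.
  case/andP: eta01 => e0 _; rewrite pmulr_rle0// => fs_le.
  by congr EFin; apply/eqP; rewrite eq_le fs_le.
apply: ge_ereal_sup => _ [z _ <-].
apply/lee_addgt0Pr => e e0.
pose m := (Num.truncn (fine s * V z / e)).+1.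
apply: le_trans (h_le_avoid m z) _; rewrite leeD2l//.
have m0 : (0 < m%:R :> R)%R by rewrite ltr0n.
have av : avoid m z <= (V z / m%:R)%:E.
  rewrite EFinM lee_pdivlMr// muleC; exact: avoid_bound.
apply: le_trans (lee_wpmul2l _ av) _ => //.
rewrite ss -EFinM lee_fin mulrA ler_pdivrMr// -ler_pdivrMl// mulrC.
exact/ltW/truncnS_gt.
Qed.

End Survival.

(** * Invariant measures by regeneration *)

Section InvariantMeasure.
Context {R : realType} {d : measure_display} {T : measurableType d}.
Variables (K : R.-pker T ~> T) (M : {finite_measure set T -> \bar R}) (B : set T)
  (W : T -> R) (b c : R) (w0 : T).
Hypotheses (mB : measurable B) (mW : measurable_fun setT W)
  (W_ge0 : forall w, 0 <= W w) (c_gt0 : 0 < c) (b_ge0 : 0 <= b) (Bw0 : B w0).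
Local Open Scope ereal_scope.
Hypothesis drift : forall w,
  average K (EFin \o W) w + c%:E <= (W w)%:E + (b * \1_B w)%:E.
Hypothesis minorized : forall w A, B w -> measurable A -> M A <= K w A.
Hypotheses (M_gt0 : 0 < M setT) (b_le : b%:E <= \int[M]_w (W w)%:E).

Let massB (nu : {finite_measure set T -> \bar R}) : {nonneg R} :=
  NngNum (fine_ge0 (measure_ge0 nu B)).

Let massBE nu : (massB nu)%:num%:E = nu B.
Proof. by rewrite /= fineK// fin_num_measure. Qed.

Let minorized_push (nu : {finite_measure set T -> \bar R}) A : measurable A ->
  mscale (massB nu) M A <= push_measure nu K A.
Proof.
move=> mA; rewrite /mscale massBE push_measureE muleC -[X in X * _]fineK ?fin_num_measure//.
rewrite -[B in X in X <= _]setIT -integral_indic//.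
have m0 : (0 <= fine (M A))%R by rewrite fine_ge0.
rewrite -ge0_integralZl//; last by apply/measurable_EFinP; exact: measurable_indic.
apply: ge0_le_integral => //.
- by apply: measurable_funeM; apply/measurable_EFinP; exact: measurable_indic.
- exact: measurable_kernel.
move=> w _; rewrite indicE; have [/set_mem Bw|_] := boolP (w \in B).
  by rewrite mule1 fineK ?fin_num_measure//; exact: minorized.
by rewrite mule0.
Qed.

(* The part of nu K left after regeneration on B according to M. *)
Let unregenerated (nu : {finite_measure set T -> \bar R}) :
    {finite_measure set T -> \bar R} :=
  sub_measure (minorized_push nu).

(** The sub-probability law, up to the mass of M, after m steps of a cycle that starts from M and is
    killed at regeneration. Its sum over m, [potential], is the expected occupation during one
    cycle. *)
Let nu m : {finite_measure set T -> \bar R} := iter m unregenerated M.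

Let nuS A m : measurable A -> nu m.+1 A + nu m B * M A = push_measure (nu m) K A.
Proof. by move=> mA; rewrite -(sub_measureK (minorized_push (nu m)) mA) -massBE. Qed.

Let integral_nuS f m : (forall z, 0 <= f z) -> measurable_fun setT f ->
  \int[nu m.+1]_w f w + nu m B * \int[M]_w f w = \int[nu m]_w average K f w.
Proof.
move=> f0 mf; rewrite -integral_push_measure//.
rewrite -(integral_sub_measure (minorized_push (nu m)))//.
by rewrite ge0_integral_mscale// -massBE.
Qed.

(** M is dominated by the law [K w0] with [w0] in B, and the drift makes the mean of W under that
    law finite. *)
Let MW_fin : \int[M]_w (W w)%:E < +oo.
Proof.
pose delta : {finite_measure set T -> \bar R} := \d_w0.
have Mle A : measurable A -> M A <= push_measure delta K A.
  move=> mA; rewrite push_measureE integral_dirac//; last exact: measurable_kernel.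
  by rewrite diracT mul1e; exact: minorized.
have mEW : measurable_fun setT (EFin \o W) by exact/measurable_EFinP.
have W0 z : 0 <= (EFin \o W) z by rewrite lee_fin.
apply: (@le_lt_trans _ _ (average K (EFin \o W) w0)).
  have -> : average K (EFin \o W) w0 = \int[push_measure delta K]_w (W w)%:E.
    rewrite integral_push_measure// integral_dirac//; last exact: measurable_average.
    by rewrite diracT mul1e.
  rewrite -[leRHS](integral_sub_measure Mle)//.
  by rewrite leeDr// integral_ge0// => w _; rewrite lee_fin.
apply: (@le_lt_trans _ _ ((W w0)%:E + (b * \1_B w0)%:E)); last by rewrite -EFinD ltry.
by apply: le_trans (drift w0); rewrite leeDl// lee_fin ltW.
Qed.

(** The drift costs b on B, but regeneration removes [nu m B] times the integral of W against M,
    which is at least b by [b_le]. The two compensate, and a decrease by c per unit of mass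
    remains. *)
Let decrease m : \int[nu m.+1]_w (W w)%:E + c%:E * nu m setT <= \int[nu m]_w (W w)%:E.
Proof.
have mEW : measurable_fun setT (EFin \o W) by exact/measurable_EFinP.
have W0 z : 0 <= (EFin \o W) z by rewrite lee_fin.
have mI : measurable_fun setT (fun w => (b * \1_B w)%:E).
  by apply/measurable_EFinP; apply: measurable_funM => //; exact: measurable_indic.
have bF : b%:E * nu m B \is a fin_num by rewrite fin_numM// fin_num_measure.
rewrite -(@leeD2rE _ (b%:E * nu m B))//.
have -> : \int[nu m]_w (W w)%:E + b%:E * nu m B =
    \int[nu m]_w ((W w)%:E + (b * \1_B w)%:E).
  rewrite ge0_integralD//; last 2 first.
  - by move=> w _; rewrite lee_fin.
  - by move=> w _; rewrite lee_fin mulr_ge0.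
  congr (_ + _); under [RHS]eq_integral do rewrite EFinM.
  rewrite ge0_integralZl//; last by apply/measurable_EFinP; exact: measurable_indic.
  by rewrite integral_indic// setIT.
apply: (@le_trans _ _ (\int[nu m]_w (average K (EFin \o W) w + c%:E))).
  rewrite ge0_integralD//; last 3 first.
  - by move=> w _; exact: average_ge0.
  - exact: measurable_average.
  - by move=> w _; rewrite lee_fin ltW.
  rewrite integral_cst//= -integral_nuS// addeAC leeD2r// leeD2l//.
  by rewrite muleC lee_wpmul2l.
apply: ge0_le_integral => //.
- by move=> w _; rewrite adde_ge0 ?average_ge0// lee_fin ltW.
- by apply: emeasurable_funD => //; exact: measurable_average.
- by apply: emeasurable_funD.
Qed.

Let sum_mass N : \int[nu N]_w (W w)%:E + c%:E * \sum_(0 <= m < N) nu m setT <=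
  \int[M]_w (W w)%:E.
Proof.
elim: N => [|N IH]; first by rewrite big_geq// mule0 adde0.
rewrite big_nat_recr//= ge0_muleDr//; last exact: sume_ge0.
apply: le_trans IH; rewrite addeCA addeC leeD2r//.
exact: decrease.
Qed.

Definition potential : set T -> \bar R := mseries nu 0.

HB.instance Definition _ := Measure.on potential.

Let potential_fin : fin_num_fun potential.
Proof.
apply: lty_fin_num_fun; apply: (@le_lt_trans _ _ ((c^-1)%:E * \int[M]_w (W w)%:E)).
  apply: lime_le; first by apply: is_cvg_nneseries.
  apply: nearW => N; rewrite muleC lee_pdivlMr// muleC.
  apply: le_trans (sum_mass N); rewrite leeDr// integral_ge0// => w _.
  by rewrite lee_fin.
by rewrite lte_mul_pinfty// lee_fin invr_ge0 ltW.
Qed.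

HB.instance Definition _ := Measure_isFinite.Build _ _ _ potential potential_fin.

Let potentialS A : potential A = M A + \sum_(0 <= m <oo) nu m.+1 A.
Proof.
rewrite /potential /mseries (nneseries_split _ 1)// big_nat1; congr (_ + _).
by rewrite -(@nneseries_addn _ _ 1%N)//; apply: eq_eseriesr => m _; rewrite addn1.
Qed.

Let push_potential A : measurable A ->
  push_measure potential K A + M A = potential A + potential B * M A.
Proof.
move=> mA; rewrite push_measureE ge0_integral_measure_series//; last first.
  exact: measurable_kernel.
rewrite (eq_eseriesr (g := fun m => nu m.+1 A + (fine (M A))%:E * nu m B)); last first.
  by move=> m _; rewrite fineK ?fin_num_measure// muleC nuS.
have mA0 : (0 <= fine (M A))%R by rewrite fine_ge0.
rewrite nneseriesD//; last by move=> m _ _; rewrite mule_ge0// lee_fin.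
rewrite nneseriesZl// fineK ?fin_num_measure// potentialS addeAC.
by congr (_ + _); [exact: addeC|exact: muleC].
Qed.

Lemma potential_gt0 : 0 < potential setT.
Proof.
by rewrite potentialS (lt_le_trans M_gt0)// leeDl// nneseries_ge0.
Qed.

(* Comparing total masses shows that regeneration takes place at total rate 1. *)
Lemma potential_invariant A : measurable A -> push_measure potential K A = potential A.
Proof.
have addIe (x y z : \bar R) : z \is a fin_num -> x + z = y + z -> x = y.
  by move=> zf /(congr1 (fun t => t - z)); rewrite !addeK.
have M1 : potential B * M setT = M setT.
  apply/esym/(addIe _ _ (potential setT)); first exact: fin_num_measure.
  by have := push_potential measurableT; rewrite push_measureT addeC [RHS]addeC.
have Bf : potential B \is a fin_num by exact: fin_num_measure.
have Mf : M setT \is a fin_num by exact: fin_num_measure.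
have B1 : potential B = 1.
  move: M1; rewrite -(fineK Bf) -{2}(fineK Mf) -[X in _ * X](fineK Mf) -EFinM => -[] M1.
  congr EFin; apply: (mulIf _); last by rewrite mul1r; exact: M1.
  by rewrite gt_eqF// fine_gt0// M_gt0/= ltey_eq Mf.
move=> mA; have := push_potential mA; rewrite B1 mul1e => /addIe -> //.
exact: fin_num_measure.
Qed.

Lemma exists_invariant_measure : exists pi : {finite_measure set T -> \bar R},
  0 < pi setT /\ forall A, measurable A -> push_measure pi K A = pi A.
Proof.
by exists potential; split; [exact: potential_gt0|exact: potential_invariant].
Qed.

End InvariantMeasure.

(** * Resolvent of the chain and return to one-step invariance *)

Section Resolvent.
Context {R : realType} {d : measure_display} {T : measurableType d}.
Variables (Q : R.-pker T ~> T) (q : {nonneg R}).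
Hypothesis q_lt1 : (q%:num < 1)%R.
Local Open Scope ereal_scope.

Let coef_ge0 m : (0 <= (1 - q%:num) * q%:num ^+ m)%R.
Proof. by rewrite mulr_ge0// subr_ge0 ltW. Qed.

Let coef m : {nonneg R} := NngNum (coef_ge0 m).

Definition iter_push m (w : T) : {finite_measure set T -> \bar R} :=
  iter m (fun mu : {finite_measure set T -> \bar R} =>
    push_measure mu Q : {finite_measure set T -> \bar R}) \d_w.

Lemma integral_iter_push m w f : (forall z, 0 <= f z) -> measurable_fun setT f ->
  \int[iter_push m w]_z f z = iter m (average Q) f w.
Proof.
elim: m f => [|m IH] f f0 mf.
  by rewrite /= integral_dirac// diracT mul1e.
rewrite [LHS]integral_push_measure// IH -?iterSr//.
- by move=> z; exact: average_ge0.
- exact: measurable_average.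
Qed.

(** The law of the chain at an independent geometric time, equal to m with probability (1 - q)
    q^m. *)
Definition resolvent (w : T) : {measure set T -> \bar R} :=
  mseries (fun m => mscale (coef m) (iter_push m w)) 0.

Lemma integral_resolvent w f : (forall z, 0 <= f z) -> measurable_fun setT f ->
  \int[resolvent w]_z f z =
  \sum_(m <oo) ((1 - q%:num) * q%:num ^+ m)%:E * iter m (average Q) f w.
Proof.
move=> f0 mf; rewrite ge0_integral_measure_series//; apply: eq_eseriesr => m _.
by rewrite ge0_integral_mscale// integral_iter_push.
Qed.

Lemma resolventE w A : measurable A -> resolvent w A =
  \sum_(m <oo) ((1 - q%:num) * q%:num ^+ m)%:E * iter m (average Q) (EFin \o \1_A) w.
Proof.
move=> mA; transitivity (\int[resolvent w]_z (\1_A z)%:E).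
  by rewrite integral_indic// setIT.
by apply: integral_resolvent => //; apply/measurable_EFinP; exact: measurable_indic.
Qed.

Let measurable_resolvent A : measurable A -> measurable_fun setT (resolvent ^~ A).
Proof.
move=> mA; rewrite (_ : resolvent ^~ A = fun w =>
  \sum_(m <oo) ((1 - q%:num) * q%:num ^+ m)%:E * iter m (average Q) (EFin \o \1_A) w).
  apply: ge0_emeasurable_sum => [m w _ _|m _].
    apply: mule_ge0; first by rewrite lee_fin coef_ge0.
    by apply: iter_average_ge0 => z; rewrite lee_fin.
  apply: measurable_funeM; apply: measurable_iter_average => [z|].
    by rewrite lee_fin.
  by apply/measurable_EFinP; exact: measurable_indic.
by apply/funext => w; rewrite resolventE.
Qed.

HB.instance Definition _ := isKernel.Build _ _ T T R resolvent measurable_resolvent.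

Let geometric_sum : \sum_(m <oo) ((1 - q%:num) * q%:num ^+ m)%:E = 1.
Proof.
apply/cvg_lim => //.
rewrite (_ : (fun n => _) = (fun n => (1 - q%:num ^+ n)%:E)).
  apply: cvg_EFin; first by apply: nearW.
  rewrite -[X in _ --> X]subr0; apply: cvgB; first exact: cvg_cst.
  by apply: cvg_expr; rewrite ger0_norm.
apply/funext => n; elim: n => [|n IH]; first by rewrite big_geq// expr0 subrr.
by rewrite big_nat_recr//= IH -EFinD exprS; congr EFin; ring.
Qed.

Let resolvent_prob w : resolvent w setT = 1.
Proof.
rewrite resolventE// -geometric_sum; apply: eq_eseriesr => m _.
rewrite (_ : EFin \o \1_setT = cst 1) ?iter_average_cst ?mule1//.
by apply/funext => z; rewrite /= indicT.
Qed.

HB.instance Definition _ :=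
  Kernel_isProbability.Build _ _ T T R resolvent resolvent_prob.

(** In operator form K = (1 - q) I + q K Q. Integrated against a finite K-invariant measure, it
    gives invariance under Q, as q > 0. *)
Lemma resolvent_recursion f w : (forall z, 0 <= f z) -> measurable_fun setT f ->
  average resolvent f w =
  (1 - q%:num)%:E * f w + q%:num%:E * average resolvent (average Q f) w.
Proof.
move=> f0 mf; rewrite /average integral_resolvent// integral_resolvent//; last 2 first.
- by move=> z; exact: average_ge0.
- exact: measurable_average.
have t0 m : 0 <= ((1 - q%:num) * q%:num ^+ m)%:E * iter m (average Q) f w.
  by apply: mule_ge0; [rewrite lee_fin coef_ge0|exact: iter_average_ge0].
rewrite (nneseries_split _ 1)// big_nat1 expr0 mulr1 /=; congr (_ + _).
rewrite -(@nneseries_addn _ _ 1%N)// -nneseriesZl; last first.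
  move=> m _; apply: mule_ge0; first by rewrite lee_fin coef_ge0.
  by apply: iter_average_ge0 => z; exact: average_ge0.
apply: eq_eseriesr => m _; rewrite addn1 -iterSr muleA -EFinM.
by rewrite exprS mulrCA.
Qed.

End Resolvent.

Section InvariantProbability.
Context {R : realType} {d : measure_display} {T : measurableType d}.
Variables (Q : R.-pker T ~> T) (V : T -> R) (B : set T) (b : R)
  (M : {finite_measure set T -> \bar R}) (q : R) (w0 : T).
Hypotheses (mV : measurable_fun setT V) (V_ge0 : forall w, 0 <= V w)
  (mB : measurable B) (Bw0 : B w0) (b_ge0 : 0 <= b) (q_gt0 : 0 < q) (q_lt1 : q < 1).
Local Open Scope ereal_scope.
Hypothesis drift : forall w,
  average Q (EFin \o V) w + 1 <= (V w)%:E + (b * \1_B w)%:E.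
Hypothesis M_gt0 : 0 < M setT.
Hypothesis minorized : forall w A, B w -> measurable A ->
  M A <= \sum_(m <oo) (q ^+ m)%:E * iter m (average Q) (EFin \o \1_A) w.

Let qn : {nonneg R} := NngNum (ltW q_gt0).

Let qn_lt1 : (qn%:num < 1)%R. Proof. exact: q_lt1. Qed.

Let K := resolvent Q qn_lt1.

Let p_gt0 : (0 < 1 - q)%R. Proof. by rewrite subr_gt0. Qed.

Let pn : {nonneg R} := NngNum (ltW p_gt0).

Let M' : {finite_measure set T -> \bar R} := mscale pn M.

Let M'_gt0 : 0 < M' setT.
Proof. by rewrite /M' /= /mscale mule_gt0// lte_fin. Qed.

Let minorized' w A : B w -> measurable A -> M' A <= K w A.
Proof.
move=> Bw mA; rewrite resolventE// (eq_eseriesr (g := fun m =>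
    (1 - q)%:E * ((q ^+ m)%:E * iter m (average Q) (EFin \o \1_A) w))); last first.
  by move=> m _; rewrite muleA -EFinM.
rewrite nneseriesZl; last first.
  move=> m _; apply: mule_ge0; first by rewrite lee_fin exprn_ge0// ltW.
  by apply: iter_average_ge0 => z; rewrite lee_fin.
by rewrite lee_wpmul2l ?minorized// lee_fin ltW.
Qed.

Let QV w : R := fine (average Q (EFin \o V) w).

Let mEV : measurable_fun setT (EFin \o V). Proof. exact/measurable_EFinP. Qed.

Let QVE w : average Q (EFin \o V) w = (QV w)%:E.
Proof.
rewrite fineK// ge0_fin_numE ?average_ge0//.
apply: (@le_lt_trans _ _ (average Q (EFin \o V) w + 1)); first by rewrite leeDl.
by apply: le_lt_trans (drift w) _; rewrite -EFinD ltry.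
Qed.

Let drift_real w : (QV w + 1 <= V w + b * \1_B w)%R.
Proof. by have := drift w; rewrite QVE -!EFinD lee_fin. Qed.

Let b0 : R := (q * b / (1 - q))%R.

Let b0_ge0 : (0 <= b0)%R.
Proof. by rewrite /b0 divr_ge0// ?mulr_ge0// ltW. Qed.

(** The first summand makes up for the possible negativity of (V - q QV) / (1 - q), which is at
    least - b0. The second raises the integral of W against M' to at least b0, as the regeneration
    argument requires. *)
Let kappa : R := (b0 + b0 / fine (M' setT))%R.

(* The resolvent maps (V - q QV) / (1 - q) to V, so that this function
   inherits from V a drift condition with respect to the resolvent. *)
Let W w : R := ((V w - q * QV w) / (1 - q) + kappa)%R.

Let M'1_gt0 : (0 < fine (M' setT))%R.
Proof. by rewrite fine_gt0// M'_gt0 ltey_eq fin_num_measure. Qed.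

Let kappa_le_W w : (kappa <= W w + b0)%R.
Proof.
rewrite /W addrAC lerDr /b0 -mulrDl divr_ge0 ?(ltW p_gt0)//.
have := drift_real w; have : (\1_B w <= 1 :> R)%R by rewrite indicE; case: (_ \in _).
have := V_ge0 w => V0 I1 dr.
have : (b * \1_B w <= b)%R by rewrite ler_piMr.
move: q_gt0 q_lt1 => q0 q1 bI.
have : (0 <= q * (V w + b - QV w))%R by rewrite mulr_ge0 ?ltW//; lra.
have : (0 <= (1 - q) * V w)%R by rewrite mulr_ge0// ltW.
lra.
Qed.

Let W_ge0 w : (0 <= W w)%R.
Proof.
have := kappa_le_W w; rewrite -lerBlDr; apply: le_trans.
by rewrite /kappa addrAC subrr add0r divr_ge0// ltW.
Qed.

Let mQV : measurable_fun setT QV.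
Proof.
apply/measurable_EFinP; rewrite (_ : EFin \o QV = average Q (EFin \o V)).
  exact: measurable_average.
by apply/funext => w; rewrite QVE.
Qed.

Let mW : measurable_fun setT W.
Proof.
apply: measurable_funD => //; apply: measurable_funM => //.
by apply: measurable_funB => //; exact: measurable_funM.
Qed.

(** Follows from (1 - q) W + q QV = V + (1 - q) kappa, applied at each step. Keeping the remainder
    [q ^+ N] times the N-step mean of V on the left avoids subtracting extended reals. *)
Let telescope N w :
  \sum_(0 <= m < N) ((1 - q) * q ^+ m)%:E * iter m (average Q) (EFin \o W) w +
  (q ^+ N)%:E * iter N (average Q) (EFin \o V) w =
  (V w + kappa * (1 - q ^+ N))%:E.
Proof.
elim: N w => [|N IH] w; first by rewrite big_geq// add0e expr0 mul1e subrr mulr0 addr0.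
have EW_ge0 z : 0 <= (EFin \o W) z by rewrite lee_fin.
have mEW : measurable_fun setT (EFin \o W) by exact/measurable_EFinP.
have kappa_ge0 : (0 <= kappa)%R by rewrite /kappa addr_ge0// divr_ge0// ltW.
have step : (1 - q)%:E * iter N (average Q) (EFin \o W) w +
    q%:E * iter N.+1 (average Q) (EFin \o V) w =
    iter N (average Q) (EFin \o V) w + ((1 - q) * kappa)%:E.
  have QV0 z : 0 <= average Q (EFin \o V) z by exact: average_ge0.
  have mQV' : measurable_fun setT (average Q (EFin \o V)) by exact: measurable_average.
  rewrite iterSr -(iter_averageZ Q N w (ltW p_gt0) EW_ge0 mEW).
  rewrite -(iter_averageZ Q N w (ltW q_gt0) QV0 mQV').
  rewrite -iter_averageD//; last 4 first.
  - by move=> z; rewrite mule_ge0// lee_fin ltW.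
  - by move=> z; rewrite mule_ge0 ?average_ge0// lee_fin ltW.
  - exact: measurable_funeM.
  - by apply: measurable_funeM; exact: measurable_average.
  rewrite -[X in _ = _ + X](iter_average_cst Q N _ w) -iter_averageD//; last first.
    by move=> z; rewrite lee_fin mulr_ge0// ltW.
  congr (iter N _ _ w); apply/funext => z; rewrite QVE /= -!EFinM -!EFinD; congr EFin.
  by rewrite /W; field; rewrite gt_eqF.
have sumF : \sum_(0 <= m < N) ((1 - q) * q ^+ m)%:E * iter m (average Q) (EFin \o W) w
    \is a fin_num.
  rewrite ge0_fin_numE; last first.
    apply: sume_ge0 => m _; rewrite mule_ge0 ?iter_average_ge0// lee_fin.
    by rewrite mulr_ge0 ?exprn_ge0 ?ltW.
  apply: (@le_lt_trans _ _ (V w + kappa * (1 - q ^+ N))%:E); last exact: ltry.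
  rewrite -IH leeDl// mule_ge0 ?iter_average_ge0// lee_fin.
  by rewrite exprn_ge0// ltW.
rewrite big_nat_recr//= -addeA.
have -> : ((1 - q) * q ^+ N)%:E * iter N (average Q) (EFin \o W) w +
    (q ^+ N.+1)%:E * average Q (iter N (average Q) (EFin \o V)) w =
    (q ^+ N)%:E * iter N (average Q) (EFin \o V) w + (q ^+ N * ((1 - q) * kappa))%:E.
  have comm (x : R) (y : \bar R) : (x * q ^+ N)%:E * y = (q ^+ N)%:E * (x%:E * y).
    by rewrite muleA -EFinM mulrC.
  rewrite exprS !comm.
  have qN0 : 0 <= (q ^+ N)%:E by rewrite lee_fin exprn_ge0// ltW.
  rewrite -ge0_muleDr//; last 2 first.
  - by rewrite mule_ge0 ?iter_average_ge0// lee_fin ltW.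
  - by apply: mule_ge0; [rewrite lee_fin ltW|exact: (iter_average_ge0 Q N.+1)].
  rewrite (_ : average Q _ w = iter N.+1 (average Q) (EFin \o V) w)// step.
  by rewrite ge0_muleDr// ?iter_average_ge0// lee_fin mulr_ge0// ltW.
by rewrite addeA IH -EFinD exprS; congr EFin; ring.
Qed.

Let resolvent_drift w :
  average K (EFin \o W) w + (q / (1 - q))%:E <= (W w)%:E + (b0 * \1_B w)%:E.
Proof.
have EW_ge0 z : 0 <= (EFin \o W) z by rewrite lee_fin.
have mEW : measurable_fun setT (EFin \o W) by exact/measurable_EFinP.
have kappa_ge0 : (0 <= kappa)%R by rewrite /kappa addr_ge0// divr_ge0// ltW.
apply: (@le_trans _ _ ((V w + kappa)%:E + (q / (1 - q))%:E)).
  rewrite leeD2r// /average integral_resolvent//; apply: lime_le.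
    apply: is_cvg_nneseries => m _ _; rewrite mule_ge0 ?iter_average_ge0// lee_fin.
    by rewrite mulr_ge0 ?exprn_ge0 ?ltW.
  apply: nearW => N; apply: (@le_trans _ _ (V w + kappa * (1 - q ^+ N))%:E).
    rewrite -telescope leeDl// mule_ge0 ?iter_average_ge0// lee_fin.
    by rewrite exprn_ge0// ltW.
  by rewrite lee_fin lerD2l ler_piMr// gerBl exprn_ge0// ltW.
rewrite -!EFinD lee_fin /W /b0 -subr_ge0.
rewrite (_ : (_ - _)%R = (q / (1 - q) * (V w + b * \1_B w - (QV w + 1)))%R).
  by rewrite mulr_ge0 ?subr_ge0// divr_ge0// ltW.
by field; rewrite gt_eqF.
Qed.

Lemma exists_invariant_probability : exists pi : probability T R,
  forall A, measurable A -> \int[pi]_w Q w A = pi A.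
Proof.
have kappa_ge0 : (0 <= kappa)%R by rewrite /kappa addr_ge0// divr_ge0// ltW.
have q0 : (0 < q / (1 - q))%R by rewrite divr_gt0.
have b_le : b0%:E <= \int[M']_w (W w)%:E.
  apply: (@le_trans _ _ (\int[M']_w (b0 / fine (M' setT))%:E)).
    rewrite integral_cst// -[X in _ * X]fineK ?fin_num_measure// -EFinM divfK//.
    by rewrite gt_eqF.
  apply: ge0_le_integral => //.
  - by move=> w _; rewrite lee_fin divr_ge0// ltW.
  - exact/measurable_EFinP.
  by move=> w _; rewrite lee_fin; have := kappa_le_W w; rewrite /kappa addrC lerD2r.
have [pi [pi_gt0 piK]] := exists_invariant_measure mB mW W_ge0 q0 b0_ge0 Bw0
  resolvent_drift minorized' M'_gt0 b_le.
have integral_piK f : (forall z, 0 <= f z) -> measurable_fun setT f ->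
    \int[pi]_w average K f w = \int[pi]_w f w.
  move=> f0 mf; rewrite -integral_push_measure//.
  by apply: eq_measure_integral => A mA _; rewrite -[RHS]piK.
have piQ A : measurable A -> \int[pi]_w Q w A = pi A.
  move=> mA; have mI : measurable_fun setT (EFin \o \1_A : T -> \bar R).
    by apply/measurable_EFinP; exact: measurable_indic.
  have I0 z : 0 <= (EFin \o \1_A : T -> \bar R) z by rewrite lee_fin.
  have avgE w : average Q (EFin \o \1_A) w = Q w A.
    by rewrite /average integral_indic// setIT.
  have piI : \int[pi]_w (EFin \o \1_A) w = pi A by rewrite integral_indic// setIT.
  have := integral_piK _ I0 mI.
  rewrite (eq_integral (fun w => (1 - q)%:E * (EFin \o \1_A) w +
     q%:E * average K (average Q (EFin \o \1_A)) w)); last first.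
    by move=> w _; exact: resolvent_recursion.
  have mQI : measurable_fun setT (average Q (EFin \o \1_A)) by exact: measurable_average.
  have QI0 z : 0 <= average Q (EFin \o \1_A) z by exact: average_ge0.
  have mKQI : measurable_fun setT (average K (average Q (EFin \o \1_A))).
    exact: measurable_average.
  have KQI0 z : 0 <= average K (average Q (EFin \o \1_A)) z by exact: average_ge0.
  rewrite ge0_integralD//; last 4 first.
  - by move=> w _; rewrite mule_ge0// lee_fin ltW.
  - exact: measurable_funeM.
  - by move=> w _; rewrite mule_ge0// lee_fin ltW.
  - exact: measurable_funeM.
  rewrite ge0_integralZl ?lee_fin ?ltW// ge0_integralZl ?lee_fin ?ltW//.
  rewrite integral_piK// piI.
  rewrite (eq_integral (fun w => Q w A)); last by move=> w _; rewrite avgE.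
  have Af : pi A \is a fin_num by exact: fin_num_measure.
  rewrite -(fineK Af); case: (\int[pi]_w Q w A) => [r| |].
  - rewrite -!EFinM -EFinD => -[] e; congr EFin.
    by apply: (mulfI (lt0r_neq0 q_gt0)); lra.
  - by rewrite mulry gtr0_sg// mul1e -EFinM addey.
  - by rewrite mulrNy gtr0_sg// mul1e -EFinM addeNy.
have piT_fin : pi setT \is a fin_num by exact: fin_num_measure.
have c0 : (0 <= (fine (pi setT))^-1)%R by rewrite invr_ge0 fine_ge0.
pose scale : {measure set T -> \bar R} := mscale (NngNum c0) pi.
have scaleT : scale setT = 1.
  rewrite /scale /= /mscale /= -[X in _ * X](fineK piT_fin) -EFinM mulVf//.
  by rewrite -eqe (fineK piT_fin) gt_eqF.
pose scale_prob := Measure_isProbability.Build _ _ _ scale scaleT.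
exists (HB.pack_for (probability T R) (scale : set T -> \bar R) (Measure.class scale) scale_prob) => A mA.
transitivity (\int[scale]_w Q w A) => //.
rewrite ge0_integral_mscale//; last exact: measurable_kernel.
by rewrite piQ.
Qed.

End InvariantProbability.

(** * Independence *)

Section IndependentFamilies.
Context {d : measure_display} {Omega : measurableType d} {R : realType}.
Variables (P : probability Omega R) (I : eqType) (G : I -> set (set Omega)).
Hypotheses (mG : forall i A, G i A -> measurable A)
  (GI : forall i, setI_closed (G i)) (indep : mutually_independent P G).
Local Open Scope ereal_scope.

Definition generated_by (J : pred I) : set (set Omega) :=
  <<s [set A | exists2 i, J i & G i A] >>.

(** A pi-system that generates the same sigma-algebra; on it independence is the product formula of
    the hypothesis. *)
Let cylinders (J : pred I) : set (set Omega) :=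
  [set C | exists (s : seq I) (A : I -> set Omega), [/\ uniq s, all J s,
     (forall i, i \in s -> G i (A i)) & C = \bigcap_(i in [set` s]) A i]].

Let cylinders_setT J : cylinders J setT.
Proof.
exists [::], (fun=> setT); split => //.
by apply/seteqP; split => // x _ i.
Qed.

Let measurable_cylinders J C : cylinders J C -> measurable C.
Proof.
move=> [s [A [_ _ GA ->]]].
apply: fin_bigcap_measurable => [|i /= si]; first exact: finite_seq.
exact: mG (GA i si).
Qed.

Let cylinders_setI J : setI_closed (cylinders J).
Proof.
move=> _ _ [s [A [us Js GA ->]]] [t [B [ut Jt GB ->]]].
exists (undup (s ++ t)), (fun i =>
  if i \in s then (if i \in t then A i `&` B i else A i) else B i).
split; first exact: undup_uniq.
- by apply/allP => i; rewrite mem_undup mem_cat => /orP[/(allP Js)|/(allP Jt)].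
- move=> i; rewrite mem_undup mem_cat; case: ifPn => [si _|_ /= ti]; last exact: GB.
  by case: ifPn => [ti|_]; [apply: GI; [exact: GA|exact: GB]|exact: GA].
- apply/seteqP; split => [x [/= Ax Bx] i /=|x /= ABx].
    rewrite mem_undup mem_cat; case: ifPn => [si _|_ /= ti]; last exact: Bx.
    by case: ifPn => [ti|_]; [split; [exact: Ax|exact: Bx]|exact: Ax].
  split => i /= si.
    by have := ABx i; rewrite /= mem_undup mem_cat si => /(_ isT); case: ifP => // _ [].
  have := ABx i; rewrite /= mem_undup mem_cat si orbT => /(_ isT).
  by case: ifP => // _ [].
Qed.

Let generated_cylinders J : generated_by J `<=` <<s cylinders J >>.
Proof.
apply: smallest_sub; first exact: smallest_sigma_algebra.
move=> A [i Ji GA]; apply: sub_sigma_algebra; exists [:: i], (fun=> A); split => //=.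
- by rewrite Ji.
- by move=> j; rewrite inE => /eqP ->.
- by apply/seteqP; split => [x Ax j //|x /(_ i)]; apply; rewrite /= inE.
Qed.

Lemma measurable_generated J A : generated_by J A -> measurable A.
Proof.
apply: smallest_sub; first exact: sigma_algebra_measurable.
by move=> B [i _]; exact: mG.
Qed.

Let independent_cylinders (J1 J2 : pred I) A B : (forall i, J1 i -> ~~ J2 i) ->
  cylinders J1 A -> cylinders J2 B -> P (A `&` B) = P A * P B.
Proof.
move=> J12 [s [A' [us Js GA ->]]] [t [B' [ut Jt GB ->]]].
have st i : i \in t -> i \notin s.
  by move=> ti; apply: contraTN (allP Jt i ti) => /(allP Js)/J12.
pose C i := if i \in s then A' i else B' i.
have -> : \bigcap_(i in [set` s]) A' i `&` \bigcap_(i in [set` t]) B' i =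
    \bigcap_(i in [set` s ++ t]) C i.
  apply/seteqP; split => [x [/= Ax Bx] i /=|x /= ABx].
    by rewrite mem_cat /C; case: ifPn => [si _|_ /= ti]; [exact: Ax|exact: Bx].
  split => i /= si; have := ABx i; rewrite /= mem_cat si ?orbT => /(_ isT); rewrite /C.
    by rewrite si.
  by rewrite (negbTE (st _ si)).
rewrite (indep us GA) (indep ut GB) indep; last 2 first.
- rewrite cat_uniq us ut andbT; apply/hasPn => i; exact: st.
- move=> i; rewrite mem_cat /C; case: ifPn => [si _|_ /= ti]; [exact: GA|exact: GB].
rewrite big_cat /=; congr (_ * _).
  by rewrite big_seq [RHS]big_seq; apply: eq_bigr => i si; rewrite /C si.
by rewrite big_seq [RHS]big_seq; apply: eq_bigr => i ti; rewrite /C (negbTE (st _ ti)).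
Qed.

(** Both sides are finite measures in A that agree on a pi-system. The argument is applied to each
    of the two sides of an intersection in turn. *)
Let extend_independence (F : set (set Omega)) (B : set Omega) :
  setI_closed F -> F setT -> F `<=` measurable -> measurable B ->
  (forall A, F A -> P (A `&` B) = P A * P B) ->
  forall A, <<s F >> A -> P (A `&` B) = P A * P B.
Proof.
move=> FI FT mF mB FB A sA.
have PB : P B = (fine (P B))%:E by rewrite fineK// fin_num_measure.
pose m2 : {measure set Omega -> \bar R} :=
  mscale (NngNum (fine_ge0 (measure_ge0 P B))) P.
have m2E C : m2 C = P C * P B by rewrite /m2 /= /mscale/= -PB muleC.
rewrite -m2E.
apply: (@g_sigma_algebra_measure_unique _ _ _ F mF (fun=> setT) _ _
  (mrestr P mB) m2) => //.
- by apply/seteqP; split => // x _; exists 0%N.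
- by move=> C FC; rewrite m2E -FB.
- move=> _; apply: (@le_lt_trans _ _ 1); last exact: ltry.
  by apply: probability_le1; rewrite setTI.
Qed.

Lemma independent_generated (J1 J2 : pred I) A B : (forall i, J1 i -> ~~ J2 i) ->
  generated_by J1 A -> generated_by J2 B -> P (A `&` B) = P A * P B.
Proof.
move=> J12 JA JB.
have mB := measurable_generated JB.
apply: (@extend_independence (cylinders J1)) => //; last exact: generated_cylinders.
  by move=> C; exact: measurable_cylinders.
move=> C J1C; rewrite setIC muleC.
apply: (@extend_independence (cylinders J2)) => //; last exact: generated_cylinders.
- by move=> D; exact: measurable_cylinders.
- exact: measurable_cylinders J1C.
by move=> D J2D; rewrite setIC muleC (independent_cylinders J12).
Qed.

End IndependentFamilies.

(** * The jump chain *)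

Section IndependentIntegral.
Context {R : realType} {d d1 d2 : measure_display} {Omega : measurableType d}
  {T1 : measurableType d1} {T2 : measurableType d2} (P : probability Omega R).
Variables (X : {mfun Omega >-> T1}) (Y : {mfun Omega >-> T2}).
Hypothesis XY : forall A B, measurable A -> measurable B ->
  (P (X @^-1` A `&` Y @^-1` B) = P (X @^-1` A) * P (Y @^-1` B))%E.
Local Open Scope ereal_scope.

Lemma integral_independent (phi : T1 * T2 -> \bar R) :
  measurable_fun setT phi -> (forall z, 0 <= phi z) ->
  \int[P]_o phi (X o, Y o) = \int[P]_o \int[P]_o' phi (X o, Y o').
Proof.
move=> mphi phi0.
have mXY : measurable_fun setT (fun o => (X o, Y o)).
  by apply: measurable_fun_pair; exact: measurable_funP.
have -> : \int[P]_o phi (X o, Y o) =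
    \int[measure_function_pushforward__canonical__measure_function_Measure P mXY]_z phi z.
  by rewrite (ge0_integral_pushforward mXY).
rewrite (@eq_measure_integral _ _ _ _ (distribution P X \x distribution P Y)); last first.
  move=> A mA _; apply/esym; exact: product_measure_unique.
rewrite fubini_tonelli1// (@ge0_integral_pushforward _ _ _ _ _ X)//; last 2 first.
- exact: measurable_fun_fubini_tonelli_F.
- by move=> x _; exact: integral_ge0.
apply: eq_integral => o _ /=; rewrite /fubini_F.
rewrite (@ge0_integral_pushforward _ _ _ _ _ Y)//.
by apply: measurable_fun_pair2.
Qed.

End IndependentIntegral.

Section FiniteMixture.
Context {R : realType} {d : measure_display} {T : measurableType d} {K : finType}.
Variables (c : K -> {nonneg R}) (m : K -> {measure set T -> \bar R}).
Local Open Scope ereal_scope.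

(** [msum] is indexed by natural numbers, hence the enumeration of K. *)
Let component i : {measure set T -> \bar R} :=
  if insub i is Some o then mscale (c (enum_val (o : 'I_#|K|))) (m (enum_val o))
  else mzero.

Definition mixture : {measure set T -> \bar R} := msum component #|K|.

Lemma integral_mixture f : (forall z, 0 <= f z) -> measurable_fun setT f ->
  \int[mixture]_z f z = \sum_(k : K) (c k)%:num%:E * \int[m k]_z f z.
Proof.
move=> f0 mf; rewrite ge0_integral_measure_sum//.
rewrite [RHS](reindex _ (onW_bij _ (enum_val_bij K)))/=.
apply: eq_bigr => o _; rewrite /component valK.
by rewrite ge0_integral_mscale.
Qed.

End FiniteMixture.

Section ChainKernel.
Context {R : realType} {J : finType} (c : job_classes R J) (n : nat) (p : J -> R).
Hypotheses (p_ge0 : forall j, 0 <= p j) (p_sum : \sum_j p j = 1)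
  (d_le_n : forall j, (jc_d c j <= n)%N).
Local Open Scope ereal_scope.

Definition centered_step j (s : {ffun 'I_(jc_d c j) -> 'I_n})
    (x : (jc_d c j).-tuple R) (w : n.-tuple R) : n.-tuple R :=
  centering (jump (jc_k c j) s x w).

Lemma measurable_centered_step (d : measure_display) (T : measurableType d) j s
    (x : T -> (jc_d c j).-tuple R) (w : T -> n.-tuple R) :
  measurable_fun setT x -> measurable_fun setT w ->
  measurable_fun setT (fun t => centered_step s (x t) (w t)).
Proof.
move=> mx mw; apply: measurable_centering; apply: measurable_jump => //.
  exact: jc_k_gt0.
exact: jc_k_le_d.
Qed.

Let measurable_step j s w :
  measurable_fun setT (fun x : (jc_d c j).-tuple R => centered_step s x w).
Proof. exact: measurable_centered_step. Qed.

Let step_law j (s : {ffun 'I_(jc_d c j) -> 'I_n}) (w : n.-tuple R) :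
    {measure set (n.-tuple R) -> \bar R} :=
  measure_function_pushforward__canonical__measure_function_Measure
    (jc_F c j) (measurable_step s w).

Let sel_weight j (s : {ffun 'I_(jc_d c j) -> 'I_n}) : {nonneg R} :=
  ((injectiveb s)%:R / (n ^_ jc_d c j)%:R)%:nng%R.

Definition chain_kernel (w : n.-tuple R) : {measure set (n.-tuple R) -> \bar R} :=
  mixture (fun j => NngNum (p_ge0 j)) (fun j => mixture (@sel_weight j)
    (fun s => step_law s w)).

Lemma integral_chain_kernel w f : (forall z, 0 <= f z) -> measurable_fun setT f ->
  \int[chain_kernel w]_z f z =
  \sum_j (p j)%:E * \sum_(s : {ffun 'I_(jc_d c j) -> 'I_n})
    ((injectiveb s)%:R / (n ^_ jc_d c j)%:R)%:E *
      \int[jc_F c j]_x f (centered_step s x w).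
Proof.
move=> f0 mf; rewrite integral_mixture//; apply: eq_bigr => j _; congr (_ * _).
rewrite integral_mixture//; apply: eq_bigr => s _; congr (_ * _).
exact: (@ge0_integral_pushforward _ _ _ _ _ _ (measurable_step s w) (jc_F c j)
  setT f measurableT mf (fun z _ => f0 z)).
Qed.

Let chain_kernelE w A : measurable A -> chain_kernel w A =
  \sum_j (p j)%:E * \sum_(s : {ffun 'I_(jc_d c j) -> 'I_n})
    ((injectiveb s)%:R / (n ^_ jc_d c j)%:R)%:E *
      \int[jc_F c j]_x (\1_A (centered_step s x w))%:E.
Proof.
move=> mA; transitivity (\int[chain_kernel w]_z (\1_A z)%:E).
  by rewrite integral_indic// setIT.
rewrite integral_chain_kernel//.
by apply/measurable_EFinP; exact: measurable_indic.
Qed.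

Let measurable_chain_kernel A : measurable A -> measurable_fun setT (chain_kernel ^~ A).
Proof.
move=> mA; under eq_fun do rewrite chain_kernelE//.
apply: emeasurable_sum => j; apply: measurable_funeM.
apply: emeasurable_sum => s; apply: measurable_funeM.
apply: (@measurable_fun_fubini_tonelli_F _ _ _ _ _ (jc_F c j)
  (fun wx => (\1_A (centered_step s wx.2 wx.1))%:E)) => //.
apply/measurable_EFinP; apply: measurableT_comp; first exact: measurable_indic.
exact: measurable_centered_step.
Qed.

HB.instance Definition _ := isKernel.Build _ _ _ _ R chain_kernel measurable_chain_kernel.

Lemma sum_sel_weight j : (\sum_(s : {ffun 'I_(jc_d c j) -> 'I_n})
  (injectiveb s)%:R / (n ^_ jc_d c j)%:R = 1 :> R)%R.
Proof.
rewrite -mulr_suml -natr_sum -big_mkcond/= sum1_card.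
have := card_inj_ffuns 'I_(jc_d c j) 'I_n; rewrite !card_ord cardsE => ->.
by rewrite divff// pnatr_eq0 -lt0n ffact_gt0 d_le_n.
Qed.

Let chain_kernel_prob w : chain_kernel w setT = 1.
Proof.
rewrite chain_kernelE//.
rewrite (eq_bigr (fun j => (p j)%:E)) ?sumEFin ?p_sum// => j _.
rewrite -[RHS]mule1; congr (_ * _).
rewrite (eq_bigr (fun s : {ffun 'I_(jc_d c j) -> 'I_n} =>
  ((injectiveb s)%:R / (n ^_ jc_d c j)%:R)%:E)).
  by rewrite sumEFin sum_sel_weight.
move=> s _; rewrite -[RHS]mule1; congr (_ * _).
rewrite (eq_integral (cst 1)); last by move=> x _; rewrite indicT.
by rewrite integral_cst// mul1e; exact: probability_setT.
Qed.

HB.instance Definition _ :=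
  Kernel_isProbability.Build _ _ _ _ R chain_kernel chain_kernel_prob.

Definition transition : R.-pker (n.-tuple R) ~> (n.-tuple R) := chain_kernel.

Lemma average_transition w f : (forall z, 0 <= f z) -> measurable_fun setT f ->
  average transition f w =
  \sum_j (p j)%:E * \sum_(s : {ffun 'I_(jc_d c j) -> 'I_n})
    ((injectiveb s)%:R / (n ^_ jc_d c j)%:R)%:E *
      \int[jc_F c j]_x f (centered_step s x w).
Proof. exact: integral_chain_kernel. Qed.

End ChainKernel.

Section DrivenChain.
Context {R : realType} {J : finType} {c : job_classes R J} {n : nat} {rate : R}
  {p : J -> R} {d : measure_display} {Omega : measurableType d}
  {P : probability Omega R} (D : driving c n rate p P).
Hypotheses (p_ge0 : forall j, 0 <= p j) (p_sum : \sum_j p j = 1)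
  (d_le_n : forall j, (jc_d c j <= n)%N).
Local Open Scope ereal_scope.

Definition driving_index : eqType := ((nat + nat) + (nat * J + nat * J))%type.

Definition driving_events (i : driving_index) : set (set Omega) :=
  match i with
  | inl (inl m) => preimage_set_system setT (gap D m) measurable
  | inl (inr m) => discrete_events (cls D m)
  | inr (inl (m, j)) => discrete_events (sel D m j)
  | inr (inr (m, j)) => preimage_set_system setT (xi D m j) measurable
  end.

Let Q := transition p_ge0 p_sum d_le_n.

Lemma measurable_discrete_preimage (d' : measure_display) (Omega' : measurableType d')
    (K : finType) (Z : Omega' -> K) (B : set K) :
  (forall k, measurable (Z @^-1` [set k])) -> measurable (Z @^-1` B).
Proof.
move=> mZ; rewrite (_ : Z @^-1` B = \bigcup_(k in B) Z @^-1` [set k]).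
  by apply: fin_bigcup_measurable => //; exact: finite_finset.
apply/seteqP; split; first by move=> o /= Bo; exists (Z o).
by move=> o [k Bk /= zk]; rewrite zk.
Qed.

Lemma measurable_discrete_choice (d' d'' : measure_display)
    (Omega' : measurableType d') (U : measurableType d'')
    (K : finType) (Z : Omega' -> K) (F : K -> Omega' -> U) :
  (forall k, measurable (Z @^-1` [set k])) -> (forall k, measurable_fun setT (F k)) ->
  measurable_fun setT (fun o => F (Z o) o).
Proof.
move=> mZ mF _ B mB; rewrite setTI.
rewrite (_ : _ @^-1` B = \bigcup_(k in [set: K]) (Z @^-1` [set k] `&` F k @^-1` B)).
  apply: fin_bigcup_measurable => // k _; apply: measurableI => //.
  by rewrite -[X in measurable X]setTI; exact: mF.
apply/seteqP; split; first by move=> o /= Bo; exists (Z o).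
by move=> o [k _ [/= zk]]; rewrite zk.
Qed.

Lemma measurable_driving_events i A : driving_events i A -> measurable A.
Proof.
case: i => [[m|m]|[[m j]|[m j]]] /= [B].
- by move=> mB <-; exact: gap_measurable.
- by move=> _ <-; apply: measurable_discrete_preimage; exact: cls_measurable.
- by move=> _ <-; apply: measurable_discrete_preimage; exact: sel_measurable.
- by move=> mB <-; exact: xi_measurable.
Qed.

Lemma driving_events_setI i : setI_closed (driving_events i).
Proof.
case: i => [[m|m]|[[m j]|[m j]]] /= _ _ [A mA <-] [B mB <-].
- by exists (A `&` B); [exact: measurableI|rewrite !setTI preimage_setI].
- by exists (A `&` B); rewrite ?preimage_setI.
- by exists (A `&` B); rewrite ?preimage_setI.
- by exists (A `&` B); [exact: measurableI|rewrite !setTI preimage_setI].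
Qed.

Lemma driving_events_independent : mutually_independent P driving_events.
Proof. exact: driving_independent. Qed.

(* Omega with the sigma-algebra of the driving variables selected by pr. *)
Definition subOmega (pr : pred driving_index) :=
  g_sigma_algebraType [set A | exists2 i, pr i & driving_events i A].

Lemma subOmega_event (pr : pred driving_index) i (A : set (subOmega pr)) :
  pr i -> driving_events i A -> measurable A.
Proof. by move=> pri GA; apply: sub_sigma_algebra; exists i. Qed.

Lemma subOmega_measurable (pr : pred driving_index) (d' : measure_display) (U : measurableType d')
    (X : Omega -> U) :
  measurable_fun setT (X : subOmega pr -> U) -> measurable_fun setT X.
Proof.
move=> mX _ B mB; have := mX measurableT B mB; rewrite !setTI.
exact: (measurable_generated measurable_driving_events).
Qed.

Lemma subOmega_gap (pr : pred driving_index) m : pr (inl (inl m)) ->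
  measurable_fun setT (gap D m : subOmega pr -> R).
Proof.
by move=> prm _ B mB; apply: (subOmega_event prm); exists B.
Qed.

Lemma subOmega_cls (pr : pred driving_index) m j : pr (inl (inr m)) ->
  measurable (cls D m @^-1` [set j] : set (subOmega pr)).
Proof. by move=> prm; apply: (subOmega_event prm); exists [set j]. Qed.

Lemma subOmega_sel (pr : pred driving_index) m j s : pr (inr (inl (m, j))) ->
  measurable (sel D m j @^-1` [set s] : set (subOmega pr)).
Proof. by move=> prm; apply: (subOmega_event prm); exists [set s]. Qed.

Lemma subOmega_xi (pr : pred driving_index) m j : pr (inr (inr (m, j))) ->
  measurable_fun setT (xi D m j : subOmega pr -> (jc_d c j).-tuple R).
Proof. by move=> prm _ B mB; apply: (subOmega_event prm); exists B. Qed.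

Lemma integral_subOmega_independent (pr1 pr2 : pred driving_index)
    (d1 d2 : measure_display) (T1 : measurableType d1) (T2 : measurableType d2)
    (X : Omega -> T1) (Y : Omega -> T2) (phi : T1 * T2 -> \bar R) :
  (forall i, pr1 i -> ~~ pr2 i) ->
  measurable_fun setT (X : subOmega pr1 -> T1) ->
  measurable_fun setT (Y : subOmega pr2 -> T2) ->
  measurable_fun setT phi -> (forall z, 0 <= phi z) ->
  \int[P]_o phi (X o, Y o) = \int[P]_o \int[P]_o' phi (X o, Y o').
Proof.
move=> pr12 mX mY mphi phi0.
pose X' : {mfun Omega >-> T1} :=
  HB.pack X (isMeasurableFun.Build _ _ _ _ X (subOmega_measurable mX)).
pose Y' : {mfun Omega >-> T2} :=
  HB.pack Y (isMeasurableFun.Build _ _ _ _ Y (subOmega_measurable mY)).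
apply: (@integral_independent _ _ _ _ _ _ _ P X' Y') => // A B mA mB.
apply: (independent_generated measurable_driving_events driving_events_setI
  driving_events_independent pr12).
- by have := mX measurableT A mA; rewrite setTI.
- by have := mY measurableT B mB; rewrite setTI.
Qed.

(* Centering removes the drift between arrivals, so the centered locations just
   after the arrivals do not depend on the arrival times. *)
Fixpoint chain (w : n.-tuple R) (m : nat) (o : Omega) : n.-tuple R :=
  if m is m'.+1 then
    centered_step (sel D m' (cls D m' o) o) (xi D m' (cls D m' o) o) (chain w m' o)
  else centering w.

Lemma measurable_chain (pr : pred driving_index) w m :
  (forall i, (i < m)%N -> pr (inl (inr i)) /\
     forall j, pr (inr (inl (i, j))) /\ pr (inr (inr (i, j)))) ->
  measurable_fun setT (chain w m : subOmega pr -> n.-tuple R).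
Proof.
elim: m => [|m IH] prm /=; first exact: measurable_cst.
have [prc prsx] := prm m (leqnn _).
have mch : measurable_fun setT (chain w m : subOmega pr -> n.-tuple R).
  by apply: IH => i im; apply: prm; exact: ltnW.
apply: (@measurable_discrete_choice _ _ (subOmega pr) _ _ (cls D m)
  (fun j o => centered_step (sel D m j o) (xi D m j o) (chain w m o))) => j.
  exact: subOmega_cls.
have [prs prx] := prsx j.
apply: (@measurable_discrete_choice _ _ (subOmega pr) _ _ (sel D m j)
  (fun s o => centered_step s (xi D m j o) (chain w m o))) => s.
  exact: subOmega_sel.
apply: measurable_centered_step => //; exact: subOmega_xi.
Qed.

Definition arrival_index (i : driving_index) : nat :=
  match i with
  | inl (inl m) => m
  | inl (inr m) => m
  | inr (inl (m, _)) => m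
  | inr (inr (m, _)) => m
  end.

Definition past m : pred driving_index := fun i => (arrival_index i < m)%N.

Lemma measurable_chain_past w m :
  measurable_fun setT (chain w m : subOmega (past m) -> n.-tuple R).
Proof. by apply: measurable_chain => i im; split => // j. Qed.

(** The driving prescribes the law on injective selections only; these already have total mass 1, so
    every other selection has probability 0. *)
Lemma prob_selection m j s :
  P (sel D m j @^-1` [set s]) = ((injectiveb s)%:R / (n ^_ jc_d c j)%:R)%:E.
Proof.
have [s_inj|s_ninj] := boolP (injectiveb s).
  by rewrite sel_law; [rewrite mul1r|exact/injectiveP].
rewrite mul0r.
have sum1 : \sum_(f : {ffun 'I_(jc_d c j) -> 'I_n}) P (sel D m j @^-1` [set f]) = 1.
  transitivity (\int[P]_o \sum_(f : {ffun 'I_(jc_d c j) -> 'I_n})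
      (\1_(sel D m j @^-1` [set f]) o)%:E).
    rewrite ge0_integral_sum//; last first.
      by move=> f; apply/measurable_EFinP; apply: measurable_indic; exact: sel_measurable.
    by apply: eq_bigr => f _; rewrite integral_indic ?setIT//; exact: sel_measurable.
  rewrite (eq_integral (cst 1)).
    by rewrite integral_cst// mul1e; exact: probability_setT.
  move=> o _; rewrite (bigD1 (sel D m j o))//= big1 ?addr0.
    by rewrite indicE mem_set.
  move=> f fo; rewrite indicE memNset//= => e.
  by rewrite -e eqxx in fo.
have inj1 : \sum_(f : {ffun 'I_(jc_d c j) -> 'I_n} | injectiveb f)
    P (sel D m j @^-1` [set f]) = 1.
  rewrite -(sum_sel_weight d_le_n j) -sumEFin big_mkcond; apply: eq_bigr => f _.
  case: ifPn => f_inj; last by rewrite mul0r.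
  by rewrite sel_law; [rewrite mul1r|exact/injectiveP].
move: sum1; rewrite (bigID (fun f : {ffun 'I_(jc_d c j) -> 'I_n} => injectiveb f))/= inj1 => sum1.
have ninj0 : \sum_(f : {ffun 'I_(jc_d c j) -> 'I_n} | ~~ injectiveb f)
    P (sel D m j @^-1` [set f]) <= 0.
  by rewrite -(@leeD2lE _ 1)// sum1 adde0.
apply/eqP; rewrite eq_le measure_ge0 andbT; apply: le_trans ninj0.
by rewrite (bigD1 s)//= leeDl// sume_ge0.
Qed.

Definition arrival_type m j (s : {ffun 'I_(jc_d c j) -> 'I_n}) (Gam : set R) : set Omega :=
  gap D m @^-1` Gam `&` cls D m @^-1` [set j] `&` sel D m j @^-1` [set s].

Lemma prob_arrival_type m j (s : {ffun 'I_(jc_d c j) -> 'I_n}) Gam : measurable Gam ->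
  P (arrival_type m s Gam) = P (gap D m @^-1` Gam) *
    ((p j)%:E * ((injectiveb s)%:R / (n ^_ jc_d c j)%:R)%:E).
Proof.
move=> mGam; rewrite -(prob_selection m s) -(cls_law D m j).
pose A (i : driving_index) : set Omega := match i with
  | inl (inl _) => gap D m @^-1` Gam
  | inl (inr _) => cls D m @^-1` [set j]
  | inr _ => sel D m j @^-1` [set s] end.
have := @driving_events_independent
  [:: inl (inl m); inl (inr m); inr (inl (m, j))] A.
rewrite !big_cons big_nil mule1 /A => <- //.
- congr (P _); rewrite /arrival_type; apply/seteqP; split.
    by move=> o [] [] o1 o2 o3 i /=; rewrite !inE => /or3P[] /eqP ->.
  move=> o oA; split; [split|].
  + by apply: (oA (inl (inl m))); rewrite /= !inE eqxx.
  + by apply: (oA (inl (inr m))); rewrite /= !inE eqxx.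
  + by apply: (oA (inr (inl (m, j)))); rewrite /= !inE eqxx.
- move=> i; rewrite !inE => /or3P[] /eqP -> /=.
  + by exists Gam => //; rewrite setTI.
  + by exists [set j].
  + by exists [set s].
Qed.

(** The Markov property with a weight h determined by the past and with the gap of index m
    restricted to [Gam]. The centered chain does not depend on that gap, whose probability therefore
    factors out. *)
Lemma chain_step (h : Omega -> R) m w Gam (f : n.-tuple R -> \bar R) :
  measurable Gam -> measurable_fun setT (h : subOmega (past m) -> R) ->
  (forall o, (0 <= h o)%R) -> (forall z, 0 <= f z) -> measurable_fun setT f ->
  \int[P]_o ((h o * \1_(gap D m @^-1` Gam) o)%:E * f (chain w m.+1 o)) =
  P (gap D m @^-1` Gam) *
    \int[P]_o ((h o)%:E * average Q f (chain w m o)).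
Proof.
move=> mGam mh h0 f0 mf.
pose z j (s : {ffun 'I_(jc_d c j) -> 'I_n}) (o : Omega) : R := \1_(arrival_type m s Gam) o.
have z0 j s o : (0 <= z j s o)%R by rewrite /z.
(* The absolute values make phi nonnegative on its whole domain, as Tonelli requires; the weights
   inserted later are nonnegative anyway. *)
pose phi j (s : {ffun 'I_(jc_d c j) -> 'I_n})
    (v : (R * n.-tuple R) * (R * (jc_d c j).-tuple R)) : \bar R :=
  (`|v.1.1| * `|v.2.1|)%:E * f (centered_step s v.2.2 v.1.2).
have phi0 j s v : 0 <= @phi j s v by rewrite mule_ge0// lee_fin mulr_ge0.
have mphi j s : measurable_fun setT (@phi j s).
  apply: emeasurable_funM.
    apply/measurable_EFinP; apply: measurable_funM;
      (apply: measurableT_comp => //; apply: measurableT_comp => //).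
  apply: measurableT_comp => //; apply: measurable_centered_step.
    exact: measurableT_comp.
  exact: measurableT_comp.
pose now j : pred driving_index := fun i => [|| i == inl (inl m), i == inl (inr m),
   i == inr (inl (m, j)) | i == inr (inr (m, j))].
pose nowd j : pred driving_index := fun i => [|| i == inl (inl m), i == inl (inr m) |
   i == inr (inl (m, j))].
pose nowx j : pred driving_index := fun i => i == inr (inr (m, j)).
have mz (pr : pred driving_index) j s : pr (inl (inl m)) -> pr (inl (inr m)) ->
    pr (inr (inl (m, j))) -> measurable_fun setT (z j s : subOmega pr -> R).
  move=> pr1 pr2 pr3; apply: (@measurable_indic _ (subOmega pr)).
  apply: measurableI; last exact: subOmega_sel.
  apply: measurableI; last exact: subOmega_cls.
  by rewrite -[X in measurable X]setTI; exact: subOmega_gap.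
have mstep j s (y : n.-tuple R) : measurable_fun setT
    (fun x : (jc_d c j).-tuple R => f (centered_step s x y)).
  by apply: measurableT_comp => //; exact: measurable_centered_step.
have stepE j s y : \int[P]_o phi j s ((1%R, y), (z j s o, xi D m j o)) =
    P (arrival_type m s Gam) * \int[jc_F c j]_x f (centered_step s x y).
  transitivity (\int[P]_o ((z j s o)%:E * f (centered_step s (xi D m j o) y))).
    by apply: eq_integral => o _; rewrite /phi/= normr1 mul1r ger0_norm.
  have := @integral_subOmega_independent (nowd j) (nowx j) _ _ _ _
    (z j s) (xi D m j) (fun v => `|v.1|%:E * f (centered_step s v.2 y)).
  rewrite /= => indep.
  under eq_integral => o _ do rewrite -[z j s o]ger0_norm//.
  rewrite indep//; last 5 first.
  - by move=> i /or3P[] /eqP ->; rewrite /nowx.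
  - by apply: mz; rewrite /nowd !eqxx ?orbT.
  - by apply: subOmega_xi; rewrite /nowx eqxx.
  - apply: emeasurable_funM; last by apply: (measurableT_comp (mstep j s y)).
    by apply/measurable_EFinP; apply: measurableT_comp.
  - by move=> v; rewrite mule_ge0// lee_fin.
  have mZ : measurable (arrival_type m s Gam).
    apply: measurableI; last exact: sel_measurable.
    apply: measurableI; last exact: cls_measurable.
    by rewrite -[X in measurable X]setTI; exact: gap_measurable.
  pose I := \int[jc_F c j]_x f (centered_step s x y).
  have I0 : 0 <= I by exact: integral_ge0.
  transitivity (\int[P]_o ((z j s o)%:E * I)).
    apply: eq_integral => o _; rewrite ger0_norm//.
    rewrite ge0_integralZl//; last 2 first.
    - by apply: (measurableT_comp (mstep j s y)); exact: xi_measurable.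
    - by rewrite lee_fin.
    congr (_ * _).
    have <- := @ge0_integral_pushforward _ _ _ _ _ _ (@xi_measurable _ _ _ _ _ _ _ _ _ D m j) P setT
      (fun x => f (centered_step s x y)) measurableT (mstep j s y) (fun x _ => f0 _).
    apply: eq_measure_integral; first exact: xi_measurable.
    by move=> ? A mA _; exact: xi_law.
  rewrite ge0_integralZr//; last 2 first.
  - by apply/measurable_EFinP; exact: measurable_indic.
  - by move=> o _; rewrite lee_fin.
  by rewrite integral_indic// setIT.
have intE j s : \int[P]_o phi j s ((h o, chain w m o), (z j s o, xi D m j o)) =
    P (arrival_type m s Gam) * \int[P]_o ((h o)%:E *
      \int[jc_F c j]_x f (centered_step s x (chain w m o))).
  have disj i : past m i -> ~~ now j i.
    by move=> im; apply/negP => /or4P[] /eqP e; move: im; rewrite e /past/= ltnn.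
  have mX : measurable_fun setT ((fun o => (h o, chain w m o)) : subOmega (past m) -> _).
    by apply: measurable_fun_pair => //; exact: measurable_chain_past.
  have mY : measurable_fun setT ((fun o => (z j s o, xi D m j o)) : subOmega (now j) -> _).
    apply: measurable_fun_pair; first by apply: mz; rewrite /now !eqxx ?orbT.
    by apply: subOmega_xi; rewrite /now eqxx !orbT.
  rewrite (integral_subOmega_independent disj mX mY (mphi j s) (phi0 j s)).
  transitivity (\int[P]_o ((h o)%:E * (P (arrival_type m s Gam) *
      \int[jc_F c j]_x f (centered_step s x (chain w m o))))).
    apply: eq_integral => o _; rewrite -stepE -ge0_integralZl//; last 2 first.
    - apply: (measurableT_comp (mphi j s)); apply: measurable_fun_pair => //.
      apply: measurable_fun_pair; last exact: xi_measurable.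
      apply: (subOmega_measurable (pr := xpredT)); exact: mz.
    - by rewrite lee_fin.
    apply: eq_integral => o' _; rewrite /phi/= normr1 mul1r ger0_norm//.
    by rewrite [`|z j s o'|%R]ger0_norm// EFinM muleA.
  under eq_integral do rewrite muleCA.
  rewrite ge0_integralZl//.
  - apply: emeasurable_funM.
      by apply/measurable_EFinP; exact: subOmega_measurable mh.
    apply: (measurableT_comp (f := fun y => \int[jc_F c j]_x f (centered_step s x y))).
      apply: (@measurable_fun_fubini_tonelli_F _ _ _ _ _ (jc_F c j)
        (fun yx => f (centered_step s yx.2 yx.1))) => //.
      by apply: measurableT_comp => //; exact: measurable_centered_step.
    exact: (subOmega_measurable (pr := past m) (measurable_chain_past w (m := m))).
  - by move=> o _; rewrite mule_ge0 ?lee_fin// integral_ge0.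
have mchain : measurable_fun setT (chain w m : Omega -> n.-tuple R).
  exact: (subOmega_measurable (pr := past m) (measurable_chain_past w (m := m))).
have mphi_o j s : measurable_fun setT
    (fun o => phi j s ((h o, chain w m o), (z j s o, xi D m j o))).
  apply: (measurableT_comp (mphi j s)); apply: measurable_fun_pair.
    by apply: measurable_fun_pair => //; exact: subOmega_measurable mh.
  apply: measurable_fun_pair; last exact: xi_measurable.
  by apply: (subOmega_measurable (pr := xpredT)); exact: mz.
(* Only the term of the realized class and selection survives, so a random class and selection
   become a sum over fixed ones. *)
transitivity (\int[P]_o \sum_j \sum_(s : {ffun 'I_(jc_d c j) -> 'I_n})
    phi j s ((h o, chain w m o), (z j s o, xi D m j o))).
  apply: eq_integral => o _; set j0 := cls D m o; set s0 := sel D m j0 o.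
  rewrite (bigD1 j0)//= [X in _ + X]big1 ?addr0; last first.
    move=> j jj0; rewrite big1// => s _; rewrite /phi /z /= indicE memNset.
      by rewrite normr0 mulr0 mul0e.
    by move=> [] [] _ /= e _; rewrite -e eqxx in jj0.
  rewrite (bigD1 s0)//= [X in _ + X]big1 ?addr0; last first.
    move=> s ss0; rewrite /phi /z /= indicE memNset.
      by rewrite normr0 mulr0 mul0e.
    by move=> [] _ /= e; rewrite -e eqxx in ss0.
  rewrite /phi/= ger0_norm// ger0_norm//; congr ((_ * _)%:E * _).
  rewrite /z !indicE; congr (nat_of_bool _)%:R.
  apply/idP/idP => /set_mem oG; apply/mem_set.
    by split.
  by case: oG => -[].
rewrite ge0_integral_sum//; last 2 first.
- by move=> j; apply: emeasurable_sum => s; exact: mphi_o.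
- by move=> j o _; apply: sume_ge0 => s _.
have mint j s : measurable_fun setT (fun y : n.-tuple R =>
    \int[jc_F c j]_x f (centered_step s x y)).
  apply: (@measurable_fun_fubini_tonelli_F _ _ _ _ _ (jc_F c j)
    (fun yx => f (centered_step s yx.2 yx.1))) => //.
  by apply: measurableT_comp => //; exact: measurable_centered_step.
have mhE : measurable_fun setT (fun o => (h o)%:E).
  by apply/measurable_EFinP; exact: subOmega_measurable mh.
pose wt j (s : {ffun 'I_(jc_d c j) -> 'I_n}) : R :=
  ((injectiveb s)%:R / (n ^_ jc_d c j)%:R)%R.
have wt0 j s : (0 <= wt j s)%R by rewrite /wt divr_ge0.
pose term j s o := (h o)%:E * \int[jc_F c j]_x f (centered_step s x (chain w m o)).
have term0 j s o : 0 <= term j s o by rewrite mule_ge0 ?lee_fin// integral_ge0.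
have mterm j s : measurable_fun setT (term j s).
  by apply: emeasurable_funM => //; apply: (measurableT_comp (mint j s)).
transitivity (P (gap D m @^-1` Gam) * \int[P]_o \sum_j (p j)%:E *
    \sum_(s : {ffun 'I_(jc_d c j) -> 'I_n}) (wt j s)%:E * term j s o); last first.
  congr (_ * _); apply: eq_integral => o _; rewrite /Q average_transition//.
  rewrite ge0_sume_distrr; last first.
    move=> j _; rewrite mule_ge0 ?lee_fin//; apply: sume_ge0 => s _.
    by rewrite mule_ge0 ?lee_fin ?wt0// integral_ge0.
  apply: eq_bigr => j _; rewrite muleCA; congr (_ * _).
  rewrite ge0_sume_distrr; last first.
    by move=> s _; rewrite mule_ge0 ?lee_fin ?wt0// integral_ge0.
  by apply: eq_bigr => s _; rewrite muleCA.
have mS j : measurable_fun setT (fun o =>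
    \sum_(s : {ffun 'I_(jc_d c j) -> 'I_n}) (wt j s)%:E * term j s o).
  by apply: emeasurable_sum => s; apply: measurable_funeM.
have S0 j o : 0 <= \sum_(s : {ffun 'I_(jc_d c j) -> 'I_n}) (wt j s)%:E * term j s o.
  by apply: sume_ge0 => s _; rewrite mule_ge0 ?lee_fin.
rewrite ge0_integral_sum//; last 2 first.
- by move=> j; apply: measurable_funeM.
- by move=> j o _; rewrite mule_ge0 ?lee_fin.
rewrite ge0_sume_distrr; last first.
  by move=> j _; rewrite integral_ge0// => o _; rewrite mule_ge0 ?lee_fin.
apply: eq_bigr => j _.
rewrite ge0_integralZl ?lee_fin// ge0_integral_sum//.
rewrite ge0_integral_sum//; last 2 first.
- by move=> s; apply: measurable_funeM.
- by move=> s o _; rewrite mule_ge0 ?lee_fin.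
rewrite ge0_sume_distrr; last first.
  by move=> s _; rewrite integral_ge0// => o _; rewrite mule_ge0 ?lee_fin.
rewrite ge0_sume_distrr; last first.
  move=> s _; rewrite mule_ge0 ?lee_fin// integral_ge0// => o _.
  by rewrite mule_ge0 ?lee_fin.
apply: eq_bigr => s _; rewrite intE prob_arrival_type//.
by rewrite ge0_integralZl ?lee_fin ?wt0// /wt !muleA.
Qed.

End DrivenChain.

Section ChainLaws.
Context {R : realType} {J : finType} {c : job_classes R J} {n : nat} {rate : R}
  {p : J -> R} {d : measure_display} {Omega : measurableType d}
  {P : probability Omega R} (D : driving c n rate p P).
Hypotheses (p_ge0 : forall j, 0 <= p j) (p_sum : \sum_j p j = 1)
  (d_le_n : forall j, (jc_d c j <= n)%N).
Local Open Scope ereal_scope.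

Let Q := transition p_ge0 p_sum d_le_n.

Lemma prob_gap m Gam : measurable Gam ->
  P (gap D m @^-1` Gam) = P (gap D 0 @^-1` Gam).
Proof. by move=> mGam; rewrite !gap_law. Qed.

Let gap_indic m Gam (o : Omega) : R := \1_(gap D m @^-1` Gam) o.

Let measurable_gap_indic (pr : pred driving_index) m Gam : pr (inl (inl m)) ->
  measurable Gam -> measurable_fun setT (gap_indic m Gam : subOmega D pr -> R).
Proof.
move=> prm mGam; apply: (@measurable_indic _ (subOmega D pr)).
by rewrite -[X in measurable X]setTI; exact: subOmega_gap.
Qed.

Lemma past_le m m' : (m <= m')%N -> forall i, past (J := J) m i -> past m' i.
Proof. by move=> mm' i; rewrite /past => /leq_trans; apply. Qed.

Lemma subOmega_le (pr1 pr2 : pred driving_index) (d' : measure_display)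
    (U : measurableType d') (X : Omega -> U) :
  (forall i, pr1 i -> pr2 i) -> measurable_fun setT (X : subOmega D pr1 -> U) ->
  measurable_fun setT (X : subOmega D pr2 -> U).
Proof.
move=> pr12 mX _ B mB; have := mX measurableT B mB; rewrite !setTI.
apply: smallest_sub; first exact: smallest_sigma_algebra.
by move=> A [i pri GA]; apply: sub_sigma_algebra; exists i => //; exact: pr12.
Qed.

Lemma chain_gaps m w Gam f : measurable Gam -> (forall z, 0 <= f z) ->
  measurable_fun setT f ->
  \int[P]_o ((\prod_(i < m) gap_indic i Gam o)%:E * f (chain D w m o)) =
  P (gap D 0 @^-1` Gam) ^+ m * iter m (average Q) f (centering w).
Proof.
move=> mGam; elim: m f => [|m IH] f f0 mf.
  under eq_integral do rewrite big_ord0 mul1e /=.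
  rewrite integral_cst// [X in _ * X](_ : _ = 1) ?mule1 ?expe0 ?mul1e//.
  exact: probability_setT.
under eq_integral do rewrite big_ord_recr.
rewrite (@chain_step _ _ _ _ _ _ _ _ _ D p_ge0 p_sum d_le_n
  (fun o => \prod_(i < m) gap_indic i Gam o)%R)//.
- rewrite IH ?prob_gap//; last 2 first.
  + by move=> z; exact: average_ge0.
  + exact: measurable_average.
  by rewrite expeS muleA -iterSr.
- apply: (@measurable_prod _ (subOmega D (past m))) => i _.
  by apply: measurable_gap_indic => //; rewrite /past/=.
- by move=> o; apply: prodr_ge0 => i _; rewrite /gap_indic indicE.
Qed.

(** Vanishes exactly when the chain is in A after arrival m and stays there for a time in [Gam];
    [gap m] is the waiting time that follows that arrival. *)
Let failure A Gam w m (o : Omega) : R :=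
  (1 - gap_indic m Gam o * \1_A (chain D w m o))%R.

(** The general weight h lets the induction absorb the first failure factor into it. Averaging over
    the gap turns that factor into [1 - rho * \1_A]. *)
Lemma chain_survival M m w h A Gam : measurable A -> measurable Gam ->
  measurable_fun setT (h : subOmega D (past m) -> R) -> (forall o, (0 <= h o)%R) ->
  \int[P]_o (h o * \prod_(i < M) failure A Gam w (m + i) o)%:E =
  \int[P]_o ((h o)%:E *
    survival Q (fun w => 1 - fine (P (gap D 0 @^-1` Gam)) * \1_A w)%R M (chain D w m o)).
Proof.
move=> mA mGam; set rho := fine (P (gap D 0 @^-1` Gam)).
have rhoE : P (gap D 0 @^-1` Gam) = rho%:E.
  rewrite fineK// fin_num_measure// -[X in measurable X]setTI.
  exact: gap_measurable.
have rho0 : (0 <= rho)%R by rewrite fine_ge0.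
have rho1 : (rho <= 1)%R.
  rewrite -lee_fin -rhoE probability_le1// -[X in measurable X]setTI.
  exact: gap_measurable.
have rhoC : P (gap D 0 @^-1` (~` Gam)) = (1 - rho)%:E.
  rewrite preimage_setC probability_setC ?rhoE// -[X in measurable X]setTI.
  exact: gap_measurable.
set a := (fun w => 1 - rho * \1_A w)%R.
have a01 z : (0 <= a z <= 1)%R.
  rewrite /a indicE; case: (z \in A); rewrite /= ?mulr1 ?mulr0 ?subr0 ?ler01 ?lexx//.
  by rewrite subr_ge0 rho1 gerBl.
have ma : measurable_fun setT a.
  by apply: measurable_funB => //; apply: measurable_funM => //; exact: measurable_indic.
elim: M m h => [|M IH] m h mh h0.
  by apply: eq_integral => o _; rewrite big_ord0 mulr1 mule1.
pose f := survival Q a M.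
have f0 z : 0 <= f z by exact: survival_ge0.
have mf : measurable_fun setT f by exact: measurable_survival.
have mfail : measurable_fun setT (failure A Gam w m : subOmega D (past m.+1) -> R).
  apply: measurable_funB => //; apply: measurable_funM.
    by apply: measurable_gap_indic => //; rewrite /past/=.
  apply: measurableT_comp; first exact: measurable_indic.
  apply: (@subOmega_le (past m)); first exact: past_le.
  exact: (measurable_chain_past (D := D) w (m := m)).
have fail0 i o : (0 <= failure A Gam w i o)%R.
  rewrite /failure /gap_indic !indicE; case: (o \in _); case: (_ \in A);
  by rewrite /= ?mulr1 ?mulr0 ?mul0r ?subr0 ?subrr.
have mh' : measurable_fun setT
    ((fun o => h o * failure A Gam w m o)%R : subOmega D (past m.+1) -> R).
  apply: measurable_funM => //; apply: (@subOmega_le (past m)) mh; exact: past_le.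
transitivity (\int[P]_o ((h o * failure A Gam w m o)%:E * f (chain D w m.+1 o))).
  rewrite -IH//; last by move=> o; rewrite mulr_ge0.
  apply: eq_integral => o _; rewrite big_ord_recl addn0 mulrA.
  by congr (_ * _)%:E; apply: eq_bigr => i _; rewrite /= addnS addSn.
pose h2 o := (h o * \1_(~` A) (chain D w m o))%R.
have h20 o : (0 <= h2 o)%R by rewrite mulr_ge0.
have mh2 : measurable_fun setT (h2 : subOmega D (past m) -> R).
  apply: measurable_funM => //; apply: measurableT_comp.
    by apply: measurable_indic; exact: measurableC.
  exact: (measurable_chain_past (D := D) w (m := m)).
have mhO := subOmega_measurable mh.
have mh2O := subOmega_measurable mh2.
have mgi G : measurable G -> measurable_fun setT (gap_indic m G : Omega -> R).
  by move=> mG; apply: (subOmega_measurable (pr := xpredT)); exact: measurable_gap_indic.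
have mchain m' : measurable_fun setT (chain D w m' : Omega -> n.-tuple R).
  exact: (subOmega_measurable (measurable_chain_past (D := D) w (m := m'))).
have mavg : measurable_fun setT (average Q f) by exact: measurable_average.
have avg0 z : 0 <= average Q f z by exact: average_ge0.
have mfc : measurable_fun setT (fun o => f (chain D w m.+1 o)) by exact: measurableT_comp.
have mac : measurable_fun setT (fun o => average Q f (chain D w m o)).
  exact: measurableT_comp.
have gi0 G o : (0 <= gap_indic m G o)%R by rewrite /gap_indic indicE.
(* A failure means that the gap misses [Gam], or that it lies in [Gam] while the chain is outside A.
   Each part is a past weight times a gap indicator, the form that [chain_step] accepts. *)
transitivity (\int[P]_o ((h o * gap_indic m (~` Gam) o)%:E * f (chain D w m.+1 o)) +
  \int[P]_o ((h2 o * gap_indic m Gam o)%:E * f (chain D w m.+1 o))).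
  rewrite -ge0_integralD//; last 4 first.
  - by move=> o _; rewrite mule_ge0// lee_fin mulr_ge0.
  - apply: emeasurable_funM => //; apply/measurable_EFinP; apply: measurable_funM => //.
    by apply: mgi; exact: measurableC.
  - by move=> o _; rewrite mule_ge0// lee_fin mulr_ge0.
  - by apply: emeasurable_funM => //; apply/measurable_EFinP; apply: measurable_funM => //; apply: mgi.
  apply: eq_integral => o _.
  rewrite -ge0_muleDl ?lee_fin ?mulr_ge0// -EFinD; congr (_%:E * _).
  rewrite /h2 /failure /gap_indic !indicE preimage_setC !in_setC.
  by case: (o \in _); case: (_ \in A) => /=; ring.
rewrite (@chain_step _ _ _ _ _ _ _ _ _ D p_ge0 p_sum d_le_n h)//; last exact: measurableC.
rewrite (@chain_step _ _ _ _ _ _ _ _ _ D p_ge0 p_sum d_le_n h2)//.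
rewrite !prob_gap//; last exact: measurableC.
rewrite rhoC rhoE -ge0_integralZl ?lee_fin ?subr_ge0//; last 2 first.
- by apply: emeasurable_funM => //; exact/measurable_EFinP.
- by move=> o _; rewrite mule_ge0// lee_fin.
rewrite -ge0_integralZl ?lee_fin//; last 2 first.
- by apply: emeasurable_funM => //; exact/measurable_EFinP.
- by move=> o _; rewrite mule_ge0// lee_fin.
rewrite -ge0_integralD//; last 4 first.
- by move=> o _; rewrite !mule_ge0// lee_fin// subr_ge0.
- by apply: measurable_funeM; apply: emeasurable_funM => //; exact/measurable_EFinP.
- by move=> o _; rewrite !mule_ge0// lee_fin.
- by apply: measurable_funeM; apply: emeasurable_funM => //; exact/measurable_EFinP.
apply: eq_integral => o _; rewrite /survival iterS -/(survival Q a M) -/f.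
rewrite !muleA -!EFinM -ge0_muleDl ?lee_fin ?mulr_ge0 ?subr_ge0//.
rewrite -EFinD; congr (_%:E * _); rewrite /h2 /a !indicE in_setC.
by case: (_ \in A) => /=; ring.
Qed.

End ChainLaws.

Section Equivariance.
Context {R : realType}.

Lemma kth_smallest_shift k (s : seq R) a : (k.-1 < size s)%N ->
  kth_smallest k [seq y + a | y <- s] = kth_smallest k s + a.
Proof.
move=> ks; rewrite /kth_smallest sort_map (nth_map 0) ?size_sort//.
congr (nth _ (sort _ s) _ + a).
by apply/funext => x; apply/funext => y /=; exact: lerD2r.
Qed.

Lemma jump_translate n d k (s : {ffun 'I_d -> 'I_n}) (x : d.-tuple R) a
    (w : n.-tuple R) : (0 < k)%N -> (k <= d)%N ->
  jump k s x (translate a w) = translate a (jump k s x w).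
Proof.
move=> k_gt0 k_le_d; apply: eq_from_tnth => i; rewrite !tnth_mktuple.
case: pickP => [b sb|//].
have -> : kth_smallest k [seq tnth (translate a w) (s a0) + tnth x a0 | a0 <- enum 'I_d] =
    kth_smallest k [seq tnth w (s a0) + tnth x a0 | a0 <- enum 'I_d] + a.
  rewrite -kth_smallest_shift; last by rewrite size_map size_enum_ord prednK.
  rewrite -map_comp; congr (kth_smallest k _); apply: eq_map => b' /=.
  by rewrite tnth_mktuple addrAC.
by rewrite addr_maxl addr_minl addrAC.
Qed.

Lemma centering_translate n a (w : n.-tuple R) : centering (translate a w) = centering w.
Proof.
apply: eq_from_tnth => i; rewrite !tnth_centering tnth_mktuple.
suff -> : mean (translate a w) = mean w + a by rewrite opprD addrACA subrr addr0.
rewrite /mean; under eq_bigr do rewrite tnth_mktuple.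
rewrite big_split/= mulrDr; congr (_ + _).
have n0 : n%:R != 0 :> R by rewrite pnatr_eq0 -lt0n (leq_ltn_trans _ (ltn_ord i)).
by rewrite sumr_const card_ord -[a *+ n]mulr_natl mulKf.
Qed.

Lemma centeringK n (w : n.-tuple R) : centering (centering w) = centering w.
Proof. exact: centering_translate. Qed.

End Equivariance.

Section CenteredProcess.
Context {R : realType} {J : finType} {c : job_classes R J} {n : nat} {rate : R}
  {p : J -> R} {d : measure_display} {Omega : measurableType d}
  {P : probability Omega R} (D : driving c n rate p P).

Lemma centered_step_centering j (s : {ffun 'I_(jc_d c j) -> 'I_n}) x (w : n.-tuple R) :
  centered_step s x (centering w) = centered_step s x w.
Proof.
by rewrite /centered_step jump_translate ?jc_k_gt0 ?jc_k_le_d// centering_translate.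
Qed.

Lemma centering_after_arrival w m o : centering (after_arrival D w m o) = chain D w m o.
Proof.
elim: m => [//|m IH] /=; rewrite -IH centered_step_centering.
by rewrite jump_translate ?jc_k_gt0 ?jc_k_le_d// centering_translate.
Qed.

Lemma centering_chain w m o : centering (chain D w m o) = chain D w m o.
Proof. by case: m => [|m]; exact: centeringK. Qed.

Lemma centeredE w t o : centered D w t o = chain D w (arrivals D t o) o.
Proof. by rewrite /centered centering_translate centering_after_arrival. Qed.

Definition first_passage t m : set Omega :=
  [set o | t < arrival_time D m.+1 o /\
    forall i, (i < m)%N -> arrival_time D i.+1 o <= t].

Lemma first_passage_inj t m m' o : first_passage t m o -> first_passage t m' o -> m = m'.
Proof.
move=> [m1 m2] [m1' m2']; case: (ltngtP m m') => //.
  by move=> /m2'; rewrite leNgt m1.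
by move=> /m2; rewrite leNgt m1'.
Qed.

Lemma arrivals_first_passage t m o : first_passage t m o -> arrivals D t o = m.
Proof.
move=> om; apply: xget_unique => // m' om'; exact: first_passage_inj om.
Qed.

Lemma first_passage_exists t o : ~ (exists m, first_passage t m o) ->
  forall m, arrival_time D m.+1 o <= t.
Proof.
move=> noE m; rewrite leNgt; apply/negP => tm; apply: noE.
have ex : exists m, t < arrival_time D m.+1 o by exists m.
exists (ex_minn ex); case: ex_minnP => k tk kmin; split => // i ik.
by rewrite leNgt; apply/negP => /kmin; rewrite leqNgt ik.
Qed.

Definition gaps_only : pred (@driving_index J) := fun i => if i is inl (inl _) then true else false.

Lemma subOmega_arrival_time m :
  measurable_fun setT (arrival_time D m : subOmega D gaps_only -> R).
Proof. by apply: measurable_sum => i; exact: subOmega_gap. Qed.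

Lemma subOmega_first_passage t m :
  measurable (first_passage t m : set (subOmega D gaps_only)).
Proof.
rewrite (_ : first_passage t m = arrival_time D m.+1 @^-1` `]t, +oo[%classic `&`
    \bigcap_(i in `I_m) arrival_time D i.+1 @^-1` `]-oo, t]%classic).
  apply: measurableI.
    by rewrite -[X in measurable X]setTI; exact: subOmega_arrival_time.
  apply: bigcap_measurableType => // i _.
  by rewrite -[X in measurable X]setTI; exact: subOmega_arrival_time.
apply/seteqP; split => o /=; rewrite in_itv/= andbT.
  by move=> [? oi]; split => // i /=; rewrite in_itv/=; exact: oi.
by move=> [? oi]; split => // i /oi; rewrite in_itv.
Qed.

Lemma measurable_first_passage t m : measurable (first_passage t m).
Proof.
exact: (measurable_generated (@measurable_driving_events _ _ _ _ _ _ _ _ _ D)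
  (subOmega_first_passage t m)).
Qed.

Lemma measurable_chainT w m : measurable_fun setT (chain D w m).
Proof. exact: (subOmega_measurable (measurable_chain_past (D := D) w (m := m))). Qed.

End CenteredProcess.

(** * The centered process *)

Section ExponentialGaps.
Context {R : realType}.
Variable rate : R.
Local Open Scope ereal_scope.

Lemma exponential_prob_ge0 (A : set R) : measurable A ->
  exponential_prob rate A = exponential_prob rate (A `&` `[0%R, +oo[).
Proof.
move=> mA; rewrite /exponential_prob.
have -> : (fun x => (exponential_pdf rate x)%:E) =
    (EFin \o (fun x => rate * expR (- rate * x))%R) \_ `[0%R, +oo[.
  by rewrite restrict_EFin.
by rewrite -!integral_mkcondr -setIA setIid.
Qed.

Lemma exponential_cdf t : (0 <= t)%R ->
  exponential_prob rate `]-oo, t] = (1 - expR (- rate * t))%:E.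
Proof.
move=> t0; rewrite exponential_prob_ge0//.
rewrite (_ : _ `&` _ = `[0%R, t]%classic); last first.
  apply/seteqP; split => x /=; rewrite !in_itv/= andbT; first by move=> [-> ->].
  by move=> /andP[-> ->].
move: t0; rewrite le_eqVlt => /predU1P[<-|t0]; last first.
  by rewrite exponential_prob_itv0c.
by rewrite mulr0 expR0 subrr set_itv1 /exponential_prob integral_set1.
Qed.

Lemma exponential_lt0 : exponential_prob rate `]-oo, 0%R[ = 0.
Proof.
rewrite exponential_prob_ge0// (_ : _ `&` _ = set0).
  by rewrite /exponential_prob integral_set0.
apply/seteqP; split => x //=; rewrite !in_itv/= andbT => -[x0].
by rewrite leNgt x0.
Qed.

End ExponentialGaps.

Section CenteredLaw.
Context {R : realType} {J : finType} {c : job_classes R J} {n : nat} {rate : R}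
  {p : J -> R} {d : measure_display} {Omega : measurableType d}
  {P : probability Omega R} (D : driving c n rate p P).
Hypotheses (p_ge0 : forall j, 0 <= p j) (p_sum : \sum_j p j = 1)
  (d_le_n : forall j, (jc_d c j <= n)%N).
Variable t : R.
Hypothesis t_ge0 : 0 <= t.
Local Open Scope ereal_scope.

Let Q := transition p_ge0 p_sum d_le_n.
Let q : R := (1 - expR (- rate * t))%R.

Lemma gap_cdf m : P (gap D m @^-1` `]-oo, t]) = q%:E.
Proof. by rewrite gap_law// exponential_cdf. Qed.

Lemma early_rate_ge0 : (0 <= q)%R.
Proof. by rewrite -lee_fin -(gap_cdf 0). Qed.

Lemma early_rate_lt1 : (q < 1)%R.
Proof. by rewrite gtrBl expR_gt0. Qed.

(** Up to a null event, m arrivals by time t force the first m gaps to be at most t. The resulting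
    geometric bound [q ^+ m] is used in place of the Poisson weights. *)
Definition early_gaps m : set Omega := [set o | forall i, (i < m)%N -> gap D i o <= t]%R.

Lemma measurable_early_gaps m : measurable (early_gaps m).
Proof.
rewrite (_ : early_gaps m = \bigcap_(i in `I_m) gap D i @^-1` `]-oo, t]%classic).
  apply: bigcap_measurableType => // i _.
  by rewrite -[X in measurable X]setTI; exact: gap_measurable.
apply/seteqP; split => o oi i /oi /=; by rewrite in_itv.
Qed.

Lemma prob_early_gaps m : P (early_gaps m) = (q ^+ m)%:E.
Proof.
pose w0 : n.-tuple R := [tuple 0%R | i < n].
have := @chain_gaps _ _ _ _ _ _ _ _ _ D p_ge0 p_sum d_le_n m w0 `]-oo, t]%classic (cst 1).
rewrite gap_cdf iter_average_cst mule1 -EFin_expe => <- //.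
under eq_integral do rewrite mule1.
transitivity (\int[P]_o (\1_(early_gaps m) o)%:E).
  by rewrite integral_indic ?setIT//; exact: measurable_early_gaps.
apply: eq_integral => o _; congr EFin; rewrite indicE.
have [/set_mem om|om] := boolP (o \in early_gaps m).
  rewrite big1// => i _; rewrite indicE mem_set//= in_itv/=; exact: om.
apply/esym/eqP; rewrite prodf_seq_eq0; apply/negPn; apply: contra om => noi.
apply/mem_set => i im; move/hasPn : noi => /(_ (Ordinal im)).
rewrite mem_index_enum => /(_ isT); rewrite /= indicE.
by case: (boolP (o \in _)) => [/set_mem|]; rewrite ?eqxx//= in_itv.
Qed.

Lemma gaps_nonnegative : P.-negligible [set o | exists i, gap D i o < 0]%R.
Proof.
have mG i : measurable (gap D i @^-1` `]-oo, 0%R[).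
  by rewrite -[X in measurable X]setTI; exact: gap_measurable.
have : P.-negligible (\bigcup_i gap D i @^-1` `]-oo, 0%R[%classic).
  apply: negligible_bigcup => i; apply/negligibleP => //.
  by apply: etrans (exponential_lt0 rate); exact: gap_law.
by apply: negligibleS => o [i oi]; exists i => //=; rewrite in_itv.
Qed.

Lemma early_arrivals m o : ~ (exists i, gap D i o < 0)%R ->
  (forall i, (i < m)%N -> arrival_time D i.+1 o <= t)%R -> early_gaps m o.
Proof.
move=> gap0 om i /om; apply: le_trans; rewrite /arrival_time big_ord_recr/= lerDr.
apply: sumr_ge0 => k _; rewrite leNgt; apply/negP => gk; apply: gap0.
by exists (k : nat).
Qed.

Lemma early_arrivals_le m (A : set Omega) : measurable A ->
  (forall o, A o -> forall i, (i < m)%N -> arrival_time D i.+1 o <= t)%R ->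
  P A <= (q ^+ m)%:E.
Proof.
move=> mA Am; have [N [mN N0 subN]] := gaps_nonnegative.
apply: (@le_trans _ _ (P (N `|` early_gaps m))).
  apply: le_measure; rewrite ?inE//.
    by apply: measurableU => //; exact: measurable_early_gaps.
  move=> o Ao; have [oneg|opos] := pselect (exists i, gap D i o < 0)%R.
    by left; exact: subN.
  by right; apply: early_arrivals => //; exact: Am.
have : P (N `|` early_gaps m) <= P N + P (early_gaps m).
  exact: (measureU2 P mN (measurable_early_gaps m)).
by rewrite N0 add0e prob_early_gaps.
Qed.

Lemma first_passage_le m : P (first_passage D t m) <= (q ^+ m)%:E.
Proof.
apply: early_arrivals_le; first exact: measurable_first_passage.
by move=> o [].
Qed.

Let passages : set Omega := \bigcup_m first_passage D t m.

Let measurable_passages : measurable passages.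
Proof. by apply: bigcup_measurable => m _; exact: measurable_first_passage. Qed.

Lemma prob_no_passage : P (~` passages) = 0.
Proof.
apply/eqP; rewrite eq_le measure_ge0 andbT.
have qcvg : (fun m => (q ^+ m)%:E) @ \oo --> (0 : \bar R).
  apply/fine_cvgP; split; first by near=> m.
  by apply: cvg_expr; rewrite ger0_norm ?early_rate_ge0// early_rate_lt1.
rewrite -(cvg_lim (@ereal_hausdorff R) qcvg); apply: lime_ge.
  by apply/cvg_ex; exists 0.
apply: nearW => m; apply: early_arrivals_le.
  exact: measurableC.
move=> o noE i _; apply: first_passage_exists => -[k ok]; apply: noE.
by exists k.
Unshelve. all: by end_near. Qed.

Lemma measurable_centered w : measurable_fun setT (centered D w t).
Proof.
move=> _ B mB; rewrite setTI.
(* Where no passage exists, [arrivals] takes its default value 0; this is the last piece. *)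
rewrite (_ : _ @^-1` B = (\bigcup_m (first_passage D t m `&` chain D w m @^-1` B)) `|`
    (~` passages `&` chain D w 0 @^-1` B)).
  apply: measurableU.
    apply: bigcup_measurable => m _; apply: measurableI.
      exact: measurable_first_passage.
    by rewrite -[X in measurable X]setTI; exact: measurable_chainT.
  apply: measurableI; first exact: measurableC.
  by rewrite -[X in measurable X]setTI; exact: measurable_chainT.
apply/seteqP; split => o /=; rewrite centeredE.
  have [[m _ om] Bo|noE Bo] := pselect (passages o).
    left; exists m => //; split => //=.
    by rewrite -(arrivals_first_passage om).
  right; split => //; move: Bo; rewrite /arrivals xgetPN// => m om; apply: noE.
  by exists m.
case=> [[m _ [om /= Bo]]|[noE /= Bo]]; first by rewrite (arrivals_first_passage om).
by rewrite /arrivals xgetPN// => m om; apply: noE; exists m.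
Qed.

Lemma expectation_chain w m f : (forall z, 0 <= f z) -> measurable_fun setT f ->
  \int[P]_o f (chain D w m o) = iter m (average Q) f (centering w).
Proof.
move=> f0 mf.
have := @chain_gaps _ _ _ _ _ _ _ _ _ D p_ge0 p_sum d_le_n m w setT f measurableT f0 mf.
rewrite preimage_setT (_ : P setT = 1); last exact: probability_setT.
rewrite -EFin_expe expr1n mul1e => <-; apply: eq_integral => o _.
by rewrite big1 ?mul1e// => i _; rewrite preimage_setT indicT.
Qed.

Definition marks_only : pred (@driving_index J) :=
  fun i => if i is inl (inl _) then false else true.

(** The number of arrivals is a function of the gaps alone and the chain a function of the marks
    alone, so the two are independent. *)
Lemma expectation_first_passage w m f : (forall z, 0 <= f z) -> measurable_fun setT f ->
  \int[P]_o ((\1_(first_passage D t m) o)%:E * f (chain D w m o)) =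
  P (first_passage D t m) * iter m (average Q) f (centering w).
Proof.
move=> f0 mf.
pose phi (v : R * n.-tuple R) : \bar R := `|v.1|%:E * f v.2.
have mX : measurable_fun setT
    (\1_(first_passage D t m) : subOmega D (@gaps_only J) -> R).
  by apply: (@measurable_indic _ (subOmega D _)); exact: subOmega_first_passage.
have mY : measurable_fun setT (chain D w m : subOmega D marks_only -> n.-tuple R).
  exact: measurable_chain.
have disj i : gaps_only i -> ~~ marks_only i by case: i => [[]|[]].
have phi0 z : 0 <= phi z by rewrite mule_ge0.
have mphi : measurable_fun setT phi.
  apply: emeasurable_funM.
    by apply/measurable_EFinP; apply: measurableT_comp.
  exact: measurableT_comp.
have := integral_subOmega_independent disj mX mY mphi phi0.
rewrite (eq_integral (fun o => (\1_(first_passage D t m) o)%:E * f (chain D w m o))); last first.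
  by move=> o _; rewrite /phi/= ger0_norm.
move=> ->; rewrite -(expectation_chain w m f0 mf).
rewrite (eq_integral (fun o => (\1_(first_passage D t m) o)%:E *
  \int[P]_o f (chain D w m o))); last first.
  move=> o _; rewrite /phi /= ge0_integralZl// ?ger0_norm//.
  by apply: measurableT_comp => //; exact: measurable_chainT.
rewrite ge0_integralZr//; last 2 first.
- by apply/measurable_EFinP; exact: subOmega_measurable mX.
- exact: integral_ge0.
by rewrite integral_indic ?setIT//; exact: measurable_first_passage.
Qed.

Lemma expectation_centered w f : (forall z, 0 <= f z) -> measurable_fun setT f ->
  \int[P]_o f (centered D w t o) =
  \sum_(m <oo) P (first_passage D t m) * iter m (average Q) f (centering w).
Proof.
move=> f0 mf.
have mI m : measurable_fun setT (fun o => (\1_(first_passage D t m) o)%:E : \bar R).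
  by apply/measurable_EFinP; apply: measurable_indic; exact: measurable_first_passage.
have mfc m : measurable_fun setT (fun o => f (chain D w m o)).
  by apply: measurableT_comp => //; exact: measurable_chainT.
have mt m : measurable_fun setT (fun o =>
    (\1_(first_passage D t m) o)%:E * f (chain D w m o)).
  exact: emeasurable_funM.
have t0 m o : 0 <= (\1_(first_passage D t m) o)%:E * f (chain D w m o).
  by rewrite mule_ge0.
transitivity (\int[P]_o \sum_(m <oo)
    ((\1_(first_passage D t m) o)%:E * f (chain D w m o))); last first.
  rewrite integral_nneseries//; apply: eq_eseriesr => m _.
  exact: expectation_first_passage.
apply: ge0_ae_eq_integral => //.
- by apply: measurableT_comp => //; exact: measurable_centered.
- exact: ge0_emeasurable_sum.
- by move=> o _; exact: nneseries_ge0.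
exists (~` passages); split.
- exact: measurableC.
- exact: prob_no_passage.
apply: subsetC => o [m _ om] _ /=.
rewrite (@nneseriesD1 _ _ m)// eseries0 ?adde0.
  by rewrite indicE mem_set//= mul1e centeredE (arrivals_first_passage om).
move=> k _ /= km; rewrite indicE memNset ?mul0e// => ok.
by rewrite (first_passage_inj ok om) eqxx in km.
Qed.

End CenteredLaw.

(** * Change of the arrival rate *)

Section Rescaling.
Context {R : realType}.
Local Open Scope ereal_scope.

Lemma eq_law_rays (m1 m2 : {measure set (measurableTypeR R) -> \bar R}) :
  (m1 setT < +oo) -> (forall x : R, m1 `]x, +oo[%classic = m2 `]x, +oo[%classic) ->
  forall A : set (measurableTypeR R), measurable A -> m1 A = m2 A.
Proof.
move=> m1T m12 A mA.
apply: (@measure_unique _ R (measurableTypeR R) (@RGenOInfty.G R) (fun k => `](- k%:R)%R, +oo[%classic)) => //.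
- exact: RGenOInfty.measurableE.
- move=> _ _ [x ->] [y ->]; exists (Num.max x y)%R.
  apply/seteqP; split => z /=; rewrite !in_itv/= !andbT gt_max.
    by move=> [-> ->].
  by move=> /andP[-> ->].
- by move=> k; exists (- k%:R)%R.
- apply/seteqP; split => // x _; exists (Num.bound `|x|) => //=.
  rewrite in_itv/= andbT ltrNl (le_lt_trans _ (archi_boundP _))//.
  by rewrite -normrN ler_norm.
- by move=> _ [x ->].
- move=> k; apply: le_lt_trans m1T; apply: le_measure; rewrite ?inE//.
Qed.

Lemma exponential_cdf_max (rate t : R) : (0 < rate)%R ->
  exponential_prob rate `]-oo, t] = (1 - expR (- rate * Num.max t 0))%:E.
Proof.
move=> rate_gt0; have [t0|t0] := leP 0%R t; first exact: exponential_cdf.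
rewrite mulr0 expR0 subrr exponential_prob_ge0// (_ : _ `&` _ = set0).
  by rewrite /exponential_prob integral_set0.
apply/seteqP; split => x //=; rewrite !in_itv/= andbT => -[xt x0].
by move: t0; rewrite ltNge (le_trans x0 xt).
Qed.

Lemma exponential_ray (rate t : R) : (0 < rate)%R ->
  exponential_prob rate `]t, +oo[ = (expR (- rate * Num.max t 0))%:E.
Proof.
move=> rate_gt0.
pose E : probability (measurableTypeR R) R :=
  exponential_distribution_exponential_prob__canonical__probability_measure_Probability rate_gt0.
have := @probability_setC _ _ _ E `]-oo, t]%classic (measurable_itv _).
rewrite setCitvl /E/= exponential_cdf_max// => ->.
by rewrite -EFinB opprB addrC subrK.
Qed.

End Rescaling.

Section RescaledDriving.
Context {R : realType} {J : finType} {c : job_classes R J} {n : nat} {rate : R}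
  {p : J -> R} {d : measure_display} {Omega : measurableType d}
  {P : probability Omega R} (D : driving c n rate p P).
Variable rate' : R.
Hypotheses (rate_gt0 : 0 < rate) (rate'_gt0 : 0 < rate').

Let scaled_gap m o := rate / rate' * gap D m o.

Let measurable_scaled_gap m : measurable_fun setT (scaled_gap m).
Proof. by apply: measurable_funM => //; exact: gap_measurable. Qed.

Let measurable_scaled_gapR m :
  measurable_fun setT (scaled_gap m : Omega -> measurableTypeR R).
Proof. exact: measurable_scaled_gap. Qed.

Let scaled_gap_law m (A : set R) : measurable A ->
  P (scaled_gap m @^-1` A) = exponential_prob rate' A.
Proof.
move=> mA.
pose E : probability (measurableTypeR R) R :=
  exponential_distribution_exponential_prob__canonical__probability_measure_Probability rate'_gt0.
apply: (@eq_law_rays _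
  (measure_function_pushforward__canonical__measure_function_Measure P (measurable_scaled_gapR m)) E) => //.
  exact: (le_lt_trans (@probability_le1 _ _ _ P _ measurableT) (ltry 1)).
move=> x; rewrite /E/= /pushforward.
have -> : scaled_gap m @^-1` `]x, +oo[ = gap D m @^-1` `]x * rate' / rate, +oo[.
  apply/seteqP; split => o /=; rewrite !in_itv/= !andbT /scaled_gap.
    by rewrite ltr_pdivrMr// mulrAC ltr_pdivlMr// [gap _ _ _ * _]mulrC.
  by rewrite ltr_pdivrMr// mulrAC ltr_pdivlMr// [gap _ _ _ * _]mulrC.
rewrite (gap_law D m (measurable_itv _)).
rewrite (exponential_ray _ rate_gt0) (exponential_ray _ rate'_gt0); congr (expR _)%:E.
have -> : Num.max (x * rate' / rate) 0 = Num.max x 0 * rate' / rate.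
  rewrite -mulrA -[RHS]mulrA maxr_pMl ?mul0r//.
  by rewrite divr_ge0// ltW.
by rewrite !mulNr mulrC divfK ?gt_eqF// mulrC.
Qed.

(** Smallness is assumed at the rates [lam n * n] only, while the conclusion concerns every rate.
    Multiplying the gaps by a constant gives a driving of the other rate on the same space, with the
    same marks and hence the same jump chain. *)
Lemma rescale_driving : driving c n rate' p P.
Proof.
apply: (@Driving _ _ c n rate' p d Omega P scaled_gap (cls D) (sel D) (xi D)) => //.
- exact: cls_measurable.
- exact: sel_measurable.
- exact: xi_measurable.
- exact: cls_law.
- exact: sel_law.
- exact: xi_law.
move=> s A us GA; apply: (driving_events_independent (D := D)) => // i /GA.
case: i => [[m|m]|[[m j]|[m j]]] //= [B mB <-].
exists ((fun x => rate / rate' * x) @^-1` B) => //.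
by rewrite -[X in measurable X]setTI; apply: measurable_funM.
Qed.

End RescaledDriving.

(** * Energy drift of the system *)

Section Eligibility.
Context {R : realType} {d k : nat} (F : probability (d.-tuple R) R).
Hypotheses (k_gt0 : (0 < k)%N) (k_le_d : (k <= d)%N).
Hypothesis F_ge0 : F [set x : d.-tuple R | forall i, 0 <= tnth x i] = 1%E.

Lemma kth_of_tnth (x : d.-tuple R) : kth_of k (tnth x) = kth_smallest k x.
Proof. by rewrite /kth_of map_tnth_enum. Qed.

Lemma count_tnth (a : pred R) (x : d.-tuple R) : count a x = #|[pred i | a (tnth x i)]|.
Proof.
rewrite -[in LHS](map_tnth_enum x) count_map cardE -size_filter.
by rewrite {2}/enum_mem -enumT; congr size; apply: eq_filter.
Qed.

Let mkth : measurable_fun setT (fun x : d.-tuple R => kth_of k (tnth x)).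
Proof.
apply: (@measurable_kth_of _ _ _ _ (fun b (x : d.-tuple R) => tnth x b)) => //.
  by rewrite card_ord.
by move=> b; exact: measurable_tnth.
Qed.

(** When fewer than k of the nonnegative sizes vanish, the k-th smallest is positive; as k <= d,
    some size is positive too. *)
Lemma low_eligible_gt0 :
  (F [set x : d.-tuple R | (k <= count (fun y => y == 0%R) x)%N] < 1)%E ->
  (0 < F [set x : d.-tuple R |
    exists a, (0 < Num.min (tnth x a) (kth_of k (tnth x)))%R])%E.
Proof.
set Z := [set x | _]; set L := [set x | _] => FZ1.
have mZ : measurable Z.
  rewrite (_ : Z = [set x | (k <= #|[pred i : 'I_d | (`|tnth x i| <= 0)%R]|)%N]).
    apply: (@measurable_count _ _ _ _ (fun b (x : d.-tuple R) => `|tnth x b|)) => b.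
    by apply: measurableT_comp => //; exact: measurable_tnth.
  apply/seteqP; split=> x; rewrite /Z/= count_tnth;
    rewrite (@eq_card _ [pred i | `|tnth x i| <= 0] [pred i | tnth x i == 0])// => i;
    by rewrite !inE normr_le0.
have mL : measurable L.
  rewrite (_ : L = \bigcup_(a in [set: 'I_d])
      (fun x => Num.min (tnth x a) (kth_of k (tnth x))) @^-1` `]0%R, +oo[).
    apply: fin_bigcup_measurable => // a _; rewrite -[X in measurable X]setTI.
    by apply: measurable_minr => //; exact: measurable_tnth.
  apply/seteqP; split => x /=.
    by move=> [a xa]; exists a => //=; rewrite in_itv/= andbT.
  by move=> [a _ /=]; rewrite in_itv/= andbT; exists a.
have mN := @measurable_sizes_ge0 R d.
set N := [set x | _] in mN.
have sub : ~` Z `<=` L `|` ~` N.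
  move=> x xZ; have [xN|xN] := pselect (N x); [left|by right].
  have zero a : (tnth x a <= 0) = (tnth x a == 0) by rewrite eq_le xN andbT.
  have cardZ : (#|[pred a | (tnth x a <= 0)%R]| < k)%N.
    rewrite ltnNge; apply/negP => xk; apply: xZ; rewrite /Z/= count_tnth.
    by rewrite (@eq_card _ _ [pred a | tnth x a <= 0])// => a; rewrite !inE zero.
  have kth_gt0 : 0 < kth_of k (tnth x).
    by rewrite ltNge kth_of_le ?card_ord// -ltnNge.
  have [a xa] : exists a, 0 < tnth x a.
    apply/not_existsP => xle; move: cardZ; rewrite ltnNge => /negP; apply.
    rewrite (@eq_card _ _ predT) ?card_ord// => a; rewrite !inE leNgt.
    by apply/negP; exact: xle.
  by exists a; rewrite lt_min xa.
have FN : F (~` N) = 0%E by rewrite probability_setC// F_ge0 subee.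
have FZC : (0 < F (~` Z))%E by rewrite probability_setC// sube_gt0.
apply: (lt_le_trans FZC); apply: (@le_trans _ _ (F (L `|` ~` N))).
  apply: le_measure; rewrite ?inE//; first exact: measurableC.
  by apply: measurableU => //; exact: measurableC.
have : (F (L `|` ~` N) <= F L + F (~` N))%E.
  exact: (measureU2 F mL (measurableC mN)).
by rewrite FN adde0.
Qed.

Lemma high_eligibleE :
  [set x : d.-tuple R | (0 < max_entry x - kth_smallest k x)%R] =
  [set x : d.-tuple R | exists a, (0 < tnth x a - Num.min (tnth x a) (kth_of k (tnth x)))%R].
Proof.
have d0 : (0 < d)%N by exact: leq_trans k_le_d.
apply/seteqP; split => x /=; rewrite -kth_of_tnth subr_gt0.
  move=> kx; apply/not_existsP => nox; move: kx; apply/negP; rewrite -leNgt.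
  have xle a : tnth x a <= kth_of k (tnth x).
    rewrite leNgt; apply/negP => xa; apply: (nox a).
    by rewrite subr_gt0 gt_min xa orbT.
  rewrite /max_entry big_seq; apply: bigmax_le => [|y /tnthP[i ->] //].
  by rewrite -nth0 -(tnth_nth _ _ (Ordinal d0)).
move=> [a]; rewrite subr_gt0 gt_min ltxx/= => /lt_le_trans; apply.
exact: (le_bigmax_seq _ (tnth x a) xpredT id (mem_tnth a x)).
Qed.

End Eligibility.

Section EnergyDrift.
Context {R : realType} {J : finType} (c : job_classes R J).
Local Open Scope ereal_scope.

Lemma average_energy n (p : J -> R) (p_ge0 : forall j, (0 <= p j)%R)
    (p_sum : (\sum_j p j = 1)%R) (d_le_n : forall j, (jc_d c j <= n)%N) (w : n.-tuple R) :
  average (transition p_ge0 p_sum d_le_n) (EFin \o @energy R n) w =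
  \sum_j (p j)%:E * (((n ^_ jc_d c j)%:R^-1)%:E * class_energy (k := jc_k c j) (jc_F c j) w).
Proof.
have men : measurable_fun setT (EFin \o @energy R n).
  by apply/measurable_EFinP; exact: measurable_energy.
rewrite average_transition//; last by move=> z; rewrite lee_fin energy_ge0.
apply: eq_bigr => j _; congr (_ * _).
rewrite /class_energy [in RHS]big_mkcond ge0_sume_distrr; last first.
  move=> s _; case: (injectiveb s) => [|//]; apply: integral_ge0 => x _.
  by rewrite lee_fin energy_ge0.
apply: eq_bigr => s _; case: (injectiveb s); last by rewrite mul0r mul0e mule0.
by rewrite mul1r.
Qed.

Hypothesis second_moment : forall j, \int[jc_F c j]_x ((nth 0%R x 0) ^+ 2)%:E < +oo.

(** Class [j0] provides the negative term and all other classes are bounded by [class_energy_le].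
    Convergence keeps the weight of [j0] above half its limit, which makes the gain uniform in n. *)
Lemma energy_drift (pin : nat -> J -> R) (pi_ : J -> R)
    (pin_ge0 : forall n j, (0 <= pin n j)%R)
    (pin_sum : forall n, (\sum_(j : J) pin n j = 1)%R)
    (pin_cvg : forall j, (fun n => pin n j) @ \oo --> pi_ j) j0 :
  (0 < pi_ j0)%R ->
  0 < jc_F c j0 [set x : (jc_d c j0).-tuple R |
    (0 < max_entry x - kth_smallest (jc_k c j0) x)%R] ->
  jc_F c j0 [set x : (jc_d c j0).-tuple R |
    (jc_k c j0 <= count (fun y => y == 0%R) x)%N] < 1 ->
  exists eps C : R, [/\ (0 < eps)%R, (0 < C)%R & exists nbar, (0 < nbar)%N /\
    forall n, (nbar <= n)%N -> (forall j, (jc_d c j <= n)%N) /\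
    forall (d_le_n : forall j, (jc_d c j <= n)%N) (w : n.-tuple R),
    (\sum_(i < n) tnth w i = 0)%R ->
    average (transition (pin_ge0 n) (pin_sum n) d_le_n) (EFin \o @energy R n) w +
      (eps * Phi1 w)%:E <= (energy w + C)%:E].
Proof.
move=> pi0 high; rewrite (high_eligibleE (jc_k_gt0 c j0) (jc_k_le_d c j0)) in high.
move=> /(low_eligible_gt0 (jc_k_gt0 c j0) (jc_k_le_d c j0) (jc_F_ge0 c j0)) low.
have [eps [L [eps0 L0 drift]]] := class_energy_drift (jc_k_gt0 c j0) (jc_k_le_d c j0)
  (jc_F_ge0 c j0) (@jc_F_exchangeable _ _ c j0) low high.
pose m2 j := fine (\int[jc_F c j]_x ((nth 0%R x 0) ^+ 2)%:E).
have m2E j : \int[jc_F c j]_x ((nth 0%R x 0) ^+ 2)%:E = (m2 j)%:E.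
  rewrite fineK// ge0_fin_numE//; apply: integral_ge0 => x _.
  by rewrite lee_fin sqr_ge0.
have m20 j : (0 <= m2 j)%R.
  by rewrite fine_ge0//; apply: integral_ge0 => x _; rewrite lee_fin sqr_ge0.
pose K := (\sum_j (jc_d c j)%:R * m2 j)%R.
have K0 : (0 <= K)%R by apply: sumr_ge0 => j _; rewrite mulr_ge0.
have [n1 _ pin_ge] : \forall n \near \oo, (pi_ j0 / 2 < pin n j0)%R.
  by apply: (cvgr_gt _ (pin_cvg j0)); rewrite ltr_pdivrMr// ltr_pMr// ltr1n.
pose n2 := (\sum_j 4 * jc_d c j)%N.
(* [K] collects the second moments, [2 * L * eps] is the loss from gaps shorter than 2 L, and 1
   makes the constant positive. The factor 1/2 beside [eps] is the one in [sum_spread]. *)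
exists (pi_ j0 / 2 * (eps / 2))%R, (K + 2 * L * eps + 1)%R; split.
- by rewrite mulr_gt0 ?divr_gt0.
- by rewrite ltr_wpDl// addr_ge0// mulr_ge0 ?mulr_ge0// ltW.
exists (maxn n1 n2).+1; split=> // n; rewrite gtn_max => /andP[n1n n2n].
have d4 j : (4 * jc_d c j <= n)%N.
  by apply: leq_trans (ltnW n2n); rewrite /n2 (bigD1 j)//= leq_addr.
split=> [j|d_le_n w w0]; first by apply: leq_trans (d4 j); rewrite leq_pmull.
have n_gt0 : (0 < n)%N by exact: leq_ltn_trans n2n.
have nR : (0 < n%:R :> R)%R by rewrite ltr0n.
have ffR j : (0 < (n ^_ jc_d c j)%:R :> R)%R by rewrite ltr0n ffact_gt0.
pose T j := ((n ^_ jc_d c j)%:R^-1)%:E * class_energy (k := jc_k c j) (jc_F c j) w.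
have ce0 j : 0 <= class_energy (k := jc_k c j) (jc_F c j) w.
  apply: sume_ge0 => s _; apply: integral_ge0 => x _; by rewrite lee_fin energy_ge0.
have T0 j : 0 <= T j by rewrite mule_ge0// lee_fin invr_ge0 ltW.
have Tle j : T j <= (energy w + (jc_d c j)%:R * m2 j)%:E.
  rewrite /T lee_pdivrMl//; have := class_energy_le (jc_k_gt0 c j) (jc_k_le_d c j)
    (jc_F_ge0 c j) (@jc_F_exchangeable _ _ c j) n_gt0 w0.
  by rewrite m2E.
pose r j := fine (T j).
have rE j : T j = (r j)%:E.
  by rewrite fineK// ge0_fin_numE// (le_lt_trans (Tle j))// ltry.
have r_le j : (r j <= energy w + (jc_d c j)%:R * m2 j)%R.
  by rewrite -lee_fin -rE.
have r0 : (r j0 + (eps / 2 * Phi1 w - 2 * L * eps) <=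
    energy w + (jc_d c j0)%:R * m2 j0)%R.
  have := drift n w (d4 j0) w0; rewrite m2E.
  have -> : class_energy (k := jc_k c j0) (jc_F c j0) w = ((n ^_ jc_d c j0)%:R * r j0)%:E.
    by rewrite EFinM -rE /T muleA -EFinM divff ?mul1e// gt_eqF.
  rewrite -!(EFinM, EFinD) lee_fin => h.
  rewrite -(ler_pM2l (mulr_gt0 nR (ffR j0))); apply: le_trans h.
  rewrite le_eqVlt; apply/orP; left; apply/eqP; rewrite /Phi1.
  by field; rewrite gt_eqF.
rewrite average_energy (eq_bigr (fun j => (pin n j * r j)%:E)); last first.
  by move=> j _; rewrite -/(T j) rE.
rewrite sumEFin -EFinD lee_fin.
have Phi_ge0 : (0 <= Phi1 w)%R.
  by rewrite mulr_ge0 ?invr_ge0 ?(ltW nR)// sumr_ge0.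
have pin_le1 j : (pin n j <= 1)%R.
  by rewrite -(pin_sum n) (bigD1 j)//= lerDl sumr_ge0.
pose g := (eps / 2 * Phi1 w - 2 * L * eps)%R.
have sum_le : (\sum_j pin n j * r j + pin n j0 * g <= energy w + K)%R.
  rewrite (bigD1 j0)//= addrAC -mulrDr.
  apply: (@le_trans _ _ (\sum_j pin n j * (energy w + (jc_d c j)%:R * m2 j))%R).
    rewrite [leRHS](bigD1 j0)//= lerD ?ler_wpM2l//.
    by apply: ler_sum => j _; rewrite ler_wpM2l.
  under eq_bigr do rewrite mulrDr.
  rewrite big_split/= -mulr_suml pin_sum mul1r lerD2l.
  by apply: ler_sum => j _; rewrite ler_piMl ?mulr_ge0.
have pj : (pi_ j0 / 2 * (eps / 2 * Phi1 w) <= pin n j0 * (eps / 2 * Phi1 w))%R.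
  apply: ler_wpM2r; first by rewrite mulr_ge0// divr_ge0// ltW.
  by apply/ltW/pin_ge; exact: ltnW.
have pL : (pin n j0 * (2 * L * eps) <= 2 * L * eps)%R.
  by rewrite ler_piMl// mulr_ge0 ?mulr_ge0// ltW.
apply: (@le_trans _ _ (\sum_j pin n j * r j + pin n j0 * (eps / 2 * Phi1 w))%R).
  by rewrite lerD2l -[leLHS]mulrA.
have -> : (\sum_j pin n j * r j + pin n j0 * (eps / 2 * Phi1 w) =
    (\sum_j pin n j * r j + pin n j0 * g) + pin n j0 * (2 * L * eps))%R.
  by rewrite /g mulrBr addrA subrK.
apply: (le_trans (lerD sum_le pL)).
by rewrite -addrA lerD2l lerDl.
Qed.

End EnergyDrift.

(** * Foster function and reachability for the jump chain *)

Section TransitionCentering.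
Context {R : realType} {J : finType} (c : job_classes R J) (n : nat) (p : J -> R).
Hypotheses (p_ge0 : forall j, 0 <= p j) (p_sum : \sum_j p j = 1)
  (d_le_n : forall j, (jc_d c j <= n)%N).
Local Open Scope ereal_scope.

Let Q := transition p_ge0 p_sum d_le_n.

Lemma mean_centering (w : n.-tuple R) : mean (centering w) = 0%R.
Proof. by rewrite /mean sum_centering mulr0. Qed.

Lemma centering_id (w : n.-tuple R) : mean w = 0%R -> centering w = w.
Proof.
by move=> w0; apply: eq_from_tnth => i; rewrite tnth_centering w0 subr0.
Qed.

(** One step brings the chain to a state of mean 0, so only the values there matter. *)
Lemma eq_average_centered (f g : n.-tuple R -> \bar R) w :
  (forall z, 0 <= f z) -> measurable_fun setT f ->
  (forall z, 0 <= g z) -> measurable_fun setT g ->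
  (forall z, mean z = 0%R -> f z = g z) -> average Q f w = average Q g w.
Proof.
move=> f0 mf g0 mg fg; rewrite !average_transition//.
apply: eq_bigr => j _; congr (_ * _); apply: eq_bigr => s _; congr (_ * _).
by apply: eq_integral => x _; apply: fg; exact: mean_centering.
Qed.

Lemma average_centering (f : n.-tuple R -> \bar R) w :
  (forall z, 0 <= f z) -> measurable_fun setT f ->
  average Q f (centering w) = average Q f w.
Proof.
move=> f0 mf; rewrite !average_transition//.
apply: eq_bigr => j _; congr (_ * _); apply: eq_bigr => s _; congr (_ * _).
by apply: eq_integral => x _; rewrite centered_step_centering.
Qed.

Variables (eps C : R).
Hypotheses (eps_gt0 : (0 < eps)%R) (C_gt0 : (0 < C)%R) (n_gt0 : (0 < n)%N).
Hypothesis drift : forall w : n.-tuple R, (\sum_(i < n) tnth w i = 0)%R ->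
  average Q (EFin \o @energy R n) w + (eps * Phi1 w)%:E <= (energy w + C)%:E.

Definition foster_radius : R := (n%:R * (C + 1) / eps)%R.

Lemma foster_radius_gt0 : (0 < foster_radius)%R.
Proof. by rewrite divr_gt0// mulr_gt0 ?ltr0n// addr_gt0. Qed.

Definition foster_ball : set (n.-tuple R) :=
  [set w | mean w = 0%R /\ (l1norm w <= foster_radius)%R].

Definition uncentered : set (n.-tuple R) := [set w | mean w != 0%R].

(** The kernel acts on all of R^n, while the ball lies in the hyperplane of mean 0. The penalty C +
    1 off the hyperplane is lost in the first step, which gives the required decrease at uncentered
    states. *)
Definition foster_function (w : n.-tuple R) : R :=
  (energy (centering w) + (C + 1) * \1_uncentered w)%R.

Let measurable_meanT : measurable_fun setT (@mean R n).
Proof. by apply: (@measurable_mean _ _ _ n id); exact: measurable_id. Qed.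

Lemma measurable_uncentered : measurable uncentered.
Proof.
rewrite (_ : uncentered = ~` (@mean R n @^-1` [set 0%R])).
  by apply: measurableC; rewrite -[X in measurable X]setTI; exact: measurable_meanT.
by apply/seteqP; split => w /=; move/eqP.
Qed.

Lemma measurable_l1norm : measurable_fun setT (@l1norm R n).
Proof.
by apply: measurable_sum => i; apply: measurableT_comp => //; exact: measurable_tnth.
Qed.

Lemma measurable_foster_ball : measurable foster_ball.
Proof.
rewrite (_ : foster_ball = (@mean R n @^-1` [set 0%R]) `&`
    (@l1norm R n @^-1` `]-oo, foster_radius])).
  apply: measurableI; rewrite -[X in measurable X]setTI.
    exact: measurable_meanT.
  exact: measurable_l1norm.
by apply/seteqP; split => w /=; rewrite in_itv.
Qed.

Lemma measurable_foster_function : measurable_fun setT foster_function.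
Proof.
apply: measurable_funD.
  by apply: measurable_energy; apply: measurable_centering; exact: measurable_id.
apply: measurable_funM => //; apply: measurable_indic; exact: measurable_uncentered.
Qed.

Lemma foster_function_ge0 w : (0 <= foster_function w)%R.
Proof. by rewrite addr_ge0 ?energy_ge0// mulr_ge0// addr_ge0// ltW. Qed.

Let menergy : measurable_fun setT (EFin \o @energy R n).
Proof. by apply/measurable_EFinP; exact: measurable_energy. Qed.

Let energy0 z : 0 <= (EFin \o @energy R n) z. Proof. by rewrite lee_fin energy_ge0. Qed.

Lemma foster_drift w :
  average Q (EFin \o foster_function) w + 1 <=
  (foster_function w)%:E + ((C + 1) * \1_foster_ball w)%:E.
Proof.
have mfoster : measurable_fun setT (EFin \o foster_function).
  by apply/measurable_EFinP; exact: measurable_foster_function.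
have foster0 z : 0 <= (EFin \o foster_function) z.
  by rewrite lee_fin foster_function_ge0.
have -> : average Q (EFin \o foster_function) w =
    average Q (EFin \o @energy R n) (centering w).
  rewrite average_centering//; apply: eq_average_centered => // z z0 /=.
  rewrite /foster_function centering_id// indicE memNset ?mulr0 ?addr0//=.
  by rewrite /uncentered/= z0 eqxx.
have := drift (sum_centering w).
have Phi0 : (0 <= eps * Phi1 (centering w))%R.
  by rewrite mulr_ge0 ?(ltW eps_gt0)// mulr_ge0 ?invr_ge0// sumr_ge0.
have avg0 : 0 <= average Q (EFin \o @energy R n) (centering w) by exact: average_ge0.
case: (average _ _ _) avg0 => [r|//|//] _; rewrite -!EFinD !lee_fin.
rewrite /foster_function; have [w0|w0] := eqVneq (mean w) 0%R; last first.
  rewrite [\1_uncentered w]indicE mem_set//= indicE.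
  have : (0 <= (C + 1) * (w \in foster_ball)%:R)%R by rewrite mulr_ge0// addr_ge0// ltW.
  rewrite mulr1; move: Phi0; set e := (eps * _)%R; set i := ((C + 1) * _)%R.
  by set v := energy _; lra.
rewrite [\1_uncentered w]indicE memNset/= ?/uncentered/= ?w0 ?eqxx// mulr0 addr0 indicE.
have [wB|wB] := boolP (w \in foster_ball); first by rewrite /=; lra.
have : (foster_radius < l1norm w)%R.
  rewrite ltNge; apply/negP => wr; move/negP : wB; apply; exact/mem_set.
move=> radius_lt; have : (C + 1 < eps * Phi1 (centering w))%R.
  rewrite centering_id// /Phi1 mulrA -ltr_pdivrMl; last by rewrite mulr_gt0 ?invr_gt0 ?ltr0n.
  rewrite invfM invrK (_ : (_ * _)%R = foster_radius)//.
  by rewrite /foster_radius mulrAC mulrC mulrA mulrAC.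
rewrite mulr0 addr0; set e := (eps * _)%R; set v := energy _; lra.
Qed.

Variables (M : {finite_measure set (n.-tuple R) -> \bar R}) (q : R).
Hypotheses (q_gt0 : (0 < q)%R) (q_lt1 : (q < 1)%R) (M_gt0 : 0 < M setT).
Hypothesis minorized : forall w A, foster_ball w -> measurable A ->
  M A <= \sum_(m <oo) (q ^+ m)%:E * iter m (average Q) (EFin \o \1_A) w.

Lemma exists_stationary_law : exists pi : probability (n.-tuple R) R,
  forall A, measurable A -> \int[pi]_w Q w A = pi A.
Proof.
have b_ge0 : (0 <= C + 1)%R by rewrite addr_ge0// ltW.
have Bw0 : foster_ball [tuple 0%R | i < n].
  split; first by rewrite /mean big1 ?mulr0// => i _; rewrite tnth_mktuple.
  rewrite /l1norm big1 ?(ltW foster_radius_gt0)// => i _.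
  by rewrite tnth_mktuple normr0.
exact: (exists_invariant_probability
  measurable_foster_function foster_function_ge0 measurable_foster_ball Bw0 b_ge0
  q_gt0 q_lt1 foster_drift M_gt0 minorized).
Qed.

(** If A had probability below delta at every step, the minorizing series would be at most delta /
    (1 - q). The choice of delta makes this M(A) / 2, a contradiction. *)
Lemma minorized_reach A : measurable A -> 0 < M A ->
  exists2 delta : R, (0 < delta)%R & forall w, foster_ball w ->
    exists m, delta%:E <= iter m (average Q) (EFin \o \1_A) w.
Proof.
move=> mA MA0; have MAf : M A \is a fin_num by exact: fin_num_measure.
have p_gt0 : (0 < 1 - q)%R by rewrite subr_gt0.
have m_gt0 : (0 < fine (M A))%R by rewrite fine_gt0// MA0 ltey_eq MAf.
exists ((1 - q) * (fine (M A) / 2))%R; first by rewrite mulr_gt0// divr_gt0.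
move=> w Bw; apply/not_existsP => no; have := minorized Bw mA.
apply/negP; rewrite -ltNge -(fineK MAf).
apply: (@le_lt_trans _ _ (fine (M A) / 2)%:E); last first.
  by rewrite lte_fin ltr_pdivrMr// ltr_pMr// ltr1n.
have term m : (q ^+ m)%:E * iter m (average Q) (EFin \o \1_A) w <=
    (geometric ((1 - q) * (fine (M A) / 2)) q m)%:E.
  rewrite /geometric/= mulrC EFinM lee_wpmul2l ?lee_fin ?exprn_ge0 ?(ltW q_gt0)//.
  by rewrite leNgt; apply/negP => /ltW; exact: no.
apply: lime_le.
  apply: is_cvg_nneseries => m _ _; rewrite mule_ge0 ?iter_average_ge0 ?lee_fin//.
    by rewrite exprn_ge0// ltW.
  by move=> z; rewrite lee_fin.
apply: nearW => N.
apply: (@le_trans _ _ (\sum_(0 <= m < N) (geometric ((1 - q) * (fine (M A) / 2)) q m)%:E)).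
  by apply: lee_sum => m _; exact: term.
rewrite sumEFin lee_fin; apply: le_trans (geometric_le_lim _ _ q_gt0 _) _.
- by rewrite mulr_ge0 ?divr_ge0 ?ltW.
- by rewrite gtr0_norm.
by rewrite mulrAC divff ?mul1r// gt_eqF.
Qed.

End TransitionCentering.

Arguments uncentered {R n}.

Section EmpiricalCcdf.
Context {R : realType}.

Lemma measurable_empirical_ccdf n :
  measurable_fun setT (@empirical_ccdf R n).
Proof.
apply: (@measurability _ _ _ (@ccdf_space R) setT _ (@evaluation_sets R)) => //.
move=> _ [_ [u [B mB ->]] <-]; rewrite setTI.
rewrite (_ : _ @^-1` _ = (fun w : n.-tuple R =>
    n%:R^-1 * \sum_(i < n) \1_(`]u, +oo[%classic : set R) (tnth w i)) @^-1` B).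
  rewrite -[X in measurable X]setTI; apply: measurable_funM => //.
  apply: measurable_sum => i; apply: measurableT_comp; last exact: measurable_tnth.
  exact: measurable_indic.
apply/seteqP; split => w /=; rewrite /empirical_ccdf;
  under eq_bigr do rewrite indicE mem_setE in_itv/= andbT; done.
Qed.

End EmpiricalCcdf.

Section Recurrence.
Context {R : realType} {J : finType} {c : job_classes R J} {n : nat} {rate : R}
  {p : J -> R} {d : measure_display} {Omega : measurableType d}
  {P : probability Omega R} (D : driving c n rate p P).
Hypotheses (p_ge0 : forall j, 0 <= p j) (p_sum : \sum_j p j = 1)
  (d_le_n : forall j, (jc_d c j <= n)%N) (rate_gt0 : 0 < rate).
Local Open Scope ereal_scope.

Let Q := transition p_ge0 p_sum d_le_n.

Let mindic (A : set (n.-tuple R)) : measurable A ->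
  measurable_fun setT (EFin \o \1_A : n.-tuple R -> \bar R).
Proof. by move=> mA; apply/measurable_EFinP; exact: measurable_indic. Qed.

Let indic0 (A : set (n.-tuple R)) z : 0 <= (EFin \o \1_A : n.-tuple R -> \bar R) z.
Proof. by rewrite lee_fin. Qed.

Lemma prob_centered w t A : (0 <= t)%R -> measurable A ->
  P [set o | A (centered D w t o)] =
  \sum_(m <oo) P (first_passage D t m) * iter m (average Q) (EFin \o \1_A) (centering w).
Proof.
move=> t0 mA; rewrite -(expectation_centered D p_ge0 p_sum d_le_n t0)//; last exact: mindic.
have mc : measurable (centered D w t @^-1` A).
  by rewrite -[X in measurable X]setTI; exact: measurable_centered.
by rewrite [RHS](integral_indic P measurableT mc) setIT.
Qed.

(** The law at time tau is the mixture of the m-step laws with the probabilities of m arrivals, each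
    at most [q ^+ m]. It is therefore dominated by the unnormalized resolvent, which dominates M in
    turn. *)
Lemma small_minorized C0 : small_set D [set z | (l1norm z <= C0)%R] ->
  exists (q : R) (M : {finite_measure set (n.-tuple R) -> \bar R}),
    [/\ (0 < q)%R, (q < 1)%R, 0 < M setT &
      forall w A, mean w = 0%R -> (l1norm w <= C0)%R -> measurable A ->
      M A <= \sum_(m <oo) (q ^+ m)%:E * iter m (average Q) (EFin \o \1_A) w].
Proof.
move=> [tau tau_gt0 [M M_gt0 minor]].
exists (1 - expR (- rate * tau))%R, M; split => //.
- by rewrite subr_gt0 expR_lt1 mulNr oppr_lt0 mulr_gt0.
- by rewrite gtrBl expR_gt0.
move=> w A w0 wC mA; have := minor w; rewrite /= centering_id// => /(_ wC _ mA) /le_trans.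
apply; rewrite (prob_centered _ (ltW tau_gt0) mA) centering_id//.
apply: lee_nneseries => [m _ _|m _]; first by rewrite mule_ge0// iter_average_ge0.
rewrite lee_wpmul2r ?iter_average_ge0//.
by apply: (first_passage_le D p_ge0 p_sum d_le_n); exact: ltW.
Qed.

Section Stationary.
Variable pi : probability (n.-tuple R) R.
Hypothesis pi_invariant : forall A, measurable A -> \int[pi]_w Q w A = pi A.

Lemma integral_invariant f : (forall z, 0 <= f z) -> measurable_fun setT f ->
  \int[pi]_w average Q f w = \int[pi]_w f w.
Proof.
move=> f0 mf; rewrite -integral_push_measure//.
apply: eq_measure_integral => A mA _; rewrite -[RHS]pi_invariant//.
Qed.

Lemma integral_iter_invariant m f : (forall z, 0 <= f z) -> measurable_fun setT f ->
  \int[pi]_w iter m (average Q) f w = \int[pi]_w f w.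
Proof.
move=> f0 mf; elim: m => [//|m IH] /=; rewrite integral_invariant//.
  by move=> z; exact: iter_average_ge0.
exact: measurable_iter_average.
Qed.

Lemma invariant_uncentered : pi uncentered = 0.
Proof.
have mU : measurable (uncentered : set (n.-tuple R)) by exact: measurable_uncentered.
rewrite -pi_invariant// integral0_eq// => w _.
transitivity (average Q (EFin \o \1_uncentered) w).
  by rewrite /average integral_indic ?setIT.
rewrite (@eq_average_centered _ _ _ _ _ _ _ _ _ (cst 0))//; last 2 first.
- exact: mindic.
- by move=> z z0; rewrite /= indicE memNset// /uncentered/= z0 eqxx.
exact: average_cst.
Qed.

Lemma integral_invariant_centering m f : (forall z, 0 <= f z) -> measurable_fun setT f ->
  \int[pi]_w iter m (average Q) f (centering w) = \int[pi]_w f w.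
Proof.
move=> f0 mf; rewrite -(integral_iter_invariant m f0 mf).
have mi : measurable_fun setT (iter m (average Q) f) by exact: measurable_iter_average.
apply: ge0_ae_eq_integral => //.
- apply: measurableT_comp => //; apply: measurable_centering; exact: measurable_id.
- by move=> w _; exact: iter_average_ge0.
- by move=> w _; exact: iter_average_ge0.
exists uncentered; split.
- exact: measurable_uncentered.
- exact: invariant_uncentered.
move=> w /= noeq; apply/eqP => w0; apply: noeq => _.
by rewrite centering_id.
Qed.

(** Every m-step law preserves pi, and the probabilities of m arrivals by time t add up to 1. The
    initial centering is harmless because pi charges only states of mean 0. *)
Lemma law_stationary t A : (0 <= t)%R -> measurable A ->
  \int[pi]_w P [set o | A (centered D w t o)] = pi A.
Proof.
move=> t0 mA.
have mi m : measurable_fun setT (iter m (average Q) (EFin \o \1_A)).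
  by apply: measurable_iter_average => //; exact: mindic.
have mic m : measurable_fun setT (fun w =>
    P (first_passage D t m) * iter m (average Q) (EFin \o \1_A) (centering w)).
  apply: emeasurable_funM; first exact: measurable_cst.
  by apply: measurableT_comp => //; apply: measurable_centering; exact: measurable_id.
under eq_integral do rewrite prob_centered//.
rewrite integral_nneseries//; last by move=> m w _; rewrite mule_ge0// iter_average_ge0.
have piA : \int[pi]_w (EFin \o \1_A) w = pi A by rewrite integral_indic// setIT.
rewrite (eq_eseriesr (g := fun m => P (first_passage D t m) * pi A)); last first.
  move=> m _; rewrite -(fineK (fin_num_measure P _ (measurable_first_passage D t m))).
  rewrite ge0_integralZl ?lee_fin ?fine_ge0//.
  - by rewrite integral_invariant_centering// ?piA//; exact: mindic.
  - apply: measurableT_comp => //; apply: measurable_centering; exact: measurable_id.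
  - by move=> w _; exact: iter_average_ge0.
have w0 : n.-tuple R by exact: [tuple 0%R | i < n].
have sum1 : \sum_(m <oo) P (first_passage D t m) = 1.
  transitivity (\sum_(m <oo) P (first_passage D t m) *
      iter m (average Q) (cst 1) (centering w0)).
    by apply: eq_eseriesr => m _; rewrite iter_average_cst mule1.
  rewrite -(expectation_centered D p_ge0 p_sum d_le_n t0)//.
  by rewrite integral_cst// mul1e; exact: probability_setT.
rewrite -(fineK (fin_num_measure pi _ mA)).
rewrite (eq_eseriesr (g := fun m => (fine (pi A))%:E * P (first_passage D t m))); last first.
  by move=> m _; rewrite muleC.
by rewrite nneseriesZl// sum1 mule1.
Qed.

Lemma invariant_stationary : stationary P (centered_ccdf D) pi.
Proof.
move=> t t0 A mA.
have mA' : measurable ((@empirical_ccdf R n) @^-1` A).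
  by rewrite -[X in measurable X]setTI; exact: measurable_empirical_ccdf.
by rewrite (law_stationary t0 mA') (law_stationary (lexx 0%R) mA').
Qed.

End Stationary.

End Recurrence.

(** * Harris recurrence *)

Section HarrisRecurrence.
Context {R : realType} {J : finType} {c : job_classes R J} {n : nat} {rate : R}
  {p : J -> R} {d : measure_display} {Omega : measurableType d}
  {P : probability Omega R} (D : driving c n rate p P).
Hypotheses (p_ge0 : forall j, 0 <= p j) (p_sum : \sum_j p j = 1)
  (d_le_n : forall j, (jc_d c j <= n)%N).
Local Open Scope ereal_scope.

Let Q := transition p_ge0 p_sum d_le_n.

Let visit (A : set (n.-tuple R)) (Gam : set R) w i : set Omega :=
  gap D i @^-1` Gam `&` chain D w i @^-1` A.

Let measurable_visit A Gam w i : measurable A -> measurable Gam ->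
  measurable (visit A Gam w i).
Proof.
move=> mA mGam; apply: measurableI; rewrite -[X in measurable X]setTI.
  exact: gap_measurable.
exact: measurable_chainT.
Qed.

(** The event [bad m], no visit from step m on, has probability at most the m-step mean of
    [survival Q a M], for every M. Letting M tend to infinity makes it null. *)
Lemma infinite_visits A Gam w : measurable A -> measurable Gam ->
  (forall z, survival Q (fun z => 1 - fine (P (gap D 0 @^-1` Gam)) * \1_A z)%R ^~ z
     @ \oo --> 0) ->
  {ae P, forall o, forall m, exists2 i, (m <= i)%N &
     Gam (gap D i o) /\ A (chain D w i o)}.
Proof.
move=> mA mGam surv0; set a := (fun z => _) in surv0.
pose bad m : set Omega := \bigcap_i ~` visit A Gam w (m + i).
have mbad m : measurable (bad m).
  by apply: bigcap_measurableType => // i _; apply: measurableC; exact: measurable_visit.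
have mgap : measurable (gap D 0 @^-1` Gam).
  by rewrite -[X in measurable X]setTI; exact: gap_measurable.
have rho01 : (0 <= fine (P (gap D 0 @^-1` Gam)) <= 1)%R.
  by rewrite fine_ge0//= -lee_fin fineK ?fin_num_measure// probability_le1.
have a01 z : (0 <= a z <= 1)%R.
  case/andP: rho01 => r0 r1.
  rewrite /a indicE; case: (z \in A); rewrite /= ?mulr1 ?mulr0 ?subr0 ?ler01 ?lexx//.
  by rewrite subr_ge0 r1 gerBl.
have ma : measurable_fun setT a.
  by apply: measurable_funB => //; apply: measurable_funM => //; exact: measurable_indic.
have bad_le m M : P (bad m) <= iter m (average Q) (survival Q a M) (centering w).
  rewrite -(expectation_chain D p_ge0 p_sum d_le_n w m)//; last 2 first.
  - by move=> z; exact: survival_ge0.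
  - exact: measurable_survival.
  have := @chain_survival _ _ _ _ _ _ _ _ _ D p_ge0 p_sum d_le_n M m w (cst 1%R) A Gam
    mA mGam (measurable_cst _) (fun=> ler01).
  under [X in _ = X -> _]eq_integral do rewrite mul1e.
  move=> <-; have -> : P (bad m) = \int[P]_o (\1_(bad m) o)%:E.
    by rewrite integral_indic ?setIT.
  have mfail i : measurable_fun setT
      ((fun o => 1 - \1_(gap D i @^-1` Gam) o * \1_A (chain D w i o))%R : Omega -> R).
    apply: measurable_funB => //; apply: measurable_funM.
      apply: measurable_indic; rewrite -[X in measurable X]setTI; exact: gap_measurable.
    by apply: measurableT_comp; [exact: measurable_indic|exact: measurable_chainT].
  have fail0 i o : (0 <= 1 - \1_(gap D i @^-1` Gam) o * \1_A (chain D w i o) :> R)%R.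
    rewrite !indicE; case: (o \in _); case: (_ \in A);
    by rewrite /= ?mulr1 ?mulr0 ?mul0r ?subr0 ?subrr.
  apply: ge0_le_integral => //.
  - by apply/measurable_EFinP; exact: measurable_indic.
  - apply/measurable_EFinP; apply: measurable_funM => //.
    by apply: measurable_prod => i _; exact: mfail.
  move=> o _; rewrite lee_fin mul1r indicE.
  have [/set_mem ob|_] := boolP (o \in bad m); last first.
    by apply: prodr_ge0 => i _; exact: fail0.
  rewrite big1// => i _; have := ob i I; rewrite /visit /= => nov.
  rewrite !indicE; case: (boolP (o \in _)) => [/set_mem og|_]; last by rewrite mul0r subr0.
  case: (boolP (_ \in A)) => [/set_mem oA|_]; last by rewrite mulr0 subr0.
  by exfalso; apply: nov.
have bad0 m : P (bad m) = 0.
  apply/eqP; rewrite eq_le measure_ge0 andbT.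
  have cvg0 : (fun M => iter m (average Q) (survival Q a M) (centering w)) @ \oo --> 0.
    apply: iter_average_cvg0 => [M|M z|z]; last exact: surv0.
    - exact: measurable_survival.
    - by rewrite survival_ge0//= survival_le1.
  rewrite -(cvg_lim (@ereal_hausdorff R) cvg0); apply: lime_ge.
    by apply/cvg_ex; exists 0.
  by apply: nearW => M; exact: bad_le.
have : P.-negligible (\bigcup_m bad m).
  apply: negligible_bigcup => m; apply/negligibleP; [exact: mbad|exact: bad0].
apply: negligibleS => o /= /existsNP[m noi]; exists m => // i _ /= [? ?].
by apply: noi; exists (m + i)%N; rewrite ?leq_addr.
Qed.

(** Each visit to A occupies the interval up to the next arrival. Infinitely many of these disjoint
    intervals have length above 1; the same visits show that the arrival times are unbounded, so
    that they are those of the process. *)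
Lemma infinite_occupation (A : set (n.-tuple R)) w o :
  (forall i, 0 <= gap D i o)%R ->
  (forall m, exists2 i, (m <= i)%N & (1 < gap D i o)%R /\ A (chain D w i o)) ->
  lebesgue_measure [set t : R | (0 <= t)%R /\ A (centered D w t o)] = +oo.
Proof.
move=> gap0 visits; pose S i := arrival_time D i o.
have SS i : S i.+1 = (S i + gap D i o)%R by rewrite /S /arrival_time big_ord_recr.
have S0 : S 0%N = 0%R by rewrite /S /arrival_time big_ord0.
have Sle : {homo S : i j / (i <= j)%N >-> (i <= j)%R}.
  apply: homo_leq => [//|y x z|i]; first exact: le_trans.
  by rewrite SS lerDl.
have unbounded N : exists m, (N%:R <= S m)%R.
  elim: N => [|N [m mN]]; first by exists 0%N; rewrite S0.
  have [i mi [gi _]] := visits m; exists i.+1; rewrite SS -natr1 lerD//.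
    exact: le_trans (Sle _ _ mi).
  exact: ltW.
pose F i : set R := if asbool (A (chain D w i o)) then `[S i, S i.+1[%classic else set0.
have mF i : measurable (F i) by rewrite /F; case: ifP.
have FE i t : F i t <-> A (chain D w i o) /\ (S i <= t < S i.+1)%R.
  rewrite /F; case: asboolP => Ai /=; last by split => // -[].
  by rewrite in_itv/=; split => [|[]].
have -> : [set t : R | (0 <= t)%R /\ A (centered D w t o)] = \bigcup_i F i.
  apply/seteqP; split => t /=.
    move=> [t0]; rewrite centeredE.
    have [m tm] : exists m, first_passage D t m o.
      apply/not_existsP => no; have [m] := unbounded (Num.bound t).
      apply/negP; rewrite -ltNge; apply: le_lt_trans (archi_boundP t0).
      apply: (@le_trans _ _ (S m.+1)); first exact: Sle.
      by apply: first_passage_exists => -[k]; exact: no.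
    rewrite (arrivals_first_passage tm) => Am; exists m => //; apply/FE; split => //.
    case: tm => -> tm; rewrite andbT; case: m {Am} tm => [|m] tm; first by rewrite S0.
    exact: tm.
  move=> [m _ /FE[Am /andP[St tS]]].
  have tm : first_passage D t m o.
    by split => // i im; apply: le_trans St; exact: Sle.
  rewrite centeredE (arrivals_first_passage tm); split => //.
  by apply: le_trans St; rewrite -S0; exact: Sle.
have muF i : A (chain D w i o) -> lebesgue_measure (F i) = (gap D i o)%:E.
  move=> Ai; rewrite /F asboolT// lebesgue_measure_itv/= lte_fin SS.
  rewrite -EFinB addrAC subrr add0r ltrDl.
  case: ltP => // gi; congr EFin; apply/esym/eqP.
  by rewrite eq_le gi gap0.
have sum_ge N : exists m, N%:R%:E <= \sum_(0 <= i < m) lebesgue_measure (F i).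
  elim: N => [|N [m mN]]; first by exists 0%N; rewrite big_geq.
  have [i mi [gi Ai]] := visits m; exists i.+1.
  rewrite big_nat_recr//= -natr1 EFinD leeD//; last by rewrite muF// lee_fin ltW.
  by apply: (le_trans mN); apply: lee_sum_nneg_natr.
have tF : trivIset setT F.
  apply: ltn_trivIset => i j ji; apply/seteqP; split => t //= [/FE[_ /andP[_ t1]] /FE[_ /andP[t2 _]]].
  by have := lt_le_trans t1 (le_trans (Sle _ _ ji) t2); rewrite ltxx.
rewrite measure_bigcup//; last by move=> i _; exact: mF.
apply/eq_infty => r.
have [m rm] := sum_ge (Num.bound `|r|%R); apply: (@le_trans _ _ (Num.bound `|r|%R)%:R%:E).
  by rewrite lee_fin (le_trans (ler_norm _))// ltW// archi_boundP.
apply: (le_trans rm); rewrite (eq_bigl (fun i => i \in [set: nat])).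
  exact: nneseries_lim_ge.
by move=> i; rewrite in_setT.
Qed.

Variables (V : n.-tuple R -> R) (B : set (n.-tuple R)).
Hypotheses (rate_gt0 : (0 < rate)%R) (mV : measurable_fun setT V)
  (V_ge0 : forall w, (0 <= V w)%R) (mB : measurable B).
Hypothesis drift : forall w, ~ B w -> average Q (EFin \o V) w + 1 <= (V w)%:E.
Variable M : {finite_measure set (n.-tuple R) -> \bar R}.
Hypothesis M_gt0 : 0 < M setT.
Hypothesis reach : forall A, measurable A -> 0 < M A ->
  exists2 delta : R, (0 < delta)%R & forall w, B w ->
    exists m, delta%:E <= iter m (average Q) (EFin \o \1_A) w.

Lemma harris_recurrent_ccdf : harris_recurrent P (centered_ccdf D).
Proof.
pose phi : {measure set (@ccdf_space R) -> \bar R} :=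
  measure_function_pushforward__canonical__measure_function_Measure M
    (@measurable_empirical_ccdf R n).
exists phi; split.
- exists (fun=> setT); first by rewrite bigcup_const.
  move=> _; split; first exact: measurableT.
  by rewrite /phi /= /pushforward preimage_setT ltey_eq fin_num_measure.
- by rewrite /phi /= /pushforward preimage_setT.
move=> A mA phiA w.
have mA' : measurable ((@empirical_ccdf R n) @^-1` A).
  by rewrite -[X in measurable X]setTI; exact: measurable_empirical_ccdf.
have [delta delta_gt0 reachA] := reach mA' phiA.
have gapE : P (gap D 0 @^-1` `]1%R, +oo[) = (expR (- rate * 1))%:E.
  rewrite (gap_law D 0 (measurable_itv _)) exponential_ray//.
  by rewrite (max_idPl _)// ler01.
have rho01 : (0 < fine (P (gap D 0 @^-1` `]1%R, +oo[)) <= 1)%R.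
  by rewrite gapE/= expR_gt0 expR_le1 mulr1 oppr_le0 ltW.
have visits := infinite_visits w mA' (measurable_itv `]1%R, +oo[)
  (survival_cvg0 mV V_ge0 mB drift mA' rho01 delta_gt0 reachA).
have := gaps_nonnegative D; move=> gaps.
apply: negligibleS (negligibleU visits gaps) => o /= infin.
apply: contrapT => /not_orP[/contrapT vis nneg]; apply: infin.
rewrite /occupation_time /centered_ccdf.
apply: (@infinite_occupation ((@empirical_ccdf R n) @^-1` A)).
  by move=> i; rewrite leNgt; apply/negP => gi; apply: nneg; exists i.
move=> m; have [i mi [gi Ai]] := vis m; exists i => //; split => //.
by move: gi; rewrite /= in_itv/= andbT.
Qed.

End HarrisRecurrence.

(** * Moment bound *)

Section SymmetricFunctions.
Context {R : realType} {n : nat}.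
Hypothesis n_gt0 : (0 < n)%N.

Definition ccdf_events : set (set (n.-tuple R)) :=
  preimage_set_system setT (@empirical_ccdf R n) measurable.

(* R^n with the sigma-algebra of the events that depend on the empirical
   distribution only. *)
Definition profile_space := g_sigma_algebraType ccdf_events.

Let measurable_ccdf_at u :
  measurable_fun setT (fun z : profile_space => (empirical_ccdf z u : R)).
Proof.
move=> _ B mB; apply: sub_sigma_algebra.
exists ((fun x : R -> R => x u) @^-1` B) => //.
by apply: sub_sigma_algebra; exists u, B.
Qed.

Let ccdf_count (z : n.-tuple R) u :
  n%:R - n%:R * empirical_ccdf z u = (count (fun y => y <= u) z)%:R :> R.
Proof.
rewrite /empirical_ccdf mulVKf ?pnatr_eq0 -?lt0n// count_tnth -sum1_card natr_sum.
rewrite [RHS]big_mkcond -[X in X%:R - _]card_ord -sum1_card natr_sum -sumrB.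
apply: eq_bigr => i _ /=; rewrite inE ltNge.
by case: (_ <= _); rewrite ?subr0 ?subrr.
Qed.

Lemma measurable_nth_sort_profile k : (k < n)%N ->
  measurable_fun setT (fun z : profile_space => nth 0 (sort <=%R (z : n.-tuple R)) k : R).
Proof.
move=> kn; apply: (measurability _ (RGenOInfty.measurableE R)).
move=> _ [_ [u ->] <-]; rewrite setTI.
rewrite (_ : _ @^-1` _ = ~` ((fun z : profile_space =>
    n%:R - n%:R * empirical_ccdf (z : n.-tuple R) u) @^-1` `[k.+1%:R, +oo[)).
  apply: measurableC; rewrite -[X in measurable X]setTI.
  by apply: measurable_funB => //; apply: measurable_funM.
apply/seteqP; split => z /=; rewrite !in_itv/= !andbT ccdf_count ler_nat ltNge
  nth_sort_le ?size_tuple//; by move/negP.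
Qed.

(** The energy is symmetric, hence a function of the order statistics, which the empirical
    distribution determines. *)
Lemma energy_sort (z : n.-tuple R) :
  energy z = \sum_(k < n) (nth 0 (sort <=%R z) k) ^+ 2.
Proof.
rewrite /energy -(big_tuple _ _ z xpredT (fun y => y ^+ 2)).
rewrite -(perm_big _ (permEl (perm_sort <=%R z))) (big_nth 0) size_sort size_tuple.
by rewrite big_mkord.
Qed.

Lemma measurable_energy_profile :
  measurable_fun setT (fun z : profile_space => energy (z : n.-tuple R)).
Proof.
under eq_fun do rewrite energy_sort.
apply: measurable_sum => k; apply: measurable_funX.
exact: measurable_nth_sort_profile.
Qed.

(** [stationary] compares laws of the empirical distribution only. Equality on those events extends
    to the integrals of functions measurable for the sigma-algebra they generate. *)
Lemma eq_integral_profile (m1 m2 : {measure set (n.-tuple R) -> \bar R}) f :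
  (m1 setT < +oo)%E ->
  (forall A, measurable A -> m1 (@empirical_ccdf R n @^-1` A) = m2 (@empirical_ccdf R n @^-1` A)) ->
  measurable_fun setT (f : profile_space -> \bar R) -> (forall z, (0 <= f z)%E) ->
  (\int[m1]_z f z = \int[m2]_z f z)%E.
Proof.
move=> m1T m12 mf f0.
have mid : measurable_fun setT (id : n.-tuple R -> profile_space).
  apply: (@measurability _ _ _ profile_space setT _ ccdf_events) => //.
  move=> _ [_ [A mA <-] <-]; rewrite !setTI.
  by rewrite -[X in measurable X]setTI; exact: measurable_empirical_ccdf.
have pushE (m : {measure set (n.-tuple R) -> \bar R}) : (\int[m]_z f z =
    \int[measure_function_pushforward__canonical__measure_function_Measure m mid]_z f z)%E.
  by rewrite (ge0_integral_pushforward mid).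
rewrite !pushE; apply: eq_measure_integral => A mA _.
apply: (@g_sigma_algebra_measure_unique _ _ profile_space ccdf_events _ (fun=> setT)) => //.
- by move=> B GB; exact: sub_sigma_algebra.
- by move=> _; exists setT => //; rewrite setTI preimage_setT.
- by rewrite bigcup_const.
- move=> _ _ [B mB <-] [B' mB' <-]; exists (B `&` B'); first exact: measurableI.
  by rewrite !setTI preimage_setI.
- by move=> _ [B mB <-]; rewrite setTI; exact: m12.
Qed.

End SymmetricFunctions.

Section CenteredKernel.
Context {R : realType} {J : finType} {c : job_classes R J} {n : nat} {rate : R}
  {p : J -> R} {d : measure_display} {Omega : measurableType d}
  {P : probability Omega R} (D : driving c n rate p P).
Hypotheses (p_ge0 : forall j, 0 <= p j) (p_sum : \sum_j p j = 1)
  (d_le_n : forall j, (jc_d c j <= n)%N).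
Local Open Scope ereal_scope.

Let Q := transition p_ge0 p_sum d_le_n.

Section FixedTime.
Variable t : R.
Hypothesis t_ge0 : (0 <= t)%R.

Let mcentered w : measurable_fun setT (centered D w t).
Proof. exact: measurable_centered. Qed.

Let centered_law (w : n.-tuple R) : {measure set (n.-tuple R) -> \bar R} :=
  measure_function_pushforward__canonical__measure_function_Measure P (mcentered w).

Let measurable_centered_law A : measurable A -> measurable_fun setT (centered_law ^~ A).
Proof.
move=> mA; have mI : measurable_fun setT (EFin \o \1_A : n.-tuple R -> \bar R).
  by apply/measurable_EFinP; exact: measurable_indic.
have I0 z : 0 <= (EFin \o \1_A : n.-tuple R -> \bar R) z by rewrite lee_fin.
apply: (@eq_measurable_fun _ _ _ _ setT (fun w => \sum_(m <oo) P (first_passage D t m) *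
    iter m (average Q) (EFin \o \1_A) (centering w))).
  by move=> w _; rewrite -prob_centered.
apply: ge0_emeasurable_sum => [m w _ _|m _].
  by rewrite mule_ge0// iter_average_ge0.
apply: emeasurable_funM; first exact: measurable_cst.
apply: measurableT_comp; first exact: measurable_iter_average.
by apply: measurable_centering; exact: measurable_id.
Qed.

HB.instance Definition _ := isKernel.Build _ _ _ _ R centered_law measurable_centered_law.

Let centered_law_prob w : centered_law w setT = 1.
Proof. exact: probability_setT. Qed.

HB.instance Definition _ :=
  Kernel_isProbability.Build _ _ _ _ R centered_law centered_law_prob.

Definition semigroup : R.-pker (n.-tuple R) ~> (n.-tuple R) := centered_law.

Lemma average_semigroup w f : (forall z, 0 <= f z) -> measurable_fun setT f ->
  average semigroup f w = \sum_(m <oo) P (first_passage D t m) *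
    iter m (average Q) f (centering w).
Proof.
move=> f0 mf; rewrite -expectation_centered//.
exact: (@ge0_integral_pushforward _ _ _ _ _ _ (mcentered w) P
  setT f measurableT mf (fun z _ => f0 z)).
Qed.

End FixedTime.

End CenteredKernel.

Section MomentBound.
Context {R : realType} {J : finType} {c : job_classes R J} {n : nat} {rate : R}
  {p : J -> R} {d : measure_display} {Omega : measurableType d}
  {P : probability Omega R} (D : driving c n rate p P).
Hypotheses (p_ge0 : forall j, 0 <= p j) (p_sum : \sum_j p j = 1)
  (d_le_n : forall j, (jc_d c j <= n)%N) (rate_gt0 : 0 < rate) (n_gt0 : (0 < n)%N).
Local Open Scope ereal_scope.

Let Q := transition p_ge0 p_sum d_le_n.

Variables (eps C : R).
Hypotheses (eps_gt0 : (0 < eps)%R) (C_gt0 : (0 < C)%R).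
Hypothesis drift : forall w : n.-tuple R, (\sum_(i < n) tnth w i = 0)%R ->
  average Q (EFin \o @energy R n) w + (eps * Phi1 w)%:E <= (energy w + C)%:E.

Definition payoff (w : n.-tuple R) : R := (eps * Phi1 (centering w))%R.

Lemma payoff_ge0 w : (0 <= payoff w)%R.
Proof. by rewrite mulr_ge0 ?(ltW eps_gt0)// mulr_ge0 ?invr_ge0// sumr_ge0. Qed.

Lemma measurable_payoff : measurable_fun setT payoff.
Proof.
apply: measurable_funM => //; apply: measurable_funM => //.
apply: measurableT_comp; first exact: measurable_l1norm.
by apply: measurable_centering; exact: measurable_id.
Qed.

Section Capped.
Variable K : R.
Hypothesis K_ge0 : (0 <= K)%R.

Definition capped (w : n.-tuple R) : R := Num.min (energy (centering w)) K.

(** Above level K no gain is claimed: [capped] is at its maximum K there and cannot increase on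
    average. *)
Definition capped_payoff (w : n.-tuple R) : R :=
  if (energy (centering w) <= K)%R then payoff w else 0%R.

Let menergyc : measurable_fun setT (fun w : n.-tuple R => energy (centering w)).
Proof. by apply: measurable_energy; apply: measurable_centering; exact: measurable_id. Qed.

Lemma measurable_capped : measurable_fun setT capped.
Proof. exact: measurable_minr. Qed.

Lemma capped_ge0 w : (0 <= capped w)%R.
Proof. by rewrite le_min energy_ge0. Qed.

Lemma capped_le w : (capped w <= K)%R.
Proof. by rewrite ge_min lexx orbT. Qed.

Lemma measurable_capped_payoff : measurable_fun setT capped_payoff.
Proof.
apply: measurable_fun_ifT => //; last exact: measurable_payoff.
exact: measurable_fun_ler.
Qed.

Lemma capped_payoff_ge0 w : (0 <= capped_payoff w)%R.
Proof. by rewrite /capped_payoff; case: ifP => // _; exact: payoff_ge0. Qed.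

Let capped0 z : 0 <= (EFin \o capped) z. Proof. by rewrite lee_fin capped_ge0. Qed.

Let mcapped : measurable_fun setT (EFin \o capped).
Proof. by apply/measurable_EFinP; exact: measurable_capped. Qed.

Lemma capped_drift w :
  average Q (EFin \o capped) w + (capped_payoff w)%:E <= (capped w + C)%:E.
Proof.
rewrite /capped_payoff {2}/capped; case: (leP (energy (centering w)) K) => wK.
  apply: (@le_trans _ _ (average Q (EFin \o @energy R n) (centering w) + (payoff w)%:E)).
    apply: leeD2r; rewrite average_centering//; last 2 first.
    - by move=> z; rewrite lee_fin energy_ge0.
    - by apply/measurable_EFinP; exact: measurable_energy.
    apply: le_average => //; first by apply/measurable_EFinP; exact: measurable_energy.
    by move=> z; rewrite lee_fin ge_min energy_centering_le.
  exact: drift (sum_centering w).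
rewrite adde0; apply: (@le_trans _ _ K%:E); last by rewrite lee_fin lerDl ltW.
rewrite -[leRHS](average_cst Q K w); apply: le_average => // z.
by rewrite lee_fin capped_le.
Qed.

Lemma iter_capped_le m w : iter m (average Q) (EFin \o capped) w <= (capped w + m%:R * C)%:E.
Proof.
elim: m w => [|m IH] w; first by rewrite mul0r addr0.
rewrite iterS; apply: (@le_trans _ _ (average Q (fun z => (capped z)%:E + (m%:R * C)%:E) w)).
  apply: le_average => [z||| z]; rewrite ?EFinD//.
  - exact: iter_average_ge0.
  - exact: measurable_iter_average.
  - by apply: emeasurable_funD => //.
have mC0 : (0 <= m%:R * C)%R by rewrite mulr_ge0// ltW.
rewrite averageD//.
rewrite [X in _ + X]average_cst -natr1 mulrDl mul1r [(m%:R * C + C)%R]addrC addrA EFinD.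
rewrite leeD2r//; apply: le_trans (capped_drift w).
by rewrite leeDl// lee_fin capped_payoff_ge0.
Qed.

(** The payoff is collected at the first step only, while each of the steps costs at most C. *)
Lemma iter_capped_drift m w :
  iter m.+1 (average Q) (EFin \o capped) w + (capped_payoff w)%:E <=
  (capped w + m.+1%:R * C)%:E.
Proof.
have mC0 : (0 <= m%:R * C)%R by rewrite mulr_ge0// ltW.
apply: (@le_trans _ _ (average Q (EFin \o capped) w + (m%:R * C)%:E + (capped_payoff w)%:E)).
  rewrite leeD2r// iterS -[X in _ + X](average_cst Q _ w) -averageD//.
  apply: le_average => [z|||z]; last exact: iter_capped_le.
  - exact: iter_average_ge0.
  - exact: measurable_iter_average.
  - by apply: emeasurable_funD => //.
rewrite addeAC -natr1 mulrDl mul1r [(m%:R * C + C)%R]addrC addrA EFinD leeD2r//.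
exact: capped_drift.
Qed.

Lemma capped_centering w : capped (centering w) = capped w.
Proof. by rewrite /capped centeringK. Qed.

Lemma capped_payoff_centering w : capped_payoff (centering w) = capped_payoff w.
Proof. by rewrite /capped_payoff /payoff centeringK. Qed.

Section FixedTime.
Variable t : R.
Hypothesis t_ge0 : (0 <= t)%R.
Let q : R := (1 - expR (- rate * t))%R.
Hypothesis q_le : (q <= 4^-1)%R.

Let S := semigroup D p_ge0 p_sum d_le_n t_ge0.

Let q_ge0 : (0 <= q)%R. Proof. exact: early_rate_ge0 D t t_ge0. Qed.

Let pr m : R := fine (P (first_passage D t m)).

Let prE m : P (first_passage D t m) = (pr m)%:E.
Proof. by rewrite fineK// fin_num_measure//; exact: measurable_first_passage. Qed.

Let pr_ge0 m : (0 <= pr m)%R. Proof. by rewrite fine_ge0. Qed.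

Lemma prob_no_arrival : P (first_passage D t 0) = (1 - q)%:E.
Proof.
have -> : first_passage D t 0 = ~` (gap D 0 @^-1` `]-oo, t]).
  apply/seteqP; split => o; rewrite /first_passage/= /arrival_time big_ord1 in_itv/=.
    by move=> [to _]; apply/negP; rewrite -ltNge.
  by move/negP; rewrite -ltNge.
rewrite probability_setC ?gap_cdf//.
by rewrite -[X in measurable X]setTI; exact: gap_measurable.
Qed.

Let pr_le m : (pr m <= q ^+ m)%R.
Proof. by rewrite -lee_fin -prE; exact: (first_passage_le D p_ge0 p_sum d_le_n). Qed.

Let sum_pr : \sum_(m <oo) P (first_passage D t m) = 1.
Proof.
pose w0 : n.-tuple R := [tuple 0%R | i < n].
rewrite -[RHS](average_cst S 1 w0) average_semigroup//.
by apply: eq_eseriesr => m _; rewrite iter_average_cst mule1.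
Qed.

Let sum_pr_le N : (\sum_(0 <= m < N) pr m <= 1)%R.
Proof.
rewrite -lee_fin -sumEFin -sum_pr (eq_bigr (fun m => P (first_passage D t m))).
  exact: nneseries_lim_ge.
by move=> m _; rewrite prE.
Qed.

(** Since [m <= 2 ^ m] and [pr m <= q ^+ m], the left side is at most (2 q)^m, and q <= 1/4 bounds
    this by 4 q / 2^m for m >= 1. Summation bounds the mean number of arrivals by 8 q, the origin of
    the constant 8. *)
Let mean_pr_le m : (m%:R * pr m <= geometric (4 * q) 2^-1 m)%R.
Proof.
rewrite /=; case: m => [|m]; first by rewrite mul0r mulr1 mulr_ge0.
apply: (@le_trans _ _ ((2 ^ m.+1)%:R * q ^+ m.+1)%R).
  by apply: ler_pM => //; rewrite ler_nat ltnW// ltn_expl.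
rewrite natrX -exprMn exprS [X in (_ <= X)%R](_ : _ = (2 * q * 2^-1 ^+ m)%R); last first.
  by rewrite exprS; field.
apply: ler_wpM2l; first by rewrite mulr_ge0.
have q2 : (2 * q <= 2^-1)%R.
  by rewrite (_ : 2^-1 = 2 * 4^-1)%R ?ler_wpM2l//; field.
have q20 : (0 <= 2 * q)%R by rewrite mulr_ge0.
by apply: lerXn2r; rewrite ?nnegrE ?invr_ge0.
Qed.

(** The payoff is earned when some arrival occurs, which has probability q, and the cost is C times
    the mean number of arrivals. Both are proportional to q, so the arrival rate drops out of the
    final bound. *)
Lemma semigroup_drift w :
  average S (EFin \o capped) w + (q * capped_payoff w)%:E <=
  (capped w + 8 * q * C)%:E.
Proof.
pose f := capped_payoff w; have f0 : (0 <= f)%R by exact: capped_payoff_ge0.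
(* Granting f without any arrival as well, and compensating by [(1 - q) * f] on the right, treats
   all terms of the series alike. *)
suff : average S (EFin \o capped) w + f%:E <=
    (capped w + 8 * q * C + (1 - q) * f)%:E.
  have : 0 <= average S (EFin \o capped) w by exact: average_ge0.
  case: (average _ _ _) => [r|//|//] _; rewrite -!EFinD !lee_fin -/f; lra.
have term m : P (first_passage D t m) * (iter m (average Q) (EFin \o capped) (centering w) + f%:E) <=
    (pr m * capped w + C * geometric (4 * q) 2^-1 m + (m == 0%N)%:R * ((1 - q) * f))%:E.
  case: m => [|m].
    rewrite prob_no_arrival /= capped_centering -EFinD -EFinM lee_fin.
    rewrite -[pr 0%N]/(fine (P _)) prob_no_arrival/= mul1r mulrDr addrAC lerDl.
    by rewrite !mulr_ge0// ltW.
  rewrite prE -/f mul0r addr0.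
  apply: (@le_trans _ _ ((pr m.+1)%:E * (capped w + m.+1%:R * C)%:E)).
    rewrite lee_wpmul2l ?lee_fin//.
    rewrite -(capped_centering w) /f -(capped_payoff_centering w).
    exact: iter_capped_drift.
  rewrite -EFinM lee_fin mulrDr lerD2l.
  rewrite (_ : pr m.+1 * (m.+1%:R * C) = C * (m.+1%:R * pr m.+1))%R; last by ring.
  by apply: ler_wpM2l; [exact: ltW|exact: mean_pr_le].
have iter0 m : 0 <= iter m (average Q) (EFin \o capped) (centering w).
  exact: iter_average_ge0.
have -> : average S (EFin \o capped) w + f%:E = \sum_(m <oo)
    P (first_passage D t m) * (iter m (average Q) (EFin \o capped) (centering w) + f%:E).
  rewrite (eq_eseriesr (g := fun m => P (first_passage D t m) *
    iter m (average Q) (EFin \o capped) (centering w) + f%:E * P (first_passage D t m))).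
    rewrite nneseriesD//; last 2 first.
    - by move=> m _ _; rewrite mule_ge0.
    - by move=> m _ _; rewrite mule_ge0.
    by rewrite nneseriesZl// sum_pr mule1 average_semigroup.
  by move=> m _; rewrite ge0_muleDr// [f%:E * _]muleC.
apply: lime_le.
  by apply: is_cvg_nneseries => m _ _; rewrite mule_ge0// adde_ge0.
apply: nearW => N; apply: (le_trans (lee_sum _ (fun m _ => term m))).
rewrite sumEFin lee_fin !big_split/=; apply: lerD; first apply: lerD.
- by rewrite -mulr_suml ler_piMl ?capped_ge0.
- rewrite -mulr_sumr mulrC; apply: ler_wpM2r; first exact: ltW.
  apply: (le_trans (@geometric_le_lim R N (4 * q) 2^-1 _ _ _)) => //.
  + by rewrite mulr_ge0.
  + by rewrite ger0_norm// invf_lt1// ltr1n.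
  have half : (1 - 2^-1 = 2^-1 :> R)%R by rewrite [X in (X - _)%R](splitr 1) mul1r addrK.
  by rewrite half invrK mulrAC -natrM.
have q1 : (0 <= 1 - q)%R by rewrite subr_ge0 (le_trans q_le)// invf_le1// ler1n.
rewrite -mulr_suml; apply: ler_piMl; first by rewrite mulr_ge0.
case: N => [|N]; first by rewrite big_geq.
by rewrite big_nat_recl//= big1 ?addr0.
Qed.

(** The process takes centered values, so the centering inside [capped] can be removed; the function
    obtained depends on the empirical distribution only, where stationarity applies. *)
Lemma semigroup_uncapped w :
  average S (EFin \o capped) w =
  average S (fun z => (Num.min (energy z) K)%:E) w.
Proof.
have mS (f : n.-tuple R -> \bar R) : (forall z, 0 <= f z) -> measurable_fun setT f ->
    average S f w = \int[P]_o f (centered D w t o).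
  by move=> f0 mf; rewrite average_semigroup// expectation_centered.
rewrite mS// mS//.
- by apply: eq_integral => o _; rewrite /= /capped centeredE centering_chain.
- by move=> z; rewrite lee_fin le_min energy_ge0.
- by apply/measurable_EFinP; apply: measurable_minr => //; exact: measurable_energy.
Qed.

End FixedTime.

(** [stationary] compares time t with the process at time 0, not with nu itself; this inequality
    leads back to [capped] under nu. *)
Lemma semigroup0_capped w :
  (capped w)%:E <= average (semigroup D p_ge0 p_sum d_le_n (lexx 0%R)) (EFin \o capped) w.
Proof.
rewrite average_semigroup//; apply: (@le_trans _ _ (\sum_(0 <= m < 1)
    P (first_passage D 0%R m) * iter m (average Q) (EFin \o capped) (centering w))).
  rewrite big_nat1 prob_no_arrival//.
  by rewrite mulr0 expR0 subrr subr0 mul1e /= capped_centering.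
by apply: nneseries_lim_ge => m _ _; rewrite mule_ge0// iter_average_ge0.
Qed.

Variable nu : probability (n.-tuple R) R.
Hypothesis nu_stationary : stationary P (centered_ccdf D) nu.

Lemma integral_semigroup_capped t (t_ge0 : (0 <= t)%R) :
  \int[nu]_w average (semigroup D p_ge0 p_sum d_le_n t_ge0) (EFin \o capped) w =
  \int[nu]_w average (semigroup D p_ge0 p_sum d_le_n (lexx 0%R)) (EFin \o capped) w.
Proof.
pose f (z : n.-tuple R) : \bar R := (Num.min (energy z) K)%:E.
have f0 z : 0 <= f z by rewrite lee_fin le_min energy_ge0.
have mf : measurable_fun setT f.
  by apply/measurable_EFinP; apply: measurable_minr => //; exact: measurable_energy.
under eq_integral do rewrite semigroup_uncapped.
under [RHS]eq_integral do rewrite semigroup_uncapped.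
rewrite -(integral_push_measure nu (semigroup D p_ge0 p_sum d_le_n t_ge0) f0 mf).
rewrite -(integral_push_measure nu (semigroup D p_ge0 p_sum d_le_n (lexx 0%R)) f0 mf).
have finite : nu setT < +oo.
  exact: (le_lt_trans (@probability_le1 _ _ _ nu _ measurableT) (ltry 1)).
apply: eq_integral_profile; last exact: f0.
- by move: finite; rewrite -(push_measureT nu (semigroup D p_ge0 p_sum d_le_n t_ge0)).
- by move=> A mA; exact: (nu_stationary t_ge0 mA).
- apply/measurable_EFinP; apply: measurable_minr => //.
  exact: (measurable_energy_profile n_gt0).
Qed.

Lemma integral_capped_payoff : \int[nu]_w (capped_payoff w)%:E <= (8 * C)%:E.
Proof.
(* Then [rate * t] is 1/4, and exp(-x) >= 1 - x gives q <= 1/4. *)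
pose t : R := ((4 * rate)^-1)%R.
have t_gt0 : (0 < t)%R by rewrite invr_gt0 mulr_gt0.
have t_ge0 := ltW t_gt0.
pose q : R := (1 - expR (- rate * t))%R.
have tE : (- rate * t = - 4^-1)%R by rewrite /t invfM mulrCA mulNr divff ?gt_eqF// mulrN1.
have q_gt0 : (0 < q)%R by rewrite subr_gt0 expR_lt1 tE oppr_lt0 invr_gt0.
have q_le : (q <= 4^-1)%R.
  by rewrite lerBlDr -lerBlDl (le_trans _ (expR_ge1Dx _))// tE.
pose S := semigroup D p_ge0 p_sum d_le_n t_ge0.
have mS : measurable_fun setT (average S (EFin \o capped)) by exact: measurable_average.
have S0 w : 0 <= average S (EFin \o capped) w by exact: average_ge0.
have mpay : measurable_fun setT (EFin \o capped_payoff).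
  by apply/measurable_EFinP; exact: measurable_capped_payoff.
have pay0 w : 0 <= (EFin \o capped_payoff) w by rewrite lee_fin capped_payoff_ge0.
have main : \int[nu]_w (average S (EFin \o capped) w + (q * capped_payoff w)%:E) <=
    \int[nu]_w ((capped w)%:E + (8 * q * C)%:E).
  apply: ge0_le_integral => //.
  - by move=> w _; rewrite adde_ge0// lee_fin mulr_ge0 ?capped_payoff_ge0// ltW.
  - by apply: emeasurable_funD => //; apply/measurable_EFinP; apply: measurable_funM => //; exact: measurable_capped_payoff.
  - by apply: emeasurable_funD.
  by move=> w _; rewrite -EFinD; exact: semigroup_drift.
have C8 : (0 <= 8 * q * C)%R by rewrite !mulr_ge0// ltW.
move: main; rewrite [X in X <= _]ge0_integralD//; last 2 first.
- by move=> w _; rewrite lee_fin mulr_ge0 ?capped_payoff_ge0// ltW.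
- by apply/measurable_EFinP; apply: measurable_funM => //; exact: measurable_capped_payoff.
rewrite [X in _ <= X]ge0_integralD//.
rewrite [X in _ <= _ + X]integral_cst// [X in _ * X](_ : _ = 1) ?mule1; last exact: probability_setT.
under [X in _ + X <= _]eq_integral do rewrite EFinM.
rewrite ge0_integralZl//; last by rewrite lee_fin ltW.
rewrite integral_semigroup_capped => main.
have I_le : \int[nu]_w (capped w)%:E <= \int[nu]_w
    average (semigroup D p_ge0 p_sum d_le_n (lexx 0%R)) (EFin \o capped) w.
  apply: ge0_le_integral.
  - exact: measurableT.
  - by move=> w _; exact: capped0.
  - exact: mcapped.
  - exact: measurable_average.
  - by move=> w _; exact: semigroup0_capped.
have I_fin : \int[nu]_w (capped w)%:E \is a fin_num.
  rewrite ge0_fin_numE; last by apply: integral_ge0 => w _; exact: capped0.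
  apply: (@le_lt_trans _ _ (\int[nu]_w K%:E)).
    apply: ge0_le_integral.
    - exact: measurableT.
    - by move=> w _; exact: capped0.
    - exact: mcapped.
    - exact: measurable_cst.
    - by move=> w _; rewrite lee_fin capped_le.
  by rewrite integral_cst// [X in _ * X](_ : _ = 1) ?mule1 ?ltry//; exact: probability_setT.
(* The cap makes the mean of [capped] finite, so it can be cancelled, leaving q times the mean
   payoff at most 8 q C. *)
have := le_trans (leeD2r _ I_le) main; rewrite leeD2lE// => qpay.
have -> : (8 * C)%:E = (q^-1)%:E * (8 * q * C)%:E :> \bar R.
  by rewrite -EFinM; congr EFin; field; rewrite gt_eqF.
- by rewrite lee_pdivlMl.
- by move=> w _; rewrite lee_fin capped_payoff_ge0.
- by move=> w _; exact: capped0.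
Qed.

End Capped.

Variable nu : probability (n.-tuple R) R.
Hypothesis nu_stationary : stationary P (centered_ccdf D) nu.

Lemma stationary_moment_bound :
  \int[nu]_w (Phi1 (centering w))%:E <= (8 * C / eps)%:E.
Proof.
have pay_lim w : (payoff w)%:E = limn (fun K : nat => (capped_payoff K%:R w)%:E).
  apply/esym/cvg_lim => //; apply: cvg_near_cst.
  exists (Num.bound (energy (centering w))) => // K /= bK.
  rewrite /capped_payoff ifT//; apply/ltW/(lt_le_trans (archi_boundP (energy_ge0 _))).
  by rewrite ler_nat.
have pay_bound : \int[nu]_w (payoff w)%:E <= (8 * C)%:E.
  under eq_integral do rewrite pay_lim.
  rewrite monotone_convergence//.
  - apply: lime_le; last by apply: nearW => K; exact: integral_capped_payoff.
    apply: ereal_nondecreasing_is_cvgn => K K' KK'; apply: ge0_le_integral => //.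
    + by move=> w _; rewrite lee_fin capped_payoff_ge0.
    + by apply/measurable_EFinP; exact: measurable_capped_payoff.
    + by apply/measurable_EFinP; exact: measurable_capped_payoff.
    move=> w _; rewrite lee_fin /capped_payoff; case: ifP => [wK|_].
      by rewrite ifT// (le_trans wK)// ler_nat.
    exact: capped_payoff_ge0.
  - by move=> K; apply/measurable_EFinP; exact: measurable_capped_payoff.
  - by move=> K w _; rewrite lee_fin capped_payoff_ge0.
  - move=> w _ K K' KK'; rewrite lee_fin /capped_payoff; case: ifP => [wK|_].
      by rewrite ifT// (le_trans wK)// ler_nat.
    exact: capped_payoff_ge0.
have mPhi : measurable_fun setT (fun w : n.-tuple R => (Phi1 (centering w))%:E).
  apply/measurable_EFinP; apply: measurable_funM => //.
  apply: measurableT_comp; first exact: measurable_l1norm.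
  by apply: measurable_centering; exact: measurable_id.
move: pay_bound; under eq_integral do rewrite /payoff EFinM.
rewrite ge0_integralZl//.
- have -> : (8 * C / eps)%:E = (eps^-1)%:E * (8 * C)%:E by rewrite -EFinM mulrC.
  by rewrite lee_pdivlMl.
- by move=> w _; rewrite lee_fin mulr_ge0 ?invr_ge0// sumr_ge0.
- by rewrite lee_fin ltW.
Qed.

End MomentBound.

Theorem theorem16p1 (R : realType) (J : finType) (c : job_classes R J)
  (lam : nat -> R) (pin : nat -> J -> R) (pi_ : J -> R)
  (lam_gt0 : forall n, 0 < lam n)
  (pin_ge0 : forall n j, 0 <= pin n j)
  (pin_sum : forall n, \sum_(j : J) pin n j = 1)
  (pin_cvg : forall j, (fun n => pin n j) @ \oo --> pi_ j)
  (mean_gt0 : forall j, (0 < \int[jc_F c j]_x (nth 0 x 0)%:E)%E)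
  (mean_fin : forall j, (\int[jc_F c j]_x (nth 0 x 0)%:E < +oo)%E)
  (nonzero : exists j,
    (jc_F c j [set x : (jc_d c j).-tuple R |
       (jc_k c j <= count (fun y => y == 0%R) x)%N] < 1)%E)
  (second_moment : forall j,
    (\int[jc_F c j]_x ((nth 0 x 0) ^+ 2)%:E < +oo)%E)
  (nontrivial : exists j,
    [/\ 0 < pi_ j,
        (jc_k c j < jc_d c j)%N,
        (0 < jc_F c j [set x : (jc_d c j).-tuple R |
           (0 < max_entry x - kth_smallest (jc_k c j) x)%R])%E &
        (jc_F c j [set x : (jc_d c j).-tuple R |
           (jc_k c j <= count (fun y => y == 0%R) x)%N] < 1)%E])
  (small : exists n0 : nat, forall n, (n0 <= n)%N ->
    forall (d : measure_display) (Omega : measurableType d)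
      (P : probability Omega R) (D : driving c n (lam n * n%:R) (pin n) P)
      (C : R), 0 < C ->
    small_set D [set q | l1norm q <= C]) :
  exists Cbar : R, 0 < Cbar /\ exists nbar : nat, forall n, (nbar <= n)%N ->
    forall lamn : R, 0 < lamn ->
    forall (d : measure_display) (Omega : measurableType d)
      (P : probability Omega R) (D : driving c n (lamn * n%:R) (pin n) P),
    positive_harris_recurrent P (centered_ccdf D) /\
    forall nu : probability (n.-tuple R) R,
      stationary P (centered_ccdf D) nu ->
      (\int[nu]_w (Phi1 (centering w))%:E <= Cbar%:E)%E.
Proof.
have [j0 [pi0 _ high low]] := nontrivial; have [n0 small_n] := small.
have [eps [C [eps_gt0 C_gt0 [nbar [nbar_gt0 drift]]]]] :=
  energy_drift second_moment pin_ge0 pin_sum pin_cvg pi0 high low.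
exists (8 * C / eps); split; first by rewrite divr_gt0// mulr_gt0.
exists (maxn n0 nbar) => n; rewrite geq_max => /andP[n0n nbarn] lamn lamn_gt0 d Omega P D.
have [d_le_n driftn] := drift n nbarn.
have n_gt0 : (0 < n)%N by exact: leq_trans nbarn.
have rate_gt0 : 0 < lamn * n%:R by rewrite mulr_gt0// ltr0n.
have rate'_gt0 : 0 < lam n * n%:R by rewrite mulr_gt0// ltr0n.
split; last first.
  by move=> nu nu_stat; apply: (stationary_moment_bound rate_gt0 n_gt0 eps_gt0 C_gt0 (driftn d_le_n) nu_stat).
(* Smallness is invoked once, for the ball of radius [foster_radius] and for the driving rescaled to
   the rate [lam n * n]. The minorization obtained involves the jump chain only and is valid for
   every rate. *)
have [q [M [q_gt0 q_lt1 M_gt0 minor]]] := small_minorized (pin_ge0 n) (pin_sum n) d_le_n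
  rate'_gt0 (small_n n n0n _ _ _ (rescale_driving D rate_gt0 rate'_gt0) _
    (foster_radius_gt0 eps_gt0 C_gt0 n_gt0)).
have minorized w A : foster_ball eps C w -> measurable A -> _ :=
  fun Bw mA => minor w A Bw.1 Bw.2 mA.
split.
  apply: (@harris_recurrent_ccdf _ _ _ _ _ _ _ _ _ D (pin_ge0 n) (pin_sum n) d_le_n
    (@foster_function R n C) (foster_ball eps C) rate_gt0 _ _ _ _ M M_gt0).
  - exact: measurable_foster_function.
  - by move=> w; exact: foster_function_ge0.
  - exact: measurable_foster_ball.
  - move=> w Bw; have := foster_drift eps_gt0 C_gt0 n_gt0 (driftn d_le_n) w.
    by rewrite indicE memNset// mulr0 adde0.
  - move=> A mA MA; exact: (minorized_reach q_gt0 q_lt1 minorized).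
have [pi pi_inv] := exists_stationary_law eps_gt0 C_gt0 n_gt0 (driftn d_le_n)
  q_gt0 q_lt1 M_gt0 minorized.
by exists pi; exact: (invariant_stationary D pi_inv).
Qed.
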